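(* For every integer $n>0$ there exist a planar polygon $\Omega\subset\mathbb{R}^2$ and a triangulation $T$ of $\Omega$ such that the space $X(\Omega,T)$ of geodesic triangulations of $\Omega$ with combinatorial type $T$ has non-trivial $n$-th homotopy group; that is, $\pi_n(X(\Omega,T),x_0)\neq 0$ for some basepoint $x_0\in X(\Omega,T)$.
   Context: An embedded $m$-sided polygon $\Omega$ in the plane is determined by a map $\phi: V_B=\{v_1,\dots,v_m,v_{m+1}=v_1\}\to\mathbb{R}^2$ together with the line segments joining $\phi(v_i)$ to $\phi(v_{i+1})$, which form a simple closed curve; $\Omega$ also denotes the closed region bounded by this curve. The polygon is not assumed convex. A triangulation $T=(V,E,F)$ of $\Omega$ is a (topological) simplicial triangulation of the closed disk $\Omega$ with vertices $V=V_I\cup V_B$, edges $E$ and faces $F$, where $V_I$ is the set of interior vertices and $V_B$ is the set of boundary vertices; the boundary edges are those joining consecutive vertices $v_i,v_{i+1}$. A geodesic triangulation of $\Omega$ with combinatorial type $T$ is an embedding $\psi$ of the $1$-skeleton of $T$ in the plane, with image in $\Omega$, such that $\psi$ agrees with $\phi$ on $V_B$ and $\psi$ maps every edge in $E$ to a line segment, parametrized by (a constant multiple of) arc length. The set of all such maps is denoted $X(\Omega,T)$. Each geodesic triangulation is uniquely determined by the positions of the interior vertices, so $X(\Omega,T)$ is identified with a subset of $\Omega^{|V_I|}\subset\mathbb{R}^{2|V_I|}$ and is given the subspace topology. *)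

(* Defs.v *)
From HB Require Import structures.
From mathcomp Require Import all_boot all_order all_algebra.
From mathcomp Require Import all_classical all_reals all_analysis.

Set Implicit Arguments.
Unset Strict Implicit.
Unset Printing Implicit Defensive.

Import Order.TTheory GRing.Theory Num.Theory.
Import numFieldNormedType.Exports.

Local Open Scope classical_set_scope.
Local Open Scope ring_scope.

(* Topological spaces X are given as subsets of an ambient topological space,
   with the subspace topology. *)

Definition homeomorphism (S T : topologicalType) (A : set S) (B : set T)
    (f : S -> T) : Prop :=
  [/\ set_bij A B f,
      {within A, continuous f} &
      exists2 g : T -> S, {in A, cancel f g} & {within B, continuous g}].

Definition embedding (S T : topologicalType) (A : set S) (f : S -> T) : Prop :=
  homeomorphism A (f @` A) f.

Section HomotopyGroup.
Variables (R : realType) (n : nat) (Y : topologicalType) (X : set Y) (x0 : Y).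

Definition cube : set 'rV[R]_n := [set t | forall i, 0 <= t ord0 i <= 1].

Definition cube_boundary : set 'rV[R]_n :=
  [set t | cube t /\ exists i, t ord0 i = 0 \/ t ord0 i = 1].

(* Maps of pairs (I^n, dI^n) -> (X, x0); values outside I^n are irrelevant. *)
Definition based_map (f : 'rV[R]_n -> Y) : Prop :=
  [/\ {within cube, continuous f},
      f @` cube `<=` X &
      forall t, cube_boundary t -> f t = x0].

Definition based_homotopic (f g : 'rV[R]_n -> Y) : Prop :=
  exists H : R * 'rV[R]_n -> Y,
    [/\ {within `[0, 1] `*` cube, continuous H},
        forall s, s \in `[0, 1] -> based_map (fun t => H (s, t)),
        forall t, cube t -> H (0, t) = f t &
        forall t, cube t -> H (1, t) = g t].

Definition homotopy_class (f : 'rV[R]_n -> Y) : set ('rV[R]_n -> Y) :=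
  [set g | based_map g /\ based_homotopic f g].

(* The underlying set of pi_n(X, x0); its neutral element is pi_unit. *)
Definition pi_ : set (set ('rV[R]_n -> Y)) :=
  [set homotopy_class f | f in based_map].

Definition pi_unit : set ('rV[R]_n -> Y) := homotopy_class (fun=> x0).

Definition pi_nontrivial : Prop := exists2 c, pi_ c & c <> pi_unit.

End HomotopyGroup.

Arguments pi_nontrivial R n {Y} X x0.

Section Polygon.
Variable R : realType.
Notation plane := 'rV[R]_2.

Definition segment_path N (a b : 'rV[R]_N) (t : R) : 'rV[R]_N :=
  (1 - t) *: a + t *: b.

Definition segment N (a b : 'rV[R]_N) : set 'rV[R]_N :=
  segment_path a b @` `[0, 1].

Variables (m : nat) (phi : 'I_m -> plane).

(* The closed broken line through phi is a simple closed curve: its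
   parametrization by 'I_m x [0, 1[ is injective.  ordS is the cyclic
   successor. *)
Definition embedded_polygon : Prop :=
  (2 < m)%N /\
  forall (i j : 'I_m) (s t : R), 0 <= s < 1 -> 0 <= t < 1 ->
    segment_path (phi i) (phi (ordS i)) s =
    segment_path (phi j) (phi (ordS j)) t ->
    i = j /\ s = t.

Definition polygon_curve : set plane :=
  \bigcup_i segment (phi i) (phi (ordS i)).

(* The curve together with the bounded components of its complement. *)
Definition polygon_region : set plane :=
  polygon_curve `|`
  [set x | (~` polygon_curve) x /\
           bounded_set (connected_component (~` polygon_curve) x)].

End Polygon.

(* Abstract simplicial complexes of dimension at most 2 on the vertex set 'I_N;
   every vertex is a simplex. *)
Record complex2 (N : nat) := Complex2 {
  edges : {set {set 'I_N}};
  faces : {set {set 'I_N}};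
  card_edge : forall e, e \in edges -> #|e| = 2%N;
  card_face : forall f, f \in faces -> #|f| = 3%N;
  face_edges : forall (f e : {set 'I_N}),
    f \in faces -> e \subset f -> #|e| = 2%N -> e \in edges
}.

Section Realization.
Variables (R : realType) (N : nat).

Definition vertex_point (v : 'I_N) : 'rV[R]_N := delta_mx ord0 v.

Definition closed_simplex (s : {set 'I_N}) : set 'rV[R]_N :=
  [set x | [/\ forall v, 0 <= x ord0 v,
               \sum_v x ord0 v = 1 &
               forall v, v \notin s -> x ord0 v = 0]].

Definition skeleton1 (T : complex2 N) : set 'rV[R]_N :=
  \bigcup_v closed_simplex [set v]%SET `|`
  \bigcup_(e in [set e | e \in edges T]) closed_simplex e.

Definition realization (T : complex2 N) : set 'rV[R]_N :=
  skeleton1 T `|` \bigcup_(f in [set f | f \in faces T]) closed_simplex f.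

End Realization.

(* A triangulation with k interior vertices of an m-gon has vertex set
   'I_(k + m): lshift m i is the i-th interior vertex and rshift k j is the
   boundary vertex v_j. *)
Section GeodesicTriangulations.
Variables (R : realType) (m k : nat).
Variables (phi : 'I_m -> 'rV[R]_2) (T : complex2 (k + m)).

Definition interior_vertex (i : 'I_k) : 'I_(k + m) := lshift m i.
Definition boundary_vertex (j : 'I_m) : 'I_(k + m) := rshift k j.

Definition boundary_edge (j : 'I_m) : {set 'I_(k + m)} :=
  [set boundary_vertex j; boundary_vertex (ordS j)]%SET.

(* The homeomorphism need not be affine on the simplices, except that it
   carries boundary edges onto sides of the polygon. *)
Definition is_triangulation : Prop :=
  (forall j, boundary_edge j \in edges T) /\
  exists h : 'rV[R]_(k + m) -> 'rV[R]_2,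
    [/\ homeomorphism (realization (R:=R) T) (polygon_region phi) h,
        forall j, h (vertex_point R (boundary_vertex j)) = phi j &
        forall j, h @` closed_simplex (boundary_edge j) =
                  segment (phi j) (phi (ordS j))].

(* In the 1-skeleton each edge carries its affine parameter, so that mapping
   an edge to a segment proportionally to arc length is being affine on it. *)
Definition geodesic_triangulation (psi : 'rV[R]_(k + m) -> 'rV[R]_2) : Prop :=
  [/\ embedding (skeleton1 (R:=R) T) psi,
      psi @` skeleton1 T `<=` polygon_region phi,
      forall j, psi (vertex_point R (boundary_vertex j)) = phi j &
      forall u v : 'I_(k + m), [set u; v]%SET \in edges T ->
        forall t : R, 0 <= t <= 1 ->
          psi (segment_path (vertex_point R u) (vertex_point R v) t) =
          segment_path (psi (vertex_point R u)) (psi (vertex_point R v)) t].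

(* The space X(Omega, T): row i is the position of the i-th interior vertex. *)
Definition geodesic_space : set 'M[R]_(k, 2) :=
  [set x | exists2 psi, geodesic_triangulation psi &
           forall i, psi (vertex_point R (interior_vertex i)) = row i x].

End GeodesicTriangulations.

(* Main.v *)
Require Import Defs.
From HB Require Import structures.
From mathcomp Require Import all_boot all_order all_algebra.
From mathcomp Require Import all_classical all_reals all_analysis.
From mathcomp Require Import zify ring lra.
Set Implicit Arguments.
Unset Strict Implicit.
Unset Printing Implicit Defensive.
Import Order.TTheory GRing.Theory Num.Theory.
Import numFieldNormedType.Exports.
Local Open Scope classical_set_scope.
Local Open Scope ring_scope.

(** Put N = n + 1.  For a suitable polygon and triangulation there are a
    continuous family F of vertex positions, indexed by the cube [-1, 1]^N, and
    an affine map tilt from vertex positions to R^N such that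
    - F(y) is a geodesic triangulation as soon as the maximum norm of y is at
      least 2/5;
    - every coordinate of tilt (F y) has the sign of the same coordinate of y;
    - tilt does not vanish on the space of geodesic triangulations.
    Hence F maps the boundary of the cube, an n-sphere, to that space, and tilt
    o F is homotopic to the inclusion of this sphere in R^N minus the origin, so
    that the sphere is not null-homotopic.  sphere_obstruction makes this
    precise: from a null-homotopy one builds a vector field on a cube of
    dimension n + 1 that has no zero and whose coordinates have opposite signs on
    opposite faces, which contradicts the theorem of Poincare and Miranda
    (poincare_miranda).  The latter rests on a Sperner lemma for cubical grids,
    proved by counting flags modulo two (cube_lemma).

    The triangulation is a corridor of N copies of one gadget, each translated
    by (24, -6) with respect to the previous one; the gadget has three interior
    vertices a, b, c that form a triangle, and tilt records 2 x + y for the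
    vertex a = (x, y) of every gadget, in the coordinates of the gadget.  If all
    tilts vanish, the gadgets block one another (tilt_neq0).  The leftmost face
    forces the first a below the origin of its gadget, hence, by the equation
    2 x + y = 0, to the right of it.  This forces b up and to the left, as b must
    also stay on the inner side of one of the sides of the polygon; b drags c upwards, and c
    leaves no place for the next a but below the origin of its own gadget.  The
    argument moves on from gadget to gadget until it reaches the right end of
    the corridor, where a is replaced by a vertex of the polygon that is not
    below the origin.  A gadget with nonzero tilt theta has a slack of order
    theta^2, whichever the sign of theta, and one such gadget is enough to
    satisfy all the constraints (family_gadget, family_positive).

    What remains is to relate embeddings with orientations of triangles.  If
    all faces are positively oriented, then the piecewise linear map of the
    whole complex is a homeomorphism onto the region (pl_map_inj,
    geometric_is_triangulation): the numbers of crossings of a vertical ray with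
    the sides of the faces add up to that of the polygon, so that the open faces
    are disjoint and cover the interior.  Conversely, in a geodesic
    triangulation of the corridor all faces are positively oriented
    (geodesic_positive): no vertex lies in a foreign face, therefore faces that
    share an edge are on opposite sides of it, and the orientation spreads from
    the leftmost face to all others.  Both directions use that the polygon is
    bounded by two x-monotone chains, which makes its region the set of points
    between two piecewise linear functions (mono_polygon_region). *)

(** * A cubical Sperner lemma *)

Section CubeLemma.
Variables (d M : nat) (a : nat -> {ffun 'I_d -> nat} -> bool).
Implicit Types (v w : {ffun 'I_d -> nat}) (S : {set 'I_d}).

Lemma addFF (x : 'F_2) : x + x = 0.
Proof. by apply: addrr_pchar2; rewrite pchar_Fp. Qed.

Lemma sum_sym0 S (f : 'I_d -> 'I_d -> 'F_2) :
  (forall i j, f i j = f j i) -> \sum_(i in S) \sum_(j in S :\ i) f i j = 0.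
Proof.
move=> fC.
have split_lt i : \sum_(j in S :\ i) f i j =
    \sum_(j in S | (i < j)%N) f i j + \sum_(j in S | (j < i)%N) f i j.
  rewrite (bigID (fun j : 'I_d => i < j)%N) /=; congr (_ + _); apply: eq_bigl => j;
    by rewrite !inE -val_eqE /=; case: ltngtP => //=; rewrite ?andbF ?andbT.
under eq_bigr do rewrite split_lt.
rewrite big_split /=.
rewrite [X in _ + X](exchange_big_dep (fun j => j \in S)) /=; last by move=> i j _ /andP[].
rewrite -big_split /= big1 // => i iS.
rewrite [X in _ + X](_ : _ = \sum_(j in S | (i < j)%N) f i j) ?addFF //.
by apply: eq_big => [j|j _]; [rewrite iS | exact: fC].
Qed.

(** The direction j is a number rather than an ordinal, because recursions run
    over it; for j >= d both operations are trivial. *)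
Definition bump_at v (j : nat) : {ffun 'I_d -> nat} := [ffun i => v i + (val i == j)]%N.
Definition set_at v (j c : nat) : {ffun 'I_d -> nat} :=
  [ffun i => if val i == j then c else v i].

Lemma bump_atC v i j : bump_at (bump_at v i) j = bump_at (bump_at v j) i.
Proof. by apply/ffunP => k; rewrite !ffunE addnAC. Qed.

Lemma bump_set_at v i j c : i != j ->
  bump_at (set_at v j c) i = set_at (bump_at v i) j c.
Proof.
move=> ij; apply/ffunP => k; rewrite !ffunE; case: eqP => // kj.
by rewrite kj eq_sym (negbTE ij) addn0.
Qed.

Lemma bump_set_eq v j c : bump_at (set_at v j c) j = set_at v j c.+1.
Proof. by apply/ffunP => k; rewrite !ffunE; case: eqP => // _; rewrite ?addn0 ?addn1. Qed.

Definition val2 (b : bool) : 'F_2 := (b : nat)%:R.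

(** The number modulo two of increasing lattice paths from v that take m steps in
    distinct directions of S and such that, for every i < m, the label a i
    differs at the two ends of the (m - i)-th step.  The labels are consumed
    downwards, so that the recursion drops the highest one. *)
Fixpoint flag_sum (m : nat) S v : 'F_2 :=
  if m is m'.+1 then
    \sum_(j in S) (val2 (a m' (bump_at v j)) + val2 (a m' v)) *
       flag_sum m' (S :\ j) (bump_at v j)
  else 1.

Lemma setD1C S i j : S :\ i :\ j = S :\ j :\ i.
Proof. by apply/setP => k; rewrite !inE andbCA. Qed.

Lemma exchange_D1 S (f : 'I_d -> 'I_d -> 'F_2) :
  \sum_(i in S) \sum_(j in S :\ i) f i j = \sum_(j in S) \sum_(i in S :\ j) f i j.
Proof.
rewrite (exchange_big_dep (fun j => j \in S)) /=; last by move=> i j _ /setD1P[].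
apply: eq_bigr => j jS; apply: eq_bigl => i; rewrite !inE jS andbT andbC eq_sym.
by case: (i \in S); rewrite ?andbF ?andbT.
Qed.

(** In the expansion of the first step, the terms that depend symmetrically on
    two directions cancel in pairs. *)
Lemma flag_sum_closed m S v :
  \sum_(j in S) flag_sum m (S :\ j) (bump_at v j) =
  \sum_(j in S) flag_sum m (S :\ j) v.
Proof.
elim: m S v => [|m IH] S v //=.
pose w i j := bump_at (bump_at v i) j.
pose f i j := flag_sum m (S :\ i :\ j) (w i j).
have fC i j : f i j = f j i by rewrite /f /w setD1C bump_atC.
have -> : \sum_(l in S) \sum_(j in S :\ l) (val2 (a m (w l j)) + val2 (a m (bump_at v l))) * f l j
   = \sum_(l in S) val2 (a m (bump_at v l)) * \sum_(j in S :\ l) f l j.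
  under eq_bigr do under eq_bigr do rewrite mulrDl.
  under eq_bigr do rewrite big_split /=.
  rewrite big_split /= sum_sym0 ?add0r; last first.
    by move=> i j; rewrite fC /w bump_atC.
  by apply: eq_bigr => l _; rewrite mulr_sumr.
rewrite exchange_D1.
have inner j : j \in S -> \sum_(i in S :\ j) (val2 (a m (bump_at v j)) + val2 (a m v)) *
     flag_sum m (S :\ i :\ j) (bump_at v j) =
     (val2 (a m (bump_at v j)) + val2 (a m v)) * \sum_(i in S :\ j) f j i.
  move=> jS; rewrite -mulr_sumr; congr (_ * _).
  rewrite (IH (S :\ j) (bump_at v j) : \sum_(i in S :\ j) f j i = _).
  by apply: eq_bigr => i _; rewrite setD1C.
rewrite (eq_bigr _ inner); under [RHS]eq_bigr do rewrite mulrDl.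
rewrite big_split /= -[X in _ + X]mulr_sumr.
by rewrite [X in _ * X]sum_sym0 // mulr0 addr0.
Qed.

Lemma flag_sumS m S v : flag_sum m.+1 S v =
  \sum_(j in S) (val2 (a m (bump_at v j)) * flag_sum m (S :\ j) (bump_at v j) +
                 val2 (a m v) * flag_sum m (S :\ j) v).
Proof.
rewrite /=; under eq_bigr do rewrite mulrDl.
by rewrite !big_split /= -!mulr_sumr flag_sum_closed.
Qed.

(** On a face of the grid on which the label of the normal direction is constant
    no step can change that label. *)
Lemma flag_sum_face m S v j c : (j < m)%N -> (forall i, i \in S -> val i != j) ->
  (forall i : 'I_d, val i = j -> v i = c) -> (exists i : 'I_d, val i = j) ->
  (forall w w', (forall i : 'I_d, val i = j -> w i = c) ->
     (forall i : 'I_d, val i = j -> w' i = c) -> a j w = a j w') ->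
  flag_sum m S v = 0.
Proof.
move=> jm jS vc jd aj; elim: m S v jm jS vc => // m IH S v jm jS vc.
have bc i : i \in S -> forall k : 'I_d, val k = j -> bump_at v i k = c.
  move=> iS k kj; rewrite ffunE (vc _ kj) kj; have := jS _ iS.
  by rewrite eq_sym => /negbTE ->; rewrite addn0.
rewrite /= big1 // => i iS; move: jm; rewrite ltnS leq_eqVlt => /orP[/eqP jm|jm].
  by rewrite -jm (aj _ v (bc _ iS) vc) addFF mul0r.
rewrite [X in _ * X]IH ?mulr0 //; last exact: bc.
by move=> k /setD1P[_ /jS].
Qed.

Lemma flag_sum_neq0 m S v : flag_sum m S v != 0 -> forall j, (j < m)%N ->
  exists r s : {ffun 'I_d -> nat}, [/\ forall i, (v i <= r i <= v i + (i \in S))%N,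
                  forall i, (v i <= s i <= v i + (i \in S))%N & a j r != a j s].
Proof.
elim: m S v => // m IH S v /= nz j jm.
have [i iS] : exists2 i, i \in S &
   (val2 (a m (bump_at v i)) + val2 (a m v)) * flag_sum m (S :\ i) (bump_at v i) != 0.
  apply/exists_inP; apply: contraNT nz; rewrite negb_exists_in => /forall_inP h.
  by rewrite big1 // => i /h; rewrite negbK => /eqP.
rewrite mulf_eq0 negb_or => /andP[n1 n2].
have bnd k : (v k <= bump_at v i k <= v k + (k \in S))%N.
  rewrite ffunE leq_addr leq_add2l; case: eqP => // /val_inj ->; by rewrite iS.
move: jm; rewrite ltnS leq_eqVlt => /orP[/eqP ->|jm].
  exists (bump_at v i), v; split=> // [k|]; first by rewrite leqnn leq_addr.
  by apply: contraNneq n1 => ->; rewrite addFF.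
have [r [s [hr hs rs]]] := IH _ _ n2 _ jm.
have bnd2 (t : {ffun 'I_d -> nat}) k :
    (bump_at v i k <= t k <= bump_at v i k + (k \in S :\ i))%N ->
    (v k <= t k <= v k + (k \in S))%N.
  rewrite !ffunE !inE -val_eqE; case: (eqVneq (val k) i) => [/val_inj ->|_] /=.
    by rewrite iS; lia.
  by rewrite addn0.
by exists r, s; split=> // k; exact: bnd2.
Qed.

(** The coordinates from m on are parameters, so that faces of the box lead to
    sums of the same kind. *)
Fixpoint box_sum (m : nat) (F : {ffun 'I_d -> nat} -> 'F_2) v : 'F_2 :=
  if m is m'.+1 then \sum_(c < M) box_sum m' F (set_at v m' c) else F v.

Lemma eq_box_sum m F G v : F =1 G -> box_sum m F v = box_sum m G v.
Proof. by move=> FG; elim: m v => [|m IH] v /=; [exact: FG | apply: eq_bigr]. Qed.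

Lemma box_sumD m F G v : box_sum m (fun w => F w + G w) v = box_sum m F v + box_sum m G v.
Proof.
by elim: m v => //= m IH v; under eq_bigr do rewrite IH; rewrite big_split.
Qed.

Lemma box_sum_sum m (I : finType) (P : pred I) (F : I -> _ -> 'F_2) v :
  box_sum m (fun w => \sum_(i | P i) F i w) v = \sum_(i | P i) box_sum m (F i) v.
Proof.
by elim: m v => //= m IH v; under eq_bigr do rewrite IH; rewrite exchange_big.
Qed.

Lemma box_sum_bump m F v j : (m <= j)%N ->
  box_sum m (fun w => F (bump_at w j)) v = box_sum m F (bump_at v j).
Proof.
elim: m v => //= m IH v mj; apply: eq_bigr => c _; rewrite IH ?(ltnW mj) //.
by rewrite bump_set_at // eq_sym ltn_eqF.
Qed.

Lemma box_sum_eq0 m F v j c : (m <= j)%N -> (forall i : 'I_d, val i = j -> v i = c) ->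
  (forall w, (forall i : 'I_d, val i = j -> w i = c) -> F w = 0) -> box_sum m F v = 0.
Proof.
elim: m v => [|m IH] v mj vc Fc /=; first exact: Fc.
apply: big1 => k _; apply: IH => // [|i ij]; first exact: ltnW.
by rewrite ffunE ij gtn_eqF //; apply: vc.
Qed.

Lemma box_sum_telescope m F v :
  box_sum m.+1 (fun w => F (bump_at w m) + F w) v =
  box_sum m F (set_at v m M) + box_sum m F (set_at v m 0).
Proof.
rewrite /=; under eq_bigr do rewrite box_sumD box_sum_bump // bump_set_eq.
elim: (M) => [|n IH]; first by rewrite big_ord0 addFF.
rewrite big_ord_recr /= IH addrC addrA; congr (_ + _).
by rewrite -addrA addFF addr0.
Qed.

(** A discrete divergence theorem modulo two, without flux through the faces. *)
Lemma box_sum_flux m j F v : (j < m)%N -> (j < d)%N ->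
  (forall w, (forall i : 'I_d, val i = j -> w i = M) -> F w = 0) ->
  (forall w, (forall i : 'I_d, val i = j -> w i = 0%N) -> F w = 0) ->
  box_sum m (fun w => F (bump_at w j) + F w) v = 0.
Proof.
move=> jm jd FM F0; elim: m v jm => // m IH v; rewrite ltnS leq_eqVlt => /orP[/eqP jm|jm].
  rewrite -jm box_sum_telescope (@box_sum_eq0 _ _ _ j M) ?(@box_sum_eq0 _ _ _ j 0%N) ?addr0 //;
  by move=> i ij; rewrite ffunE ij eqxx.
by rewrite /= big1 // => c _; apply: IH.
Qed.

Lemma box_sum_neq0 m F v : box_sum m F v != 0 ->
  exists2 w, F w != 0 &
    forall i : 'I_d, ((i < m)%N -> (w i < M)%N) /\ ((m <= i)%N -> w i = v i).
Proof.
elim: m v => [|m IH] v /= nz; first by exists v.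
have [c nzc] : exists c : 'I_M, box_sum m F (set_at v m c) != 0.
  apply/existsP; apply: contraNT nz; rewrite negb_exists => /forallP h.
  by rewrite big1 // => i _; have := h i; rewrite negbK => /eqP.
have [w Fw wv] := IH _ nzc; exists w => // i; have [wlt weq] := wv i.
split=> [|mi].
  rewrite ltnS leq_eqVlt => /orP[/eqP im|/wlt //].
  have mi : (m <= i)%N by rewrite im.
  by rewrite (weq mi) ffunE /= im eqxx.
by rewrite (weq (ltnW mi)) ffunE gtn_eqF.
Qed.

Hypothesis a_lo : forall j v, (j < d)%N -> (forall i : 'I_d, val i = j -> v i = 0%N) -> a j v = false.
Hypothesis a_hi : forall j v, (j < d)%N -> (forall i : 'I_d, val i = j -> v i = M) -> a j v = true.

(** By induction on the dimension: flag_sumS writes the sum over the box as a sum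
    of divergences, one for each direction.  The flux vanishes on all pairs of
    opposite faces, except for the last direction, where it leaves the sum of the
    same kind over a face of dimension m. *)
Lemma box_flag_sum m v : (m <= d)%N -> (forall i : 'I_d, (m <= val i)%N -> v i = M) ->
  box_sum m (flag_sum m [set i : 'I_d | (val i < m)%N]%SET) v = 1.
Proof.
elim: m v => [|m IH] v md vM //.
have jE : [set i : 'I_d | (val i < m.+1)%N]%SET :\ Ordinal md = [set i : 'I_d | (val i < m)%N]%SET.
  by apply/setP => i; rewrite !inE -val_eqE /= ltnS ltn_neqAle.
rewrite (eq_box_sum _ _ (flag_sumS m _)) box_sum_sum.
rewrite (bigD1 (Ordinal md)) ?inE ?leqnn //= [X in _ + X]big1 ?addr0; last first.
  move=> i; rewrite inE -val_eqE /= ltnS => /andP[im inm].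
  have {im inm} im : (i < m)%N by rewrite ltn_neqAle inm im.
  pose S := [set i : 'I_d | (val i < m.+1)%N]%SET :\ i.
  apply: (@box_sum_flux m.+1 i (fun w => val2 (a m w) * flag_sum m S w)) => //; first exact: ltnW.
    move=> w wM; rewrite (@flag_sum_face m S w i M) ?mulr0 //.
    - by move=> k; rewrite !inE => /andP[].
    - by exists i.
    - by move=> u u' hu hu'; rewrite !a_hi.
  move=> w wM; rewrite (@flag_sum_face m S w i 0%N) ?mulr0 //.
  - by move=> k; rewrite !inE => /andP[].
  - by exists i.
  - by move=> u u' hu hu'; rewrite !a_lo.
rewrite jE.
rewrite [LHS](box_sum_telescope m (fun w => val2 (a m w) * flag_sum m [set i : 'I_d | (val i < m)%N]%SET w) v).
rewrite [X in _ + X](@box_sum_eq0 _ _ _ m 0%N) //; first last.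
  by move=> w w0; rewrite a_lo // mul0r.
  by move=> i im; rewrite ffunE im eqxx.
have vM' (i : 'I_d) : (m <= val i)%N -> set_at v m M i = M.
  by rewrite ffunE leq_eqVlt eq_sym; case: eqP => //= _ /vM.
rewrite addr0 -[RHS](IH (set_at v m M)) // ?(ltnW md) //.
suff H k (u : {ffun 'I_d -> nat}) : (k <= m)%N -> (forall i : 'I_d, val i = m -> u i = M) ->
    box_sum k (fun w => val2 (a m w) * flag_sum m [set i : 'I_d | (val i < m)%N]%SET w) u =
    box_sum k (flag_sum m [set i : 'I_d | (val i < m)%N]%SET) u.
  by apply: H => // i im; rewrite ffunE im eqxx.
elim: k u => [|k IHk] u km um /=; first by rewrite a_hi // mul1r.
apply: eq_bigr => c _; apply: IHk => [|i im]; first exact: ltnW.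
by rewrite ffunE im gtn_eqF //; exact: um.
Qed.

(** Since the sum over the box is odd, some small cube carries a flag, and along
    the flag all labels change. *)
Lemma cube_lemma : exists v : {ffun 'I_d -> nat}, (forall i, v i < M)%N /\
  forall j, (j < d)%N -> exists r s : {ffun 'I_d -> nat}, [/\ forall i, (v i <= r i <= (v i).+1)%N,
     forall i, (v i <= s i <= (v i).+1)%N & a j r != a j s].
Proof.
have := @box_flag_sum d [ffun => M] (leqnn d); rewrite (_ : [set i | _]%SET = [set: 'I_d]%SET).
  move=> h; have /box_sum_neq0[w Fw wM] : box_sum d (flag_sum d [set: 'I_d]%SET) [ffun => M] != 0.
    by rewrite h ?oner_neq0 // => i; rewrite ffunE.
  exists w; split=> [i|j jd]; first by have [wlt _] := wM i; exact: wlt (ltn_ord i).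
  have [r [s [hr hs rs]]] := flag_sum_neq0 Fw jd; exists r, s.
  by split=> // i; [have := hr i | have := hs i]; rewrite inE addn1.
by apply/setP => i; rewrite !inE ltn_ord.
Qed.
End CubeLemma.

(** * The theorem of Poincare and Miranda *)

Section PoincareMiranda.
Variables (R : realType) (d : nat) (f : 'rV[R]_d -> 'rV[R]_d).
Hypothesis f_cont : continuous f.
Hypothesis f_lo : forall x i, cube x -> x ord0 i = 0 -> f x ord0 i <= 0.
Hypothesis f_hi : forall x i, cube x -> x ord0 i = 1 -> 0 <= f x ord0 i.

Definition grid_point (M : nat) (v : {ffun 'I_d -> nat}) : 'rV[R]_d :=
  \row_i ((v i)%:R / M%:R).

Lemma cube_grid_point M (v : {ffun 'I_d -> nat}) : (0 < M)%N -> (forall i, v i <= M)%N -> cube (grid_point M v).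
Proof.
move=> M0 vM i; rewrite mxE divr_ge0 ?ler0n //= ler_pdivrMr ?ltr0n // mul1r ler_nat; exact: vM.
Qed.

(** The label of a grid point in direction j tells whether the j-th coordinate of
    f is positive there; on the faces it is prescribed, which is compatible
    with the weak inequalities for f. *)
Lemma sign_change M : (0 < M)%N -> exists x : 'rV[R]_d, cube x /\
  forall i, exists r s : 'rV[R]_d, [/\ forall k, `|r ord0 k - x ord0 k| <= M%:R^-1,
     forall k, `|s ord0 k - x ord0 k| <= M%:R^-1, f r ord0 i <= 0 & 0 <= f s ord0 i].
Proof.
move=> M0; pose MR : R := M%:R; have MR0 : 0 < MR by rewrite ltr0n.
pose a (j : nat) (v : {ffun 'I_d -> nat}) :=
  [exists i : 'I_d, (val i == j) && ((v i == M) || ((v i != 0%N) && (0 < f (grid_point M v) ord0 i)))].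
have aE (i : 'I_d) v : a i v = ((v i == M) || ((v i != 0%N) && (0 < f (grid_point M v) ord0 i))).
  apply/existsP/idP => [[k /andP[/eqP/val_inj ->]] //|h]; by exists i; rewrite eqxx.
have alo j (v : {ffun 'I_d -> nat}) : (j < d)%N -> (forall i : 'I_d, val i = j -> v i = 0%N) -> a j v = false.
  by move=> jd h; rewrite (aE (Ordinal jd)) h //= eq_sym gtn_eqF.
have ahi j (v : {ffun 'I_d -> nat}) : (j < d)%N -> (forall i : 'I_d, val i = j -> v i = M) -> a j v = true.
  by move=> jd h; rewrite (aE (Ordinal jd)) h //= eqxx.
have [v [vM hv]] := @cube_lemma d M a alo ahi.
exists (grid_point M v); split; first by apply: cube_grid_point => // i; apply: ltnW.
move=> i; have [r [s [hr hs]]] := hv i (ltn_ord i).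
have dist (t : {ffun 'I_d -> nat}) : (forall k : 'I_d, (v k <= t k <= (v k).+1)%N) ->
    (forall k, `|grid_point M t ord0 k - grid_point M v ord0 k| <= M%:R^-1) /\
    cube (grid_point M t).
  move=> ht; split=> [k|]; last first.
    by apply: cube_grid_point => // k; have := ht k; have := vM k; lia.
  rewrite !mxE -mulrBl normrM normfV (ger0_norm (ltW MR0)) -[leRHS]mul1r ler_pM2r ?invr_gt0 //.
  have /andP[h1 h2] := ht k; rewrite -natrB // normr_nat lern1; lia.
have [[dr cr] [ds cs]] := (dist _ hr, dist _ hs).
have neg t : cube (grid_point M t) -> a i t = false -> f (grid_point M t) ord0 i <= 0.
  move=> ct; rewrite aE => /negbT; rewrite negb_or negb_and negbK => /andP[_ /orP[/eqP t0|]].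
    by apply: f_lo => //; rewrite mxE t0 mul0r.
  by rewrite -leNgt.
have pos t : cube (grid_point M t) -> a i t = true -> 0 <= f (grid_point M t) ord0 i.
  move=> ct; rewrite aE => /orP[/eqP tM|/andP[_ /ltW //]].
  by apply: f_hi => //; rewrite mxE tM divff ?gt_eqF.
case ar : (a i r); case as_ : (a i s) => // _.
  by exists (grid_point M s), (grid_point M r); split=> //; [exact: neg | exact: pos].
by exists (grid_point M r), (grid_point M s); split=> //; [exact: neg | exact: pos].
Qed.

Lemma compact_cube : compact (@cube R d).
Proof.
have -> : @cube R d = [set v : 'rV_d | forall i, `[0 : R, 1]%classic (v ord0 i)].
  by apply/seteqP; split=> x h i; have := h i; rewrite /= in_itv.
by apply: (@rV_compact _ d (fun=> `[0 : R, 1]%classic)) => i; exact: segment_compact.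
Qed.

(** The grid points near which all coordinates of f change their signs cluster
    at a zero. *)
Theorem poincare_miranda : exists2 x, cube x & f x = 0.
Proof.
pose near_change (M : nat) (x : 'rV[R]_d) := cube x /\
  forall i, exists r s : 'rV[R]_d, [/\ forall k, `|r ord0 k - x ord0 k| <= M.+1%:R^-1,
     forall k, `|s ord0 k - x ord0 k| <= M.+1%:R^-1, f r ord0 i <= 0 & 0 <= f s ord0 i].
have [x_ hx] : {x_ : nat -> 'rV[R]_d & forall M, near_change M (x_ M)}.
  by apply: choice => M; exact: sign_change.
have [] := @compact_cube (x_ @ \oo) _; first by exists 0%N => // M _; case: (hx M).
move=> x [cx clx]; exists x => //; apply/rowP => i; rewrite mxE.
apply/eqP; apply: contraT => fx0.
have [e e0 he] : exists2 e, 0 < e & forall y : 'rV[R]_d, (forall k, `|x ord0 k - y ord0 k| < e) ->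
    `|f x ord0 i - f y ord0 i| < `|f x ord0 i|.
  have : continuous (fun y => f y ord0 i).
    by move=> y; apply: (@continuous_comp _ _ _ f (fun z : 'rV[R]_d => z ord0 i)); [exact: f_cont | exact: coord_continuous].
  move=> /(_ x)/cvgrPdist_lt/(_ `|f x ord0 i|); rewrite normr_gt0 => /(_ fx0).
  move/nbhs_ballP => [e e0 he]; exists e => // y hy; apply: he; split=> // k l.
  by rewrite ord1; exact: hy.
have e20 : 0 < e / 2 by rewrite divr_gt0.
have [M0 hM0] : exists M0 : nat, (M0.+1%:R)^-1 < e / 2.
  have [M0 hM] := ltr_add_invr (e20 : 0 < e / 2); exists M0; by rewrite add0r in hM.
have [||y [[M /= MM0 <-] bxM]] := clx [set x_ M | M in [set M | (M0 <= M)%N]] (ball x (e / 2)).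
- by exists M0 => // M /= hM; exists M.
- exact: nbhsx_ballx.
have [_ /(_ i)[r [s [dr ds fr fs]]]] := hx M.
have small : M.+1%:R^-1 < e / 2.
  by apply: le_lt_trans hM0; rewrite lef_pV2 ?posrE ?ltr0n // ler_nat.
have near (t : 'rV[R]_d) : (forall k, `|t ord0 k - x_ M ord0 k| <= M.+1%:R^-1) ->
    `|f x ord0 i - f t ord0 i| < `|f x ord0 i|.
  move=> dt; apply: he => k; have [_ /(_ ord0 k)] := bxM; rewrite /ball /= => b.
  rewrite (splitr e) (_ : _ - _ = (x ord0 k - x_ M ord0 k) + (x_ M ord0 k - t ord0 k)); last by ring.
  rewrite (le_lt_trans (ler_normD _ _)) // ltrD // distrC; exact: le_lt_trans small.
have := near _ dr; have := near _ ds; move: fx0 fr fs.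
move: (f x ord0 i) (f r ord0 i) (f s ord0 i) => u p q u0 p0 q0.
rewrite !ltr_norml; case: (ger0P u) => u00; lra.
Qed.
End PoincareMiranda.

(** * Continuity and the maximum norm *)

Section Continuity.
Variables (R : realType) (T : topologicalType).
Implicit Types f g : T -> R.

Lemma cont_cst (c : R) : continuous (fun _ : T => c).
Proof. exact: cst_continuous. Qed.
Lemma cont_add f g : continuous f -> continuous g -> continuous (fun x => f x + g x).
Proof. by move=> cf cg x; apply: cvgD; [exact: cf | exact: cg]. Qed.
Lemma cont_opp f : continuous f -> continuous (fun x => - f x).
Proof. by move=> cf x; apply: cvgN; exact: cf. Qed.
Lemma cont_mul f g : continuous f -> continuous g -> continuous (fun x => f x * g x).
Proof. by move=> cf cg x; apply: cvgM; [exact: cf | exact: cg]. Qed.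
Lemma cont_min f g : continuous f -> continuous g ->
  continuous (fun x => Num.min (f x) (g x)).
Proof. by move=> cf cg x; apply: (@continuous_min R T f g x (cf x) (cg x)). Qed.
Lemma cont_max f g : continuous f -> continuous g ->
  continuous (fun x => Num.max (f x) (g x)).
Proof. by move=> cf cg x; apply: (@continuous_max R T f g x (cf x) (cg x)). Qed.
Lemma cont_sum (I : Type) (r : seq I) (P : pred I) (F : I -> T -> R) :
  (forall i, continuous (F i)) -> continuous (fun x => \sum_(i <- r | P i) F i x).
Proof.
move=> cF; elim: r => [|i r IH].
  by under eq_fun do rewrite big_nil; exact: cont_cst.
under eq_fun do rewrite big_cons; case: (P i) => //.
exact: cont_add.
Qed.
Lemma cont_mx m n (h : T -> 'M[R]_(m, n)) :
  (forall i j, continuous (fun x => h x i j)) -> continuous h.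
Proof.
move=> ch x; apply/cvg_ballP => e e0.
have : \forall y \near x, forall ij, ball (h x ij.1 ij.2) e (h y ij.1 ij.2).
  apply: filter_forall => -[i j] /=; have /cvg_ballP := ch i j x; exact.
by apply: filterS => y hy; split=> // i j; exact: (hy (i, j)).
Qed.
Lemma cont_entry m n (h : T -> 'M[R]_(m, n)) i j :
  continuous h -> continuous (fun x => h x i j).
Proof.
move=> ch x; apply: (@continuous_comp _ _ _ h (fun M : 'M[R]_(m, n) => M i j)).
  exact: ch.
exact: coord_continuous.
Qed.
Lemma cont_norm m n (h : T -> 'M[R]_(m, n)) : continuous h -> continuous (fun x => `|h x|).
Proof.
move=> ch x; apply: (@continuous_comp _ _ _ h (fun M : 'M[R]_(m, n) => `|M|)).
  exact: ch.
exact: norm_continuous.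
Qed.
End Continuity.

Lemma cont_id (T : topologicalType) : continuous (fun x : T => x).
Proof. by move=> x. Qed.
Lemma cont_comp (T U V : topologicalType) (f : T -> U) (g : U -> V) :
  continuous f -> continuous g -> continuous (fun x => g (f x)).
Proof. by move=> cf cg x; apply: continuous_comp; [exact: cf | exact: cg]. Qed.

Ltac cont_tac := repeat lazymatch goal with
  | |- continuous (fun _ => ?c) => exact: cont_cst
  | |- continuous (fun x => @?f x + @?g x) => apply: (@cont_add _ _ f g)
  | |- continuous (fun x => - @?f x) => apply: (@cont_opp _ _ f)
  | |- continuous (fun x => @?f x * @?g x) => apply: (@cont_mul _ _ f g)
  | |- continuous (fun x => Num.min (@?f x) (@?g x)) => apply: (@cont_min _ _ f g)
  | |- continuous (fun x => Num.max (@?f x) (@?g x)) => apply: (@cont_max _ _ f g)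
  | |- continuous (fun x => `|@?f x|) => apply: (@cont_norm _ _ _ _ f)
  | |- continuous (fun x => fun_of_matrix (@?h x) ?i ?j) => apply: (@cont_entry _ _ _ _ h i j)
  | |- continuous _ => first [assumption | exact: cont_id]
  | |- _ => first [apply: cont_add | apply: cont_opp | apply: cont_mul | apply: cont_entry
                  | apply: cont_min | apply: cont_max | apply: cont_norm | exact: cont_cst]
  end.

Lemma cont_within (T U V : topologicalType) (A : set U) (g : T -> U) (f : U -> V) :
  continuous g -> {within A, continuous f} -> (forall x, A (g x)) ->
  continuous (fun x => f (g x)).
Proof.
move=> cg /subspace_continuousP cf Ag x W /(cf _ (Ag x)) h.
have := cg x _ h; rewrite /nbhs /=; apply: filterS => y /=; apply; exact: Ag.
Qed.

Section MxNorm.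
Variable R : realType.
Lemma entry_le_norm m n (x : 'M[R]_(m, n)) i j : `|x i j| <= `|x|.
Proof. by rewrite [leRHS]mx_normrE; apply: (le_bigmax _ _ (i, j)). Qed.
Lemma norm_le_entry n (x : 'rV[R]_n) c : 0 <= c -> (forall j, `|x ord0 j| <= c) -> `|x| <= c.
Proof.
move=> c0 h; rewrite [leLHS]mx_normrE; apply: bigmax_le => // -[i j] _ /=.
by rewrite ord1; exact: h.
Qed.
Lemma norm_attained n (x : 'rV[R]_n) : 0 < `|x| -> exists j, `|x ord0 j| = `|x|.
Proof.
move=> x0; have [|[i j] /= h] := @mx_norm_neq0 _ _ _ x; first by rewrite gt_eqF.
by exists j; rewrite (ord1 i) in h; exact/esym.
Qed.
End MxNorm.

(** * Detecting spheres by signs of coordinates *)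

Section SphereObstruction.
Variables (R : realType) (n : nat) (Y : topologicalType) (X : set Y).
Variables (F : 'rV[R]_n.+1 -> Y) (Phi : Y -> 'rV[R]_n.+1).
Hypothesis F_cont : continuous F.
Hypothesis Phi_cont : continuous Phi.
Hypothesis F_in : forall y : 'rV[R]_n.+1, `|y| <= 1 -> 2/5 <= `|y| -> X (F y).
Hypothesis Phi_neq0 : forall x, X x -> Phi x != 0.
Hypothesis Phi_F_ge0 : forall (y : 'rV[R]_n.+1) i, `|y| <= 1 ->
  0 <= y ord0 i -> 0 <= Phi (F y) ord0 i.
Hypothesis Phi_F_le0 : forall (y : 'rV[R]_n.+1) i, `|y| <= 1 ->
  y ord0 i <= 0 -> Phi (F y) ord0 i <= 0.

(** The quotient map from the cube to a sphere that collapses the boundary to the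
    south pole, in a form that is polynomial in u = 2 t - 1 and r = |u|: the
    height is 1 - 2 r, the other coordinates are 2 (1 - r) u.  Its image is near
    the unit sphere of the maximum norm. *)
Definition centred (t : 'rV[R]_n) : 'rV[R]_n := \row_j (2 * t ord0 j - 1).

Definition cube_to_sphere (t : 'rV[R]_n) : 'rV[R]_n.+1 := \row_i
  if unlift ord0 i is Some j then 2 * (1 - `|centred t|) * centred t ord0 j
  else 1 - 2 * `|centred t|.

Definition south : 'rV[R]_n.+1 := \row_i if unlift ord0 i is Some _ then 0 else -1.

Lemma unlift_ord0 m : unlift (@ord0 m) ord0 = None.
Proof. exact: unlift_none. Qed.

Lemma cont_cube_to_sphere : continuous cube_to_sphere.
Proof.
have cc : continuous centred.
  by apply: cont_mx => i j; under eq_fun do rewrite mxE; cont_tac.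
apply: cont_mx => i j; under eq_fun do rewrite mxE.
by case: unliftP => [k|] _; cont_tac.
Qed.

Lemma centred_le1 t : cube t -> `|centred t| <= 1.
Proof. by move=> ct; apply: norm_le_entry => // j; rewrite mxE ler_norml; have := ct j; lra. Qed.

(** The height is large for r <= 3/10 and for r >= 7/10; in between the other
    coordinates are. *)
Lemma sphere_bounds t : cube t ->
  `|cube_to_sphere t| <= 1 /\ 2/5 <= `|cube_to_sphere t|.
Proof.
move=> ct; have r1 := centred_le1 ct; have r0 : 0 <= `|centred t| by [].
split.
  apply: norm_le_entry => // i; rewrite mxE; case: unliftP => [j|] _; last first.
    by rewrite ler_norml; lra.
  rewrite normrM normrM ger0_norm // ger0_norm ?subr_ge0 //.
  have := entry_le_norm (centred t) ord0 j; move: r0 r1.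
  have : 0 <= `|centred t ord0 j| by [].
  move: (`|centred t|) (`|centred t ord0 j|) => r u; nra.
have e0 := entry_le_norm (cube_to_sphere t) ord0 ord0.
rewrite mxE unlift_ord0 in e0.
case: (leP `|centred t| (3/10)) => r3.
  by apply: le_trans e0; rewrite ger0_norm; lra.
have [j hj] : exists j, `|centred t ord0 j| = `|centred t| by apply: norm_attained; lra.
have := entry_le_norm (cube_to_sphere t) ord0 (lift ord0 j).
rewrite mxE liftK normrM normrM ger0_norm // ger0_norm ?subr_ge0 // hj => e1.
case: (leP `|centred t| (7/10)) => r7.
  apply: le_trans e1; move: r3 r7; move: (`|centred t|) => r; nra.
by apply: le_trans e0; rewrite ltr0_norm; lra.
Qed.

Lemma south_boundary t : cube_boundary t -> cube_to_sphere t = south.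
Proof.
move=> [ct [j tj]]; have r1 : `|centred t| = 1.
  apply/le_anti; rewrite centred_le1 //=; have := entry_le_norm (centred t) ord0 j.
  apply: le_trans; rewrite mxE; case: tj => ->; first by rewrite mulr0 sub0r normrN1.
  by rewrite mulr1 ger0_norm; lra.
apply/rowP => i; rewrite !mxE; case: unliftP => [k|] _; rewrite r1; last by ring.
by rewrite subrr mulr0 mul0r.
Qed.

Lemma south_bounds : `|south| <= 1 /\ 2/5 <= `|south|.
Proof.
split.
  by apply: norm_le_entry => // i; rewrite mxE; case: unliftP => [j|] _; rewrite ?normr0 // normrN1.
apply: le_trans (entry_le_norm south ord0 ord0).
by rewrite mxE unlift_ord0 normrN1; lra.
Qed.

Definition clamp01 (c : R) := Num.min 1 (Num.max 0 c).

Lemma clamp01_itv c : 0 <= clamp01 c <= 1.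
Proof. by rewrite /clamp01 le_min ler01 le_max lexx ge_min lexx. Qed.

Lemma clamp01_id c : 0 <= c <= 1 -> clamp01 c = c.
Proof. by move=> /andP[c0 c1]; rewrite /clamp01 max_r // min_r. Qed.

(** Coordinates on the domain of a homotopy.  For x0 from 0 to 1/2 the time runs
    from 0 to 1; for x0 from 1/2 to 1 the time stays 1 and the space cube
    shrinks to its middle half, where the height is nonnegative. *)
Definition fold_time (x : 'rV[R]_n.+1) : R := clamp01 (2 * clamp01 (x ord0 ord0)).
Definition fold_scale (x : 'rV[R]_n.+1) : R := Num.min 1 (3/2 - clamp01 (x ord0 ord0)).
Definition fold_space (x : 'rV[R]_n.+1) : 'rV[R]_n :=
  \row_j (1/2 + (clamp01 (x ord0 (lift ord0 j)) - 1/2) * fold_scale x).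

Lemma fold_scale_itv x : 1/2 <= fold_scale x <= 1.
Proof.
rewrite /fold_scale; have /andP[] := clamp01_itv (x ord0 ord0).
move: (clamp01 _) => c c0 c1; rewrite le_min ge_min lexx /= andbT.
by apply/andP; split; lra.
Qed.

Lemma cube_fold_space x : cube (fold_space x).
Proof.
move=> j; rewrite mxE; have := clamp01_itv (x ord0 (lift ord0 j)).
have := fold_scale_itv x; move: (clamp01 _) (fold_scale x) => c m; nra.
Qed.

(** If f = F o cube_to_sphere were null-homotopic, Phi o H in the coordinates above
    would satisfy the sign conditions of poincare_miranda on all faces: at x0 = 0
    the map is constant with value the south pole, at x0 = 1 it is f near the
    north pole, and laterally it is either constant or f.  It would thus have a
    zero, although Phi has none on X. *)
Lemma sphere_obstruction : pi_nontrivial R n X (F south).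
Proof.
pose f t := F (cube_to_sphere t).
have fc : continuous f by apply: cont_comp => //; exact: cont_cube_to_sphere.
have bf : based_map X (F south) f.
  split; first exact: continuous_subspaceT.
    by move=> _ [t ct <-]; have [] := sphere_bounds ct; exact: F_in.
  by move=> t /south_boundary; rewrite /f => ->.
exists (homotopy_class X (F south) f); first by exists f.
move=> cf.
have : homotopy_class X (F south) f f.
  split=> //; exists (fun st => f st.2); split=> //.
    apply: continuous_subspaceT => st; apply: (@continuous_comp _ _ _ snd f); last exact: fc.
    exact: cvg_snd.
(* H is a homotopy from the constant map to f. *)
rewrite cf => -[_ [H [Hc Hb H0 H1]]].
pose g x := Phi (H (fold_time x, fold_space x)).
have inbox x : ((`[0, 1] : set R) `*` @cube R n) (fold_time x, fold_space x).
  by split; [rewrite /= in_itv /= clamp01_itv | exact: cube_fold_space].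
have gc : continuous g.
  have tc : continuous fold_time by rewrite /fold_time /clamp01; cont_tac.
  have sc : continuous fold_space.
    apply: cont_mx => i j; under eq_fun do rewrite mxE.
    by rewrite /fold_scale /clamp01; cont_tac.
  apply: (@cont_comp _ _ _ (fun x => H (fold_time x, fold_space x)) Phi) => //.
  apply: (@cont_within _ _ _ _ (fun x => (fold_time x, fold_space x)) H _ Hc inbox).
  by move=> x; exact: (cvg_pair (tc x) (sc x)).
have HX s t : 0 <= s <= 1 -> cube t -> X (H (s, t)).
  move=> s01 ct; have [|_ hX _] := Hb s; first by rewrite in_itv.
  by apply: hX; exists t.
have Hbd s t : 0 <= s <= 1 -> cube_boundary t -> H (s, t) = F south.
  by move=> s01; have [|_ _] := Hb s; [rewrite in_itv | apply].
have [sle1 _] := south_bounds.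
have Psouth j : Phi (F south) ord0 (lift ord0 j) = 0.
  by apply/le_anti; rewrite Phi_F_le0 ?Phi_F_ge0 // mxE liftK.
have top x : cube x -> 1/2 <= x ord0 ord0 -> fold_time x = 1.
  move=> cx h; rewrite /fold_time (clamp01_id (cx ord0)) /clamp01 max_r ?min_l; lra.
have bot x : cube x -> x ord0 ord0 <= 1/2 -> fold_scale x = 1.
  by move=> cx h; rewrite /fold_scale (clamp01_id (cx ord0)) min_l; lra.
(* On the lateral faces the folded point is either on the boundary of the cube
   or in the top face, where f has coordinates of the right sign. *)
have side x j e : cube x -> e = 0 \/ e = 1 -> x ord0 (lift ord0 j) = e ->
    g x ord0 (lift ord0 j) = 0 \/
    exists2 t, cube t & g x = Phi (F (cube_to_sphere t)) /\
      (centred t) ord0 j = (2 * e - 1) * fold_scale x.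
  move=> cx e01 xe; case: (leP (x ord0 ord0) (1/2)) => x0.
    left; rewrite /g Hbd ?clamp01_itv //; split; first exact: cube_fold_space.
    exists j; rewrite mxE (clamp01_id (cx _)) bot // xe; case: e01 => ->; [left|right]; lra.
  right; exists (fold_space x); first exact: cube_fold_space.
  rewrite /g top ?ltW // H1; last exact: cube_fold_space.
  split=> //; rewrite !mxE (clamp01_id (cx _)) xe; lra.
have [||x cx gx0] := @poincare_miranda R n.+1 g gc.
- move=> x i cx; case: (unliftP ord0 i) => [j ->|->] xe.
    have [->//|[t ct [-> cj]]] := side x j 0 cx (or_introl erefl) xe.
    apply: Phi_F_le0; first by have [] := sphere_bounds ct.
    rewrite mxE liftK cj; have := centred_le1 ct; have := fold_scale_itv x; nra.
  rewrite /g /fold_time (clamp01_id (cx ord0)) xe mulr0 clamp01_id ?lexx ?ler01 //.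
  rewrite H0; last exact: cube_fold_space.
  by apply: Phi_F_le0 => //; rewrite mxE unlift_ord0; lra.
- move=> x i cx; case: (unliftP ord0 i) => [j ->|->] xe.
    have [->//|[t ct [-> cj]]] := side x j 1 cx (or_intror erefl) xe.
    apply: Phi_F_ge0; first by have [] := sphere_bounds ct.
    rewrite mxE liftK cj; have := centred_le1 ct; have := fold_scale_itv x; nra.
  have ct := cube_fold_space x.
  rewrite /g top ?xe ?H1 //; last lra.
  apply: Phi_F_ge0; first by have [] := sphere_bounds ct.
  rewrite mxE unlift_ord0 subr_ge0.
  suff : `|centred (fold_space x)| <= 1/2 by lra.
  apply: norm_le_entry => [|j]; first lra.
  rewrite !mxE ler_norml /fold_scale (clamp01_id (cx ord0)) xe min_r; last lra.
  have := clamp01_itv (x ord0 (lift ord0 j)); lra.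
have := Phi_neq0 (HX _ _ (clamp01_itv (2 * clamp01 (x ord0 ord0))) (cube_fold_space x)).
by rewrite -/(fold_time x) -/(g x) gx0 eqxx.
Qed.
End SphereObstruction.

(** * Crossings and broken lines in the plane *)

Section Plane.
Variable R : realType.
Notation plane := 'rV[R]_2.
Implicit Types p q r x : plane.

Definition px p : R := p ord0 ord0.
Definition py p : R := p ord0 ord_max.
Definition pt (a b : R) : plane := \row_j if j == ord0 then a else b.

Lemma px_pt a b : px (pt a b) = a. Proof. by rewrite /px mxE. Qed.
Lemma py_pt a b : py (pt a b) = b. Proof. by rewrite /py mxE. Qed.
Lemma plane_eq p q : px p = px q -> py p = py q -> p = q.
Proof.
move=> ex ey; apply/rowP => j; have [->|->] // : j = ord0 \/ j = ord_max.
by case: j => [[|[|]]] //= h; [left|right]; apply: val_inj.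
Qed.
Lemma pxD p q : px (p + q) = px p + px q. Proof. by rewrite /px mxE. Qed.
Lemma pyD p q : py (p + q) = py p + py q. Proof. by rewrite /py mxE. Qed.
Lemma pxZ a p : px (a *: p) = a * px p. Proof. by rewrite /px mxE. Qed.
Lemma pyZ a p : py (a *: p) = a * py p. Proof. by rewrite /py mxE. Qed.
Lemma pxN p : px (- p) = - px p. Proof. by rewrite /px mxE. Qed.
Lemma pyN p : py (- p) = - py p. Proof. by rewrite /py mxE. Qed.

Definition pE := (px_pt, py_pt, pxD, pyD, pxZ, pyZ, pxN, pyN).

Lemma cont_px : continuous px. Proof. exact: coord_continuous. Qed.
Lemma cont_py : continuous py. Proof. exact: coord_continuous. Qed.

(** Twice the signed area of the triangle p q r. *)
Definition orient p q r : R :=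
  (px q - px p) * (py r - py p) - (py q - py p) * (px r - px p).

Lemma orient_rot p q r : orient q r p = orient p q r.
Proof. by rewrite /orient; ring. Qed.
Lemma orientC p q r : orient q p r = - orient p q r.
Proof. by rewrite /orient; ring. Qed.

(** The signed intersection number of the directed edge [p, q[ with the downward
    vertical ray from x.  The half-open convention on abscissas and ordinates
    amounts to moving x infinitesimally up and right, so that
    no general position is ever needed. *)
Definition crossing p q x : R :=
  if px p <= px x < px q then (0 <= orient p q x)%R%:R
  else if px q <= px x < px p then - (orient p q x <= 0)%R%:R else 0.

Lemma crossingC p q x : crossing q p x = - crossing p q x.
Proof.
rewrite /crossing orientC oppr_ge0 oppr_le0.
case: ifP => [/andP[a b]|h]; first by rewrite (lt_geF b) andFb opprK.
by case: ifP => _; rewrite ?opprK ?oppr0.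
Qed.
End Plane.

Section PolyFun.
Variables (R : realType) (P : nat -> 'rV[R]_2).

Definition slope_of j := (py (P j.+1) - py (P j)) / (px (P j.+1) - px (P j)).
(** The function whose graph is the broken line P 0, ..., P k with increasing
    abscissas, extended by constants: every side contributes its slope times the
    width of its part to the left of X. *)
Definition polyfun k (X : R) : R := py (P 0%N) + \sum_(j < k)
  slope_of j * (Num.min (px (P j.+1)) (Num.max (px (P j)) X) - px (P j)).

Lemma cont_polyfun k : continuous (polyfun k).
Proof. by rewrite /polyfun; cont_tac; apply: cont_sum => i; cont_tac. Qed.

Lemma polyfunS k X : polyfun k.+1 X = polyfun k X +
  slope_of k * (Num.min (px (P k.+1)) (Num.max (px (P k)) X) - px (P k)).
Proof. by rewrite /polyfun big_ord_recr /= addrA. Qed.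

Variable k0 : nat.
Hypothesis incr : forall j, (j < k0)%N -> px (P j) < px (P j.+1).

Lemma px_lt i j : (i < j)%N -> (j <= k0)%N -> px (P i) < px (P j).
Proof.
move=> ij; elim: j ij => // j IH; rewrite ltnS leq_eqVlt => /orP[/eqP -> /incr //|ij jk].
exact: lt_trans (IH ij (ltnW jk)) (incr jk).
Qed.

Lemma px_le i j : (i <= j)%N -> (j <= k0)%N -> px (P i) <= px (P j).
Proof. by rewrite leq_eqVlt => /orP[/eqP -> //|ij jk]; exact: ltW (px_lt ij jk). Qed.

Lemma polyfun_right k X : (k <= k0)%N -> px (P k) <= X -> polyfun k X = py (P k).
Proof.
elim: k X => [|k IH] X kk hX; first by rewrite /polyfun big_ord0 addr0.
have h := incr kk; have hk : px (P k) <= X by apply: le_trans hX; exact: ltW.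
rewrite polyfunS IH ?(ltnW kk) // max_r // min_l // /slope_of divfK ?subr_eq0 ?gt_eqF //.
by rewrite addrC subrK.
Qed.

Lemma polyfun_left k k' X : (k <= k')%N -> (k' <= k0)%N -> X <= px (P k) ->
  polyfun k' X = polyfun k X.
Proof.
move=> + + hX; elim: k' => [|k' IH]; first by rewrite leqn0 => /eqP ->.
rewrite leq_eqVlt => /orP[/eqP -> //|]; rewrite ltnS => kk' k'k.
rewrite polyfunS IH ?(ltnW k'k) // max_l ?min_r ?subrr ?mulr0 ?addr0 //.
  exact: ltW (incr k'k).
by apply: le_trans hX _; apply: px_le => //; exact: ltnW.
Qed.

Lemma polyfun_seg j k X : (j < k)%N -> (k <= k0)%N -> px (P j) <= X <= px (P j.+1) ->
  polyfun k X = py (P j) + slope_of j * (X - px (P j)).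
Proof.
move=> jk kk /andP[h1 h2]; rewrite (@polyfun_left j.+1) // polyfunS.
by rewrite polyfun_right // ?max_r ?min_r //; lia.
Qed.

Lemma orient_seg j x : (j < k0)%N ->
  orient (P j) (P j.+1) x =
  (px (P j.+1) - px (P j)) * (py x - (py (P j) + slope_of j * (px x - px (P j)))).
Proof.
move=> jk; have := incr jk; rewrite -subr_gt0 /orient /slope_of => h.
by field; rewrite gt_eqF.
Qed.

Lemma find_seg k X : (k <= k0)%N -> px (P 0%N) <= X < px (P k) ->
  exists2 j, (j < k)%N & px (P j) <= X < px (P j.+1).
Proof.
elim: k => [_ /andP[a b]|k IH kk /andP[a b]]; first by move: (le_lt_trans a b); rewrite ltxx.
case: (ltP X (px (P k))) => h; last by exists k; rewrite ?h.
by have [||j jk hj] := IH; rewrite ?a ?(ltnW kk) //; exists j => //; exact: ltnW.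
Qed.

(** The ray below x meets an x-monotone broken line once, if the line passes below
    x; the half-open convention prevents double counts at the vertices. *)
Lemma sum_crossing x : \sum_(j < k0) crossing (P j) (P j.+1) x =
  ((px (P 0%N) <= px x < px (P k0)) && (polyfun k0 (px x) <= py x))%R%:R.
Proof.
suff H k : (k <= k0)%N -> \sum_(j < k) crossing (P j) (P j.+1) x =
  ((px (P 0%N) <= px x < px (P k)) && (polyfun k (px x) <= py x))%R%:R by exact: H.
elim: k => [_|k IH kk].
  by rewrite big_ord0; case: (leP (px (P 0%N))) => //= h.
rewrite big_ord_recr /= IH ?(ltnW kk) //; have h := incr kk.
have h0 := px_le (leq0n k) (ltnW kk).
rewrite /crossing orient_seg // pmulr_rge0 ?subr_gt0 // subr_ge0.
case: (ltP (px x) (px (P k))) => hx /=.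
  rewrite (lt_geF (lt_trans hx h)) /= addr0 andbT (lt_trans hx h) andbT.
  by rewrite (@polyfun_left k k.+1) // ltW.
rewrite andbF /= add0r (le_trans h0 hx) /=; case: (ltP (px x) (px (P k.+1))) => hx2 /=.
  by rewrite (@polyfun_seg k k.+1) // hx ltW.
by rewrite ?andbF.
Qed.
End PolyFun.

(** * Polygons bounded by two monotone chains *)

Record monotone_chains (R : realType) (kL kU : nat) (L U : nat -> 'rV[R]_2) : Prop :=
  MonotoneChains {
    lower_pos : (0 < kL)%N;
    upper_pos : (0 < kU)%N;
    sides_gt2 : (2 < kL + kU)%N;
    lower_incr : forall j, (j < kL)%N -> px (L j) < px (L j.+1);
    upper_incr : forall j, (j < kU)%N -> px (U j) < px (U j.+1);
    chains_start : L 0%N = U 0%N;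
    chains_end : L kL = U kU;
    chains_lt : forall X, px (L 0%N) < X < px (L kL) -> polyfun L kL X < polyfun U kU X }.

Lemma leq_pred_sub i j m : (i < j)%N -> (j < m)%N -> ((m - j).-1.+1 <= (m - i).-1)%N.
Proof. lia. Qed.

Section MonotonePolygon.
Variables (R : realType) (kL kU : nat) (L U : nat -> 'rV[R]_2).
Hypothesis chains : monotone_chains kL kU L U.
Let kL0 := lower_pos chains.
Let kU0 := upper_pos chains.
Let k2 := sides_gt2 chains.
Let incrL := lower_incr chains.
Let incrU := upper_incr chains.
Let startLU := chains_start chains.
Let endLU := chains_end chains.
Let lo_lt_up := chains_lt chains.
Let lo := polyfun L kL.
Let up := polyfun U kU.
Let x0 := px (L 0%N).
Let x1 := px (L kL).

Definition mono_polygon (j : 'I_(kL + kU)) : 'rV[R]_2 :=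
  if (j <= kL)%N then L j else U (kL + kU - j).

Definition mono_region : set 'rV[R]_2 :=
  [set x | x0 <= px x <= x1 /\ lo (px x) <= py x <= up (px x)].

Lemma mono_lower (j : 'I_(kL + kU)) : (j < kL)%N ->
  mono_polygon j = L j /\ mono_polygon (ordS j) = L j.+1.
Proof.
move=> jk; by rewrite /mono_polygon (ltnW jk) /= modn_small ?jk //; lia.
Qed.

Lemma mono_upper (j : 'I_(kL + kU)) : (kL <= j)%N ->
  mono_polygon j = U (kL + kU - j) /\ mono_polygon (ordS j) = U (kL + kU - j).-1.
Proof.
move=> jk; have jm := ltn_ord j; rewrite /mono_polygon /=; split.
  case: leqP => // jk'; have jE : nat_of_ord j = kL by apply/eqP; rewrite eqn_leq jk jk'.
  by rewrite jE addKn endLU.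
have [h|h] : (j.+1 < kL + kU)%N \/ j.+1 = (kL + kU)%N by lia.
  by rewrite modn_small // ifF; [congr U; lia | lia].
by rewrite h modnn /= startLU; congr U; lia.
Qed.

Lemma lo0 : lo x0 = py (L 0%N).
Proof.
rewrite /lo (polyfun_seg incrL kL0 (leqnn _)) ?lexx ?ltW ?incrL //.
by rewrite subrr mulr0 addr0.
Qed.
Lemma lo1 : lo x1 = py (L kL). Proof. by rewrite /lo (polyfun_right incrL). Qed.
Lemma up0 : up x0 = lo x0.
Proof.
rewrite lo0 /x0 startLU /up (polyfun_seg incrU kU0 (leqnn _)) ?lexx ?ltW ?incrU //.
by rewrite subrr mulr0 addr0.
Qed.
Lemma up1 : up x1 = lo x1.
Proof. by rewrite lo1 /up /x1 endLU (polyfun_right incrU). Qed.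

Lemma lo_le_up X : x0 <= X <= x1 -> lo X <= up X.
Proof.
move=> /andP[]; rewrite le_eqVlt => /orP[/eqP <- _|h0]; first by rewrite up0.
rewrite le_eqVlt => /orP[/eqP ->|h1]; first by rewrite up1.
by rewrite ltW // lo_lt_up // h0.
Qed.

Lemma px_segment_path (a b : 'rV[R]_2) s : px (segment_path a b s) = px a + s * (px b - px a).
Proof. by rewrite /segment_path !pE; ring. Qed.
Lemma py_segment_path (a b : 'rV[R]_2) s : py (segment_path a b s) = py a + s * (py b - py a).
Proof. by rewrite /segment_path !pE; ring. Qed.

Lemma on_polyfun (P : nat -> 'rV[R]_2) k j (s : R) : (forall j, (j < k)%N -> px (P j) < px (P j.+1)) -> (j < k)%N ->
  0 <= s <= 1 ->
  let x := segment_path (P j) (P j.+1) s in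
  px (P j) <= px x <= px (P j.+1) /\ py x = polyfun P k (px x).
Proof.
move=> incr jk s01 x; have h := incr _ jk.
have b : px (P j) <= px x <= px (P j.+1) by rewrite px_segment_path; apply/andP; split; nra.
split=> //; rewrite (polyfun_seg incr jk (leqnn _)) // /x px_segment_path py_segment_path.
by rewrite /slope_of; field; lra.
Qed.

Lemma lower_point (j : 'I_(kL + kU)) (s : R) : (j < kL)%N -> 0 <= s <= 1 ->
  let x := segment_path (mono_polygon j) (mono_polygon (ordS j)) s in
  [/\ px (L j) <= px x <= px (L j.+1), py x = lo (px x) & x0 <= px x <= x1].
Proof.
move=> jk s01; have [-> ->] := mono_lower jk => x.
have [h1 h2] := on_polyfun incrL jk s01; split=> //; move: h1 => /andP[h1 h3].
by apply/andP; split; [apply: le_trans h1 | apply: le_trans h3 _]; apply: (px_le incrL); rewrite // ltnW.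
Qed.

Lemma segment_pathC (a b : 'rV[R]_2) s : segment_path a b s = segment_path b a (1 - s).
Proof. by rewrite /segment_path subKr addrC. Qed.

Lemma upper_point (j : 'I_(kL + kU)) (s : R) : (kL <= j)%N -> 0 <= s <= 1 ->
  let x := segment_path (mono_polygon j) (mono_polygon (ordS j)) s in
  let r := (kL + kU - j).-1 in
  [/\ (r < kU)%N, x = segment_path (U r) (U r.+1) (1 - s), px (U r) <= px x <= px (U r.+1),
     py x = up (px x) & x0 <= px x <= x1].
Proof.
move=> jk s01 x r; have jm := ltn_ord j.
have rk : (r < kU)%N by rewrite /r; lia.
have xE : x = segment_path (U r) (U r.+1) (1 - s).
  rewrite /x; have [-> ->] := mono_upper jk; rewrite segment_pathC /r.
  by congr segment_path; congr U; lia.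
have s01' : 0 <= 1 - s <= 1 by lra.
have [h1 h2] := on_polyfun incrU rk s01'; rewrite -xE in h1 h2; split=> //.
move: h1 => /andP[h1 h3]; rewrite /x0 /x1 startLU endLU.
by apply/andP; split; [apply: le_trans h1 | apply: le_trans h3 _]; apply: (px_le incrU); rewrite // ltnW.
Qed.

(** Two sides of the same chain have distinct abscissas except at common ends; a
    lower and an upper side are separated by chains_lt except at the two ends of
    the chains, which belong to the half-open sides only once. *)
Lemma mono_embedded : embedded_polygon mono_polygon.
Proof.
split=> // i j s t s01 t01.
have [s01' t01'] : 0 <= s <= 1 /\ 0 <= t <= 1 by lra.
have path_inj (a b : 'rV[R]_2) u v : px a < px b -> segment_path a b u = segment_path a b v -> u = v.
  move=> ab /(congr1 (@px R)); rewrite !px_segment_path => /addrI/mulIf; apply.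
  by rewrite subr_eq0 gt_eqF.
have strictL (i' : 'I_(kL + kU)) u : 0 <= u < 1 -> (i' < kL)%N ->
    px (segment_path (mono_polygon i') (mono_polygon (ordS i')) u) < px (L i'.+1).
  move=> u01 ik; have [-> ->] := mono_lower ik; rewrite px_segment_path.
  have := incrL ik; nra.
have strictU (i' : 'I_(kL + kU)) u : 0 <= u < 1 -> (kL <= i')%N ->
    px (U (kL + kU - i').-1) < px (segment_path (mono_polygon i') (mono_polygon (ordS i')) u).
  move=> u01 ik; have [||rk -> _ _ _] := @upper_point i' u; [by []|lra|]; rewrite px_segment_path.
  have := incrU rk; nra.
have mixed (i' j' : 'I_(kL + kU)) u v : 0 <= u < 1 -> 0 <= v < 1 -> (i' < kL)%N -> (kL <= j')%N ->
    segment_path (mono_polygon i') (mono_polygon (ordS i')) u =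
    segment_path (mono_polygon j') (mono_polygon (ordS j')) v -> False.
  move=> u01 v01 ik jk e; have [u01' v01'] : 0 <= u <= 1 /\ 0 <= v <= 1 by lra.
  have [_ yl x01] := lower_point ik u01'; have [rk _ _ yu _] := upper_point jk v01'.
  have su := strictL _ _ u01 ik; have sv := strictU _ _ v01 jk.
  rewrite -e in yu sv; move: yl yu x01 su sv; move: (segment_path _ _ _) => x yl yu x01 su sv.
  suff : lo (px x) < up (px x) by rewrite -yl -yu ltxx.
  apply: lo_lt_up; apply/andP; split.
    by apply: le_lt_trans sv; rewrite /x0 startLU; apply: (px_le incrU) => //; exact: ltnW.
  by apply: lt_le_trans su _; apply: (px_le incrL).
case: (ltnP i kL) => ik; case: (ltnP j kL) => jk e.
- have iE := mono_lower ik; have jE := mono_lower jk.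
  have ij : nat_of_ord i = j.
    case: (ltngtP i j) => // ij; exfalso.
      have [h _ _] := lower_point jk t01'; rewrite -e in h; have h2 := strictL _ _ s01 ik.
      by have := @px_le _ _ _ incrL i.+1 j ij (ltnW jk); lra.
    have [h _ _] := lower_point ik s01'; rewrite e in h; have h2 := strictL _ _ t01 jk.
    by have := @px_le _ _ _ incrL j.+1 i ij (ltnW ik); lra.
  split; first exact: val_inj.
  move: e; rewrite (val_inj ij : i = j) jE.1 jE.2; apply: path_inj; exact: incrL.
- by case: (mixed i j s t).
- by case: (mixed j i t s).
have [ri iE hi _ _] := upper_point ik s01'; have [rj jE hj _ _] := upper_point jk t01'.
have iu := strictU _ _ s01 ik; have ju := strictU _ _ t01 jk.
have im := ltn_ord i; have jm := ltn_ord j.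
have ij : nat_of_ord i = j.
  case: (ltngtP i j) => // ij; exfalso.
    have := px_le incrU (leq_pred_sub ij jm) (ltnW ri).
    by rewrite -e in hj ju; move: hj iu => /andP[_ h1] h2 h3; move: (le_lt_trans (le_trans h1 h3) h2); rewrite ltxx.
  have := px_le incrU (leq_pred_sub ij im) (ltnW rj).
  by rewrite e in hi iu; move: hi ju => /andP[_ h1] h2 h3; move: (le_lt_trans (le_trans h1 h3) h2); rewrite ltxx.
have {}ij : i = j by apply: val_inj.
split=> //; subst j.
by move: e; rewrite iE jE => /(path_inj _ _ _ _ (incrU ri)); lra.
Qed.

Lemma mono_curve : polygon_curve mono_polygon =
  [set x | x0 <= px x <= x1 /\ (py x = lo (px x) \/ py x = up (px x))].
Proof.
apply/seteqP; split=> [x [j _ [s]]|x [/andP[h0 h1] hx]].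
  rewrite /= in_itv /= => s01 <-; case: (ltnP j kL) => jk.
    by have [_ ? ?] := lower_point jk s01; split=> //; left.
  by have [_ _ _ ? ?] := upper_point jk s01; split=> //; right.
have onseg (P : nat -> 'rV[R]_2) k : (forall j, (j < k)%N -> px (P j) < px (P j.+1)) -> (0 < k)%N ->
    px (P 0%N) <= px x -> px x <= px (P k) -> py x = polyfun P k (px x) ->
    exists j s, [/\ (j < k)%N, 0 <= s <= 1 & segment_path (P j) (P j.+1) s = x].
  move=> incr k0 P0 Pk yE.
  have [j jk /andP[j1 j2]] : exists2 j, (j < k)%N & px (P j) <= px x <= px (P j.+1).
    move: Pk; rewrite le_eqVlt => /orP[/eqP ->|Pk].
      by exists k.-1; rewrite ?prednK // lexx (px_le incr) // leq_pred.
    have [||j jk /andP[j1 j2]] := @find_seg R P k k (px x); rewrite ?P0 //.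
    by exists j; rewrite // j1 ltW.
  have h := incr _ jk; exists j, ((px x - px (P j)) / (px (P j.+1) - px (P j))); split=> //.
    rewrite divr_ge0 ?ler_pdivrMr ?mul1r; lra.
  apply: plane_eq; rewrite ?px_segment_path ?py_segment_path; first by field; lra.
  rewrite yE (polyfun_seg incr jk (leqnn _)) ?j1 // /slope_of; field; lra.
case: hx => yE.
  have [j [s [jk s01 sE]]] := onseg L kL incrL kL0 h0 h1 yE.
  have jm : (j < kL + kU)%N by lia.
  exists (Ordinal jm) => //; exists s; first by rewrite /= in_itv.
  by have [] := @mono_lower (Ordinal jm) jk => -> ->.
have [j [s [jk s01 sE]]] : exists j s, [/\ (j < kU)%N, 0 <= s <= 1 & segment_path (U j) (U j.+1) s = x].
  by apply: onseg; rewrite // -?startLU -?endLU.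
have jm : (kL + kU - j.+1 < kL + kU)%N by lia.
exists (Ordinal jm) => //; exists (1 - s); first by rewrite /= in_itv /=; lra.
have [|-> ->] := @mono_upper (Ordinal jm); first by rewrite /=; lia.
by rewrite /= segment_pathC subKr subKn ?sE //; lia.
Qed.

Definition mono_inside : set 'rV[R]_2 :=
  [set x | x0 < px x < x1 /\ lo (px x) < py x < up (px x)].

Lemma mono_regionE : mono_region = polygon_curve mono_polygon `|` mono_inside.
Proof.
rewrite mono_curve; apply/seteqP; split=> [x [/andP[h0 h1] /andP[l u]]|x].
  case: (eqVneq (py x) (lo (px x))) => [e|ln]; first by left; split; [rewrite h0|left].
  case: (eqVneq (py x) (up (px x))) => [e|un]; first by left; split; [rewrite h0|right].
  have l' : lo (px x) < py x by rewrite lt_neqAle eq_sym ln.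
  have u' : py x < up (px x) by rewrite lt_neqAle un.
  right; split; last by rewrite l'.
  by rewrite !lt_neqAle h0 h1 !andbT; apply/andP; split;
    [apply: contraTneq (lt_trans l' u') => <- | apply: contraTneq (lt_trans l' u') => ->];
    rewrite ?up0 ?up1 ltxx.
case=> [[h [] e]|[/andP[h0 h1] /andP[l u]]].
- by split=> //; rewrite e lexx lo_le_up.
- by split=> //; rewrite e lexx lo_le_up.
by split; rewrite ltW //= ltW.
Qed.

Lemma cont_lo_px : continuous (fun x : 'rV[R]_2 => lo (px x)).
Proof. by apply: (cont_comp (@cont_px R)); exact: cont_polyfun. Qed.
Lemma cont_up_px : continuous (fun x : 'rV[R]_2 => up (px x)).
Proof. by apply: (cont_comp (@cont_px R)); exact: cont_polyfun. Qed.

Lemma open_lt (T : topologicalType) (f g : T -> R) :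
  continuous f -> continuous g -> open [set x | f x < g x].
Proof.
move=> cf cg; rewrite (_ : [set x | _] = (fun x => g x - f x) @^-1` [set y | 0 < y]).
  by apply: open_comp; [move=> x _; apply: (cont_add cg (cont_opp cf)) | exact: open_gt].
by apply/seteqP; split=> x /=; rewrite subr_gt0.
Qed.

Lemma closed_le (T : topologicalType) (f g : T -> R) :
  continuous f -> continuous g -> closed [set x | f x <= g x].
Proof.
move=> cf cg; rewrite (_ : [set x | _] = ~` [set x | g x < f x]).
  by apply: open_closedC; exact: open_lt.
by apply/seteqP; split=> x /=; rewrite leNgt => /negP.
Qed.

Lemma open_mono_inside : open mono_inside.
Proof.
rewrite (_ : mono_inside = ([set x | x0 < px x] `&` [set x | px x < x1]) `&`
   ([set x | lo (px x) < py x] `&` [set x | py x < up (px x)])); last first.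
  apply/seteqP; split=> x; first by move=> [/andP[? ?] /andP[? ?]].
  by move=> [[/= a b] [/= c d]]; split; apply/andP.
have [[[cx cy] cl] cu] := (@cont_px R, @cont_py R, cont_lo_px, cont_up_px).
apply: openI; apply: openI.
- by apply: open_lt; [exact: cont_cst | exact: cx].
- by apply: open_lt; [exact: cx | exact: cont_cst].
- by apply: open_lt; [exact: cl | exact: cy].
- by apply: open_lt; [exact: cy | exact: cu].
Qed.

Lemma closed_mono_region : closed mono_region.
Proof.
rewrite (_ : mono_region = ([set x | x0 <= px x] `&` [set x | px x <= x1]) `&`
   ([set x | lo (px x) <= py x] `&` [set x | py x <= up (px x)])); last first.
  apply/seteqP; split=> x; first by move=> [/andP[? ?] /andP[? ?]].
  by move=> [[/= a b] [/= c d]]; split; apply/andP.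
have [[[cx cy] cl] cu] := (@cont_px R, @cont_py R, cont_lo_px, cont_up_px).
apply: closedI; apply: closedI.
- by apply: closed_le; [exact: cont_cst | exact: cx].
- by apply: closed_le; [exact: cx | exact: cont_cst].
- by apply: closed_le; [exact: cl | exact: cy].
- by apply: closed_le; [exact: cy | exact: cu].
Qed.
End MonotonePolygon.

(** * The region of such a polygon *)

Section Region.
Variables (R : realType) (kL kU : nat) (L U : nat -> 'rV[R]_2).
Hypothesis chains : monotone_chains kL kU L U.
Let lo := polyfun L kL.
Let up := polyfun U kU.
Let x0 := px (L 0%N).
Let x1 := px (L kL).
Let curve := polygon_curve (@mono_polygon R kL kU L U).
Let region := mono_region kL kU L U.
Let inside := mono_inside kL kU L U.

Lemma region_split : region = curve `|` inside.
Proof. exact: mono_regionE. Qed.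

Lemma inside_not_curve x : inside x -> ~ curve x.
Proof.
rewrite /curve mono_curve // => -[_ /andP[a b]] [_ [] e]; move: a b; rewrite e ?ltxx //.
Qed.

Lemma compact_mono_region : compact region.
Proof.
pose M := `|x0| + `|x1| + 1.
have cl : compact (lo @` `[x0, x1] `|` up @` `[x0, x1]).
  apply: compactU; (apply: continuous_compact; last exact: segment_compact);
    by apply: continuous_subspaceT; exact: cont_polyfun.
have [B [_ hB]] := compact_bounded cl.
have {}hB := hB (B + 1) (ltr_pwDr ltr01 (lexx _)).
apply: bounded_closed_compact; last exact: closed_mono_region.
exists (M + `|B| + 1); split; first exact: num_real.
move=> M' hM' x [/andP[]]; rewrite -/x0 -/x1 -/lo -/up => h0 h1 /andP[hl hu].
have lx : `|lo (px x)| <= B + 1.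
  by apply: hB; left; exists (px x) => //; rewrite /= in_itv /= h0.
have ux : `|up (px x)| <= B + 1.
  by apply: hB; right; exists (px x) => //; rewrite /= in_itv /= h0.
apply: norm_le_entry => [|j]; first by apply: le_trans (ltW hM'); rewrite !addr_ge0.
apply: le_trans (ltW hM').
have -> : x ord0 j = if j == ord0 then px x else py x.
  have [->|->] // : j = ord0 \/ j = ord_max.
  by case: j => [[|[|]]] //= h; [left|right]; apply: val_inj.
have [n0 n1 nB] : [/\ 0 <= `|x0|, 0 <= `|x1| & B <= `|B|] by split=> //; exact: ler_norm.
have [m0 m1] : - `|x0| <= x0 /\ x1 <= `|x1| by rewrite ler_norm lerNl -normrN ler_norm.
have B0 : 0 <= `|B| by [].
move: lx ux; rewrite !ler_norml /M => /andP[? ?] /andP[? ?].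
by case: ifP => _; apply/andP; split; lra.
Qed.

(** The interior is open, and closed in the complement of the curve. *)
Lemma connected_sub_inside (S : set 'rV[R]_2) x : connected S -> S `<=` ~` curve ->
  S x -> inside x -> S `<=` inside.
Proof.
move=> cS Sc Sx ix.
suff <- : S `&` inside = S by move=> y [].
apply: cS; first by exists x.
  by exists inside; [exact: open_mono_inside | ].
exists region; first exact: closed_mono_region.
rewrite region_split; apply/seteqP; split=> y [Sy]; first by move=> iy; split=> //; right.
by case=> [cy|iy]; [case: (Sc _ Sy) | ].
Qed.

Lemma unbounded_ray (A : set 'rV[R]_2) (x v : 'rV[R]_2) : v != 0 ->
  (forall t, 0 <= t -> A (x + t *: v)) -> bounded_set A -> False.
Proof.
move=> v0 hA [M [_ hM]].
have nv : 0 < `|v| by rewrite normr_gt0.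
pose t := (`|M| + 1 + `|x|) / `|v|.
have t0 : 0 <= t by rewrite divr_ge0 // !addr_ge0.
have : `|x + t *: v| <= `|M| + 1/2.
  by apply: hM; [have := ler_norm M; lra | exact: hA].
have : `|t *: v| <= `|x + t *: v| + `|x|.
  by rewrite -{1}[t *: v](addKr x) addrC (le_trans (ler_normD _ _)) // normrN.
have -> : `|t *: v| = `|M| + 1 + `|x| by rewrite normrZ ger0_norm // /t divfK ?gt_eqF.
lra.
Qed.

Lemma ray_connected (x v : 'rV[R]_2) :
  connected ((fun t : R => x + t *: v) @` [set t | 0 <= t]).
Proof.
apply: connected_continuous_connected.
  by apply/connected_intervalP; rewrite (_ : [set t | _] = [set` `[0, +oo[%R]);
    [exact: interval_is_interval | apply/seteqP; split=> t /=; rewrite in_itv /= andbT].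
apply: continuous_subspaceT; apply: cont_mx => i j.
by under eq_fun do rewrite !mxE; cont_tac.
Qed.

(** From a point above, below or beside the region a vertical ray escapes without
    meeting the curve. *)
Lemma outside_unbounded x : ~ region x ->
  ~ bounded_set (connected_component (~` curve) x).
Proof.
move=> nr; pose e s : 'rV[R]_2 := pt 0 s.
have esc s : s != 0 -> (forall t, 0 <= t -> ~ curve (x + t *: e s)) ->
    ~ bounded_set (connected_component (~` curve) x).
  move=> s0 hs; apply: (@unbounded_ray _ x (e s)).
    by apply: contra_neq s0 => /(congr1 (@py R)); rewrite py_pt /py mxE.
  move=> t t0; exists ((fun t : R => x + t *: e s) @` [set t | 0 <= t]).
    split; last exact: ray_connected.
      by exists 0 => //=; rewrite scale0r addr0.
    by move=> _ [u u0 <-]; exact: hs.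
  by exists t.
have ex s t : px (x + t *: e s) = px x by rewrite /e !pE mulr0 addr0.
have ey s t : py (x + t *: e s) = py x + t * s by rewrite /e !pE.
case: (leP x0 (px x)) => h0; last first.
  apply: (esc 1); first exact: oner_neq0.
  by move=> t _; rewrite /curve mono_curve // => -[]; rewrite ex => /andP[]; rewrite leNgt h0.
case: (leP (px x) x1) => h1; last first.
  apply: (esc 1); first exact: oner_neq0.
  by move=> t _; rewrite /curve mono_curve // => -[]; rewrite ex => /andP[_]; rewrite leNgt h1.
have lu : lo (px x) <= up (px x) by apply: lo_le_up => //; rewrite h0.
case: (leP (lo (px x)) (py x)) => hl; last first.
  apply: (esc (-1)); first by rewrite oppr_eq0 oner_neq0.
  move=> t t0; rewrite /curve mono_curve // => -[_]; rewrite ex ey -/lo -/up.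
  by case; lra.
case: (leP (py x) (up (px x))) => hu; last first.
  apply: (esc 1); first exact: oner_neq0.
  move=> t t0; rewrite /curve mono_curve // => -[_]; rewrite ex ey -/lo -/up.
  by case; lra.
by case: nr; split; rewrite ?h0 ?hl.
Qed.

Theorem mono_polygon_region : polygon_region (@mono_polygon R kL kU L U) = region.
Proof.
apply/seteqP; split=> [x [cx|[nc bx]]|x].
- by rewrite region_split; left.
- by case: (pselect (region x)) => // /outside_unbounded.
rewrite region_split => -[cx|ix]; [by left | right; split; first exact: inside_not_curve].
have sub : connected_component (~` curve) x `<=` region.
  move=> y [S [Sx Sc cS] Sy]; rewrite region_split; right.
  exact: (connected_sub_inside cS Sc Sx ix).
have [B [Br hB]] := compact_bounded compact_mono_region.
by exists B; split=> // M BM y /sub; exact: hB.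
Qed.
End Region.

(** * Crossings of the sides of a triangle *)

Section TriangleCrossing.
Variable R : realType.
Notation plane := 'rV[R]_2.
Implicit Types a b c x : plane.

Definition tri_crossing a b c x : R := crossing a b x + crossing b c x + crossing c a x.
Definition open_tri a b c x := [&& 0 < orient a b x, 0 < orient b c x & 0 < orient c a x].
Definition closed_tri a b c x := [&& 0 <= orient a b x, 0 <= orient b c x & 0 <= orient c a x].

Definition center a b c : plane := 3^-1 *: (a + b + c).

Lemma orient_sum a b c x : orient b c x + orient c a x + orient a b x = orient a b c.
Proof. by rewrite /orient; ring. Qed.

(** Up to a common factor, the areas of the triangles that x forms with the sides
    are barycentric coordinates of x. *)
Lemma orient_bary a b c x : orient b c x * (px a - px x) + orient c a x * (px b - px x) +
  orient a b x * (px c - px x) = 0.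
Proof. by rewrite /orient; ring. Qed.

(** On the sides the value depends on the half-open convention of crossing. *)
Definition crossing_spec a b c x := [/\ 0 <= tri_crossing a b c x,
  open_tri a b c x -> tri_crossing a b c x = 1 &
  0 < tri_crossing a b c x -> closed_tri a b c x].

Lemma crossing_spec_rot a b c x : crossing_spec b c a x -> crossing_spec a b c x.
Proof.
rewrite /crossing_spec /open_tri /closed_tri.
have -> : tri_crossing b c a x = tri_crossing a b c x by rewrite /tri_crossing; ring.
by case=> h1 h2 h3; split=> // [/and3P[? ? ?]|/h3/and3P[? ? ?]]; [apply: h2|]; apply/and3P.
Qed.

Lemma crossingE a b x : crossing a b x =
  if (px a <= px x) && ~~ (px b <= px x) then (0 <= orient a b x)%R%:R
  else if (px b <= px x) && ~~ (px a <= px x) then - (orient a b x <= 0)%R%:R else 0.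
Proof. by rewrite /crossing !ltNge. Qed.

(** Here u, v, w stand for barycentric weights of a point, and a, b, c for the
    abscissas of the vertices relative to it. *)
Lemma weights_left (u v w a b c : R) : u + v + w > 0 -> u * a + v * b + w * c = 0 ->
  a <= 0 -> 0 < b -> 0 < c -> (v <= 0 -> 0 <= w) /\ (0 < v -> 0 <= w -> 0 <= u).
Proof.
move=> D e a0 b0 c0; split=> [v0|v0 w0]; rewrite leNgt; apply/negP => h.
  have h1 : u * a <= 0 by apply: mulr_ge0_le0; lra.
  have h2 : v * b <= 0 by apply: mulr_le0_ge0; lra.
  have h3 : w * c < 0 by rewrite pmulr_llt0.
  lra.
have h1 : 0 <= u * a by apply: mulr_le0; lra.
have h2 : 0 < v * b by apply: mulr_gt0.
have h3 : 0 <= w * c by apply: mulr_ge0; lra.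
lra.
Qed.

Lemma weights_right (u v w a b c : R) : u + v + w > 0 -> u * a + v * b + w * c = 0 ->
  0 < a -> b <= 0 -> c <= 0 -> (w <= 0 -> 0 <= v) /\ (0 < w -> 0 <= v -> 0 <= u).
Proof.
move=> D e a0 b0 c0; split=> [w0|w0 v0]; rewrite leNgt; apply/negP => h.
  have h1 : 0 < u * a by apply: mulr_gt0; lra.
  have h2 : 0 <= v * b by apply: mulr_le0; lra.
  have h3 : 0 <= w * c by apply: mulr_le0.
  lra.
have h1 : u * a < 0 by rewrite pmulr_llt0.
have h2 : v * b <= 0 by apply: mulr_ge0_le0.
have h3 : w * c <= 0 by apply: mulr_ge0_le0; lra.
lra.
Qed.

(** The vertical line through x separates one vertex from the two others, or does
    not separate them.  In the former case it crosses two sides, and the signs of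
    the barycentric coordinates tell how many of the crossings are below x. *)
Lemma tri_crossingP a b c x : 0 < orient a b c -> crossing_spec a b c x.
Proof.
have left_alone p q r : 0 < orient p q r -> px p <= px x -> px x < px q -> px x < px r ->
    crossing_spec p q r x.
  move=> D pl ql rl; have tc : tri_crossing p q r x =
      (0 <= orient p q x)%R%:R - (orient r p x <= 0)%R%:R.
    by rewrite /tri_crossing !crossingE pl !leNgt ql rl /= addr0.
  rewrite /crossing_spec tc /open_tri /closed_tri.
  have D' : 0 < orient q r x + orient r p x + orient p q x by rewrite orient_sum.
  rewrite -subr_le0 in pl; rewrite -subr_gt0 in ql; rewrite -subr_gt0 in rl.
  have [h1 h2] := weights_left D' (orient_bary p q r x) pl ql rl.
  split.
  - by case: (leP _ 0) => [/h1 ->|_]; rewrite ?subrr // subr0 ler0n.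
  - by move=> /and3P[w u v]; rewrite (ltW w) (lt_geF v) subr0.
  case: (leP 0 (orient p q x)) => w; case: (leP (orient r p x) 0) => v; rewrite ?subrr ?subr0 ?ltxx ?sub0r ?oppr_gt0 ?ltr10 // => _.
  by rewrite /= h2 // (ltW v).
have right_alone p q r : 0 < orient p q r -> px x < px p -> px q <= px x -> px r <= px x ->
    crossing_spec p q r x.
  move=> D pl ql rl; have tc : tri_crossing p q r x =
      (0 <= orient r p x)%R%:R - (orient p q x <= 0)%R%:R.
    by rewrite /tri_crossing !crossingE ql rl leNgt pl /= addr0 addrC.
  rewrite /crossing_spec tc /open_tri /closed_tri.
  have D' : 0 < orient q r x + orient r p x + orient p q x by rewrite orient_sum.
  rewrite -subr_gt0 in pl; rewrite -subr_le0 in ql; rewrite -subr_le0 in rl.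
  have [h1 h2] := weights_right D' (orient_bary p q r x) pl ql rl.
  split.
  - by case: (leP _ 0) => [/h1 ->|_]; rewrite ?subrr // subr0 ler0n.
  - by move=> /and3P[w u v]; rewrite (ltW v) (lt_geF w) subr0.
  case: (leP 0 (orient r p x)) => w; case: (leP (orient p q x) 0) => v; rewrite ?subrr ?subr0 ?ltxx ?sub0r ?oppr_gt0 ?ltr10 // => _.
  by rewrite /= h2 // (ltW v).
have all_same p q r : 0 < orient p q r -> (px q <= px x) = (px p <= px x) ->
    (px r <= px x) = (px p <= px x) -> crossing_spec p q r x.
  move=> D eq er; have tc : tri_crossing p q r x = 0.
    by rewrite /tri_crossing !crossingE eq er !andbN !addr0.
  rewrite /crossing_spec tc /open_tri ltxx; split=> // /and3P[w u v]; exfalso.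
  have e := orient_bary p q r x.
  case: (leP (px p) (px x)) eq er => hp eq er.
    have hq : px q - px x <= 0 by rewrite subr_le0 eq.
    have hr : px r - px x <= 0 by rewrite subr_le0 er.
    rewrite -subr_le0 in hp.
    have := mulr_ge0_le0 (ltW u) hp; have := mulr_ge0_le0 (ltW v) hq.
    have := mulr_ge0_le0 (ltW w) hr => h3 h2 h1.
    have z1 : px p - px x = 0 by apply/eqP; rewrite -(mulrI_eq0 _ (lregP (lt0r_neq0 u))); apply/eqP; lra.
    have z2 : px q - px x = 0 by apply/eqP; rewrite -(mulrI_eq0 _ (lregP (lt0r_neq0 v))); apply/eqP; lra.
    have z3 : px r - px x = 0 by apply/eqP; rewrite -(mulrI_eq0 _ (lregP (lt0r_neq0 w))); apply/eqP; lra.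
    move: D; rewrite /orient (subr0_eq z1) (subr0_eq z2) (subr0_eq z3).
    by rewrite !subrr mul0r mulr0 subrr ltxx.
  have hq : 0 < px q - px x by rewrite subr_gt0 ltNge eq.
  have hr : 0 < px r - px x by rewrite subr_gt0 ltNge er.
  rewrite -subr_gt0 in hp.
  have := mulr_gt0 u hp; have := mulr_gt0 v hq; have := mulr_gt0 w hr; lra.
move=> D; case: (leP (px a) (px x)) => la; case: (leP (px b) (px x)) => lb; case: (leP (px c) (px x)) => lc.
- by apply: (all_same _ _ _ D); [rewrite la lb | rewrite la lc].
- by do 2 apply: crossing_spec_rot; apply: (right_alone _ _ _ _ lc la lb); rewrite 2!orient_rot.
- by apply: crossing_spec_rot; apply: (right_alone _ _ _ _ lb lc la); rewrite orient_rot.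
- exact: (left_alone _ _ _ D la lb lc).
- exact: (right_alone _ _ _ D la lb lc).
- by apply: crossing_spec_rot; apply: (left_alone _ _ _ _ lb lc la); rewrite orient_rot.
- by do 2 apply: crossing_spec_rot; apply: (left_alone _ _ _ _ lc la lb); rewrite 2!orient_rot.
- by apply: (all_same _ _ _ D); rewrite !leNgt la ?lb ?lc.
Qed.

(** Used to move points of closed triangles into general position. *)
Lemma open_tri_toward_center a b c x k : 0 < orient a b c -> closed_tri a b c x ->
  0 < k -> k <= 1 -> open_tri a b c (x + k *: (center a b c - x)).
Proof.
move=> D0 /and3P[c1 c2 c3] k0 k1; have D3 : 0 < orient a b c / 3 by rewrite divr_gt0.
have towards u v : 0 <= orient u v x -> orient u v (center a b c) = orient a b c / 3 ->
    0 < orient u v (x + k *: (center a b c - x)).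
  move=> o ce; have -> : orient u v (x + k *: (center a b c - x)) =
      (1 - k) * orient u v x + k * (orient a b c / 3).
    by rewrite -ce /orient !pE; ring.
  by rewrite ltr_wpDl ?mulr_gt0 // mulr_ge0 // subr_ge0.
by apply/and3P; split; apply: towards => //; rewrite /center /orient !pE; field.
Qed.

Lemma open_center a b c : 0 < orient a b c -> open_tri a b c (center a b c).
Proof.
move=> D0; have := @open_tri_toward_center a b c (center a b c) 1 D0.
rewrite subrr scaler0 addr0; apply=> //.
have D3 : 0 <= orient a b c / 3 by rewrite divr_ge0 // ltW.
by apply/and3P; split; rewrite (_ : orient _ _ _ = orient a b c / 3) // /center /orient !pE; field.
Qed.
End TriangleCrossing.

(** * Complexes of oriented triangles *)

Section OrientedComplex.
Variables (R : realType) (n0 : nat).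
Notation V := 'I_n0.
Notation plane := 'rV[R]_2.

Definition tri_set (t : V * V * V) : {set V} := [set t.1.1; t.1.2; t.2]%SET.

Section Complex.
Variable F : seq (V * V * V).

(** Degenerate triples are dropped, which makes this a complex for every list. *)
Definition tri_faces : {set {set V}} := [set f : {set V} | (#|f| == 3%N) && has (fun t => f == tri_set t) F]%SET.
Definition tri_edges : {set {set V}} :=
  [set e : {set V} | (#|e| == 2%N) && [exists f in tri_faces, e \subset f]]%SET.

Lemma card_tri_edge e : e \in tri_edges -> #|e| = 2%N.
Proof. by rewrite inE => /andP[/eqP]. Qed.
Lemma card_tri_face f : f \in tri_faces -> #|f| = 3%N.
Proof. by rewrite inE => /andP[/eqP]. Qed.
Lemma tri_face_edges (f e : {set V}) :
  f \in tri_faces -> e \subset f -> #|e| = 2%N -> e \in tri_edges.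
Proof. by move=> fF ef e2; rewrite inE e2 eqxx /=; apply/existsP; exists f; rewrite fF. Qed.

Definition complex_of : complex2 n0 := Complex2 card_tri_edge card_tri_face tri_face_edges.

(** Cyclic rotations of a listed triple are oriented faces too. *)
Definition is_face p q r := [|| (p, q, r) \in F, (q, r, p) \in F | (r, p, q) \in F].

Lemma is_face_rot p q r : is_face p q r -> is_face q r p.
Proof. by rewrite /is_face => /or3P[] ->; rewrite ?orbT. Qed.

Lemma mem_is_face p q r : (p, q, r) \in F -> is_face p q r.
Proof. by rewrite /is_face => ->. Qed.
End Complex.

(** The map of the realization that is affine on simplices and given by z on the
    vertices. *)
Definition pl_map (z : V -> plane) (w : 'rV[R]_n0) : plane := \sum_v w ord0 v *: z v.

Lemma pl_map_vertex z v : pl_map z (vertex_point R v) = z v.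
Proof.
rewrite /pl_map (bigD1 v) //= big1 ?addr0 => [|u uv]; rewrite mxE eqxx /= ?eqxx ?scale1r //.
by rewrite (negbTE uv) scale0r.
Qed.

Lemma pl_mapD z w w' : pl_map z (w + w') = pl_map z w + pl_map z w'.
Proof. by rewrite /pl_map -big_split /=; apply: eq_bigr => v _; rewrite mxE scalerDl. Qed.
Lemma pl_mapZ z a w : pl_map z (a *: w) = a *: pl_map z w.
Proof. by rewrite /pl_map scaler_sumr; apply: eq_bigr => v _; rewrite mxE scalerA. Qed.

Lemma pl_map_segment z a b t :
  pl_map z (segment_path a b t) = segment_path (pl_map z a) (pl_map z b) t.
Proof. by rewrite /segment_path pl_mapD !pl_mapZ. Qed.

Lemma cont_pl_map z : continuous (pl_map z).
Proof.
apply: cont_mx => i j; under eq_fun do rewrite summxE.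
by apply: cont_sum => v; under eq_fun do rewrite mxE; cont_tac.
Qed.

Section OneTriangle.
Variables (z : V -> plane) (p q r : V).
Hypothesis D : 0 < orient (z p) (z q) (z r).

Lemma tri_distinct : [/\ p != q, q != r & p != r].
Proof.
by split; apply: contraTneq D => ->; rewrite -leNgt; rewrite le_eqVlt; apply/orP; left; apply/eqP; rewrite /orient; ring.
Qed.

Lemma sum_tri (T : zmodType) (f : V -> T) : (forall v, v \notin [set p; q; r]%SET -> f v = 0) ->
  \sum_v f v = f p + f q + f r.
Proof.
have [pq qr pr] := tri_distinct => h.
rewrite (bigD1 p) //= (bigD1 q) /=; last by rewrite eq_sym.
rewrite (bigD1 r) /=; last by rewrite eq_sym pr eq_sym.
rewrite big1 ?addr0 ?addrA // => v /andP[/andP[vp vq] vr].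
by apply: h; rewrite !inE (negbTE vp) (negbTE vq) (negbTE vr).
Qed.

Variable w : 'rV[R]_n0.
Hypothesis w_in : closed_simplex [set p; q; r]%SET w.

Lemma simplex_sum3 : w ord0 p + w ord0 q + w ord0 r = 1.
Proof. by case: w_in => _ <- h; rewrite (sum_tri h). Qed.

Lemma pl_map_tri : pl_map z w = w ord0 p *: z p + w ord0 q *: z q + w ord0 r *: z r.
Proof. by case: w_in => _ _ h; apply: sum_tri => v /h ->; rewrite scale0r. Qed.

Lemma orient_pl_map : orient (z p) (z q) (pl_map z w) = w ord0 r * orient (z p) (z q) (z r).
Proof.
rewrite pl_map_tri /orient !pE; have := simplex_sum3.
move: (w ord0 p) (w ord0 q) (w ord0 r) => a b c e; have -> : a = 1 - b - c by rewrite -e; ring.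
ring.
Qed.
End OneTriangle.

Lemma tri_set_rot (p q r : V) : [set q; r; p]%SET = [set p; q; r]%SET.
Proof. by apply/setP => v; rewrite !inE; case: (v == p); case: (v == q); case: (v == r). Qed.

Definition tri_point (p q r : V) (a b c : R) : 'rV[R]_n0 :=
  a *: vertex_point R p + b *: vertex_point R q + c *: vertex_point R r.

Lemma pl_map_tri_point z p q r a b c :
  pl_map z (tri_point p q r a b c) = a *: z p + b *: z q + c *: z r.
Proof. by rewrite !pl_mapD !pl_mapZ !pl_map_vertex. Qed.

Lemma tri_pointE p q r a b c v : tri_point p q r a b c ord0 v =
  a * (v == p)%:R + b * (v == q)%:R + c * (v == r)%:R.
Proof. by rewrite !mxE eqxx. Qed.

Lemma tri_point_in p q r a b c : 0 <= a -> 0 <= b -> 0 <= c -> a + b + c = 1 ->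
  closed_simplex [set p; q; r]%SET (tri_point p q r a b c).
Proof.
move=> a0 b0 c0 s; split=> [v||v].
- by rewrite tri_pointE !addr_ge0 // mulr_ge0.
- under eq_bigr do rewrite tri_pointE.
  rewrite !big_split /= -!mulr_sumr.
  have one u : \sum_(v : V) ((v == u)%:R : R) = 1.
    by rewrite (bigD1 u) //= eqxx big1 ?addr0 // => v /negbTE ->.
  by rewrite !one !mulr1.
by rewrite !inE !negb_or tri_pointE => /andP[/andP[/negbTE -> /negbTE ->] /negbTE ->]; rewrite !mulr0 !addr0.
Qed.

Lemma bary_point (z : V -> plane) p q r (x : plane) : 0 < orient (z p) (z q) (z r) ->
  let D := orient (z p) (z q) (z r) in
  pl_map z (tri_point p q r (orient (z q) (z r) x / D) (orient (z r) (z p) x / D)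
     (orient (z p) (z q) x / D)) = x.
Proof.
move=> D0 D; rewrite pl_map_tri_point; have Dn : D != 0 by rewrite gt_eqF.
apply: plane_eq; rewrite !pE.
  by move: Dn; rewrite /D /orient => Dn; field.
by move: Dn; rewrite /D /orient => Dn; field.
Qed.

Lemma closed_tri_point (z : V -> plane) p q r (x : plane) : 0 < orient (z p) (z q) (z r) ->
  closed_tri (z p) (z q) (z r) x ->
  exists2 w : 'rV[R]_n0, closed_simplex [set p; q; r]%SET w & pl_map z w = x.
Proof.
move=> D0 /and3P[h1 h2 h3]; eexists; last exact: bary_point D0.
have Dge := ltW D0; apply: tri_point_in.
- exact: divr_ge0.
- exact: divr_ge0.
- exact: divr_ge0.
by rewrite -!mulrDl orient_sum divff ?gt_eqF.
Qed.

Lemma pl_map_closed_tri (z : V -> plane) p q r w : 0 < orient (z p) (z q) (z r) ->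
  closed_simplex [set p; q; r]%SET w -> closed_tri (z p) (z q) (z r) (pl_map z w).
Proof.
move=> D0 hw; have h v : 0 <= w ord0 v by case: hw.
have D1 := D0; rewrite -orient_rot in D1; have D2 := D1; rewrite -orient_rot in D2.
have hw1 : closed_simplex [set q; r; p]%SET w by rewrite tri_set_rot.
have hw2 : closed_simplex [set r; p; q]%SET w by rewrite tri_set_rot.
apply/and3P; rewrite (orient_pl_map D0 hw) (orient_pl_map D1 hw1) (orient_pl_map D2 hw2).
by split; rewrite mulr_ge0 // ltW.
Qed.

Lemma pl_map_tri_inj (z : V -> plane) p q r w w' : 0 < orient (z p) (z q) (z r) ->
  closed_simplex [set p; q; r]%SET w -> closed_simplex [set p; q; r]%SET w' ->
  pl_map z w = pl_map z w' -> w = w'.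
Proof.
move=> D0 hw hw' e.
have D1 := D0; rewrite -orient_rot in D1; have D2 := D1; rewrite -orient_rot in D2.
have hw1 : closed_simplex [set q; r; p]%SET w by rewrite tri_set_rot.
have hw2 : closed_simplex [set r; p; q]%SET w by rewrite tri_set_rot.
have hw1' : closed_simplex [set q; r; p]%SET w' by rewrite tri_set_rot.
have hw2' : closed_simplex [set r; p; q]%SET w' by rewrite tri_set_rot.
have er : w ord0 r = w' ord0 r.
  by apply: (mulIf (lt0r_neq0 D0)); rewrite -(orient_pl_map D0 hw) -(orient_pl_map D0 hw') e.
have ep : w ord0 p = w' ord0 p.
  by apply: (mulIf (lt0r_neq0 D1)); rewrite -(orient_pl_map D1 hw1) -(orient_pl_map D1 hw1') e.
have eq : w ord0 q = w' ord0 q.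
  by apply: (mulIf (lt0r_neq0 D2)); rewrite -(orient_pl_map D2 hw2) -(orient_pl_map D2 hw2') e.
apply/rowP => v; case vs : (v \in [set p; q; r]%SET); last first.
  by case: hw => _ _ ->; [case: hw' => _ _ ->|]; rewrite ?vs.
by move: vs; rewrite !inE => /orP[/orP[]|] /eqP ->.
Qed.
End OrientedComplex.

(** * Injectivity of piecewise linear maps *)

Section Injective.
Variables (R : realType) (n0 : nat).
Notation V := 'I_n0.
Notation plane := 'rV[R]_2.
Variables (z : V -> plane) (F : seq (V * V * V)) (interior : pred V) (bd : V -> V -> Prop).
Hypothesis F_pos : forall p q r, (p, q, r) \in F -> 0 < orient (z p) (z q) (z r).
Hypothesis F_uniq : uniq F.
Hypothesis F_cross : forall x,
  \sum_(t <- F) tri_crossing (z t.1.1) (z t.1.2) (z t.2) x <= 1.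
Hypothesis F_opp : forall p q r, is_face F p q r -> bd p q \/ exists s, is_face F q p s.
Hypothesis F_vertex : forall v, exists q r, is_face F v q r.
Hypothesis bd_int : forall p q, bd p q -> ~~ interior p /\ ~~ interior q.
Hypothesis bd_vertex : forall v, ~~ interior v -> exists q, bd v q.

Definition on_bd (w : 'rV[R]_n0) := exists p q, bd p q /\ closed_simplex [set p; q]%SET w.
Definition in_face (w : 'rV[R]_n0) :=
  exists p q r, is_face F p q r /\ closed_simplex [set p; q; r]%SET w.
Hypothesis bd_inj : forall w w', on_bd w -> on_bd w' -> pl_map z w = pl_map z w' -> w = w'.

Lemma is_face_pos p q r : is_face F p q r -> 0 < orient (z p) (z q) (z r).
Proof.
case/or3P => /F_pos //; first by rewrite orient_rot.
by rewrite -orient_rot.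
Qed.

(** Two faces that overlap would contribute 2 to the total crossing number. *)
Lemma crossing_disjoint t t' x : t \in F -> t' \in F ->
  open_tri (z t.1.1) (z t.1.2) (z t.2) x -> open_tri (z t'.1.1) (z t'.1.2) (z t'.2) x -> t = t'.
Proof.
move=> tF t'F ot ot'; apply/eqP; apply: contraT => tt'.
have pos s : s \in F -> crossing_spec (z s.1.1) (z s.1.2) (z s.2) x.
  by case: s => [[p q] r] /F_pos; exact: tri_crossingP.
have := F_cross x; rewrite (bigD1_seq t) //= -big_filter (bigD1_seq t') ?filter_uniq //=; last first.
  by rewrite mem_filter eq_sym tt'.
have [_ -> // _] := pos _ tF; have [_ -> // _] := pos _ t'F.
set S := \sum_(_ <- _ | _) _; suff : 0 <= S by lra.
by rewrite /S big_seq_cond sumr_ge0 // => s /andP[]; rewrite mem_filter => /andP[_ /pos[]].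
Qed.

Lemma open_tri_rot (a b c x : plane) : open_tri b c a x = open_tri a b c x.
Proof. by rewrite /open_tri andbC -andbA andbC -andbA. Qed.

Lemma open_disjoint p q r p' q' r' x : is_face F p q r -> is_face F p' q' r' ->
  open_tri (z p) (z q) (z r) x -> open_tri (z p') (z q') (z r') x ->
  [set p; q; r]%SET = [set p'; q'; r']%SET.
Proof.
have listed a b c : is_face F a b c -> open_tri (z a) (z b) (z c) x ->
    exists2 t, t \in F & open_tri (z t.1.1) (z t.1.2) (z t.2) x /\ tri_set t = [set a; b; c]%SET.
  case/or3P => h o; [exists (a, b, c) | exists (b, c, a) | exists (c, a, b)] => //=; split=> //.
  - by rewrite open_tri_rot.
  - by rewrite /tri_set /= tri_set_rot.
  - by rewrite -open_tri_rot.
  - by rewrite /tri_set /= -tri_set_rot.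
move=> f f' o o'; have [t tF [ot <-]] := listed _ _ _ f o.
have [t' t'F [ot' <-]] := listed _ _ _ f' o'.
by rewrite (crossing_disjoint tF t'F ot ot').
Qed.

(** The slope of orient a b in the direction d. *)
Definition turn (a b d : plane) := (px b - px a) * py d - (py b - py a) * px d.

Lemma orient_move a b x d e : orient a b (x + e *: d) = orient a b x + e * turn a b d.
Proof. by rewrite /orient /turn !pE; ring. Qed.

Lemma move_pos (o k : R) : 0 < o -> exists2 e0, 0 < e0 & forall e, 0 < e -> e <= e0 -> 0 < o + e * k.
Proof.
move=> o0; exists (o / (2 * (o + `|k|))).
  by rewrite divr_gt0 // mulr_gt0 // ltr_pwDl.
have s0 : 0 < o + `|k| by rewrite ltr_pwDl.
move=> e e0; rewrite ler_pdivlMr; last by rewrite mulr_gt0.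
move=> h; have k1 : - `|k| <= k by rewrite lerNl -normrN ler_norm.
have : e * - `|k| <= e * k by rewrite ler_pM2l.
have : 0 < e * o by apply: mulr_gt0.
move: h; rewrite mulrCA mulrDr mulrN; lra.
Qed.

Lemma move_nonneg (o k : R) : 0 <= o -> (0 < o \/ 0 <= k) ->
  exists2 e0, 0 < e0 & forall e, 0 < e -> e <= e0 -> 0 <= o + e * k.
Proof.
move=> o0 [/move_pos|k0]; first by move=> /(_ k)[e0 ? h]; exists e0 => // e *; rewrite ltW ?h.
by exists 1 => // e e0 _; rewrite addr_ge0 // mulr_ge0 // ltW.
Qed.

Lemma min3_pos (a b c : R) : 0 < a -> 0 < b -> 0 < c ->
  exists2 e, 0 < e & [/\ e <= a, e <= b & e <= c].
Proof.
move=> a0 b0 c0; exists (Num.min a (Num.min b c)); first by rewrite !lt_min a0 b0.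
by rewrite !ge_min !lexx ?orbT.
Qed.

Lemma overlap_same p q r p' q' r' x : is_face F p q r -> is_face F p' q' r' ->
  closed_tri (z p) (z q) (z r) x -> open_tri (z p') (z q') (z r') x ->
  [set p; q; r]%SET = [set p'; q'; r']%SET.
Proof.
move=> f f' cl /and3P[p1 p2 p3]; have D := is_face_pos f.
pose c := center (z p) (z q) (z r).
have [e1 e10 h1] := move_pos (turn (z p') (z q') (c - x)) p1.
have [e2 e20 h2] := move_pos (turn (z q') (z r') (c - x)) p2.
have [e3 e30 h3] := move_pos (turn (z r') (z p') (c - x)) p3.
have [e e0 [ee1 ee2 ee3]] := min3_pos e10 e20 e30.
have [k k0 [k1 ke _]] := min3_pos ltr01 e0 ltr01.
apply: (open_disjoint f f' (open_tri_toward_center D cl k0 k1)).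
apply/and3P; split; rewrite orient_move; [apply: h1|apply: h2|apply: h3] => //;
  exact: le_trans ke _.
Qed.

Section Cone.
Variables (v : V) (d : plane).
Hypothesis v_int : interior v.
(* With d as the direction of the first axis, del q is the ordinate of q as seen
   from v, dot q its abscissa, and kap q = - dot q / del q increases with the
   angle on either side of the axis. *)
Let del q := px d * (py (z q) - py (z v)) - py d * (px (z q) - px (z v)).
Let dot q := px d * (px (z q) - px (z v)) + py d * (py (z q) - py (z v)).
Let kap q := - dot q / del q.
Let nb q := [exists r, is_face F v q r].

Lemma next_face q r : is_face F v q r -> exists s, is_face F v r s.
Proof.
move=> h; have [/bd_int[_]|//] := F_opp (is_face_rot (is_face_rot h)).
by rewrite v_int.
Qed.

Lemma del_identity q r : orient (z v) (z q) (z r) * (px d ^+ 2 + py d ^+ 2) =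
  dot q * del r - dot r * del q.
Proof. by rewrite /orient /dot /del; ring. Qed.

Lemma kap_lt q r : px d ^+ 2 + py d ^+ 2 > 0 -> is_face F v q r -> 0 < del q * del r -> kap q < kap r.
Proof.
move=> d0 f qr; have := del_identity q r; have := mulr_gt0 (is_face_pos f) d0 => h e.
have [q0 r0] : del q != 0 /\ del r != 0.
  by move: (gt_eqF qr); rewrite mulf_eq0 => /negbT; rewrite negb_or => /andP.
rewrite -subr_gt0 (_ : kap r - kap q = (dot q * del r - dot r * del q) / (del q * del r)).
  by rewrite divr_gt0 // -e.
rewrite /kap; move: (del q) (del r) (dot q) (dot r) q0 r0 => a b c e' a0 b0.
by field; rewrite a0 b0.
Qed.

(** Take a neighbor q strictly on the right of d for which kap is maximal; the next neighbor
    cannot be on the right of d, so that d lies between the two.  Such q exists,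
    because the same maximality argument on the left of d shows that turning
    around v cannot stop there. *)
Lemma cone_cover : exists q r, [/\ is_face F v q r, 0 <= turn (z v) (z q) d & 0 <= turn (z r) (z v) d].
Proof.
have [d0|d0] := eqVneq (px d ^+ 2 + py d ^+ 2) 0.
  have [q [r f]] := F_vertex v; exists q, r; split=> //; rewrite /turn;
  by move: d0; move/eqP; rewrite paddr_eq0 ?sqr_ge0 // !sqrf_eq0 => /andP[/eqP -> /eqP ->];
     rewrite !mulr0 subr0.
have {}d0 : 0 < px d ^+ 2 + py d ^+ 2 by rewrite lt_neqAle eq_sym d0 addr_ge0 ?sqr_ge0.
have nbP q r : is_face F v q r -> nb q by move=> f; apply/existsP; exists r.
have [q0 /andP[nq0 q0neg]] : exists q, nb q && (del q < 0).
  apply/existsP; apply: contraT; rewrite negb_exists => /forallP noneg.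
  have nonneg q : nb q -> 0 <= del q.
    by move=> nq; have := noneg q; rewrite nq -leNgt.
  have [q1 [r1 f1]] := F_vertex v; have [s1 f2] := next_face f1.
  have [i0 /andP[ni0 i0pos]] : exists q, nb q && (0 < del q).
    have := nonneg _ (nbP _ _ f1); rewrite le_eqVlt => /orP[/eqP e|h]; last by exists q1; rewrite (nbP _ _ f1).
    have := nonneg _ (nbP _ _ f2); rewrite le_eqVlt => /orP[/eqP e'|h]; last by exists r1; rewrite (nbP _ _ f2).
    have := mulr_gt0 (is_face_pos f1) d0; rewrite del_identity -e -e' !mulr0 subrr ltxx //.
  pose P q := nb q && (0 < del q).
  have Pi0 : P i0 by rewrite /P ni0.
  case: (@Order.TotalTheory.arg_maxP _ _ _ i0 P kap Pi0) => q /andP[/existsP[r f] qpos] qmax.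
  have [s f'] := next_face f.
  have := nonneg _ (nbP _ _ f'); rewrite le_eqVlt => /orP[/eqP e|rpos].
    have h1 := mulr_gt0 (is_face_pos f) d0; rewrite del_identity -e mulr0 sub0r oppr_gt0 in h1.
    have h2 := mulr_gt0 (is_face_pos f') d0; rewrite del_identity -e mulr0 subr0 in h2.
    have [t f''] := next_face f'; have := nonneg _ (nbP _ _ f'').
    move: h1; rewrite pmulr_llt0 // => h1; move: h2; rewrite nmulr_rgt0 // => h2; lra.
  have := qmax r; rewrite /P (nbP _ _ f') rpos => /(_ isT) /= h.
  by have := lt_le_trans (kap_lt d0 f (mulr_gt0 qpos rpos)) h; rewrite ltxx.
pose P q := nb q && (del q < 0).
have Pq0 : P q0 by rewrite /P nq0.
case: (@Order.TotalTheory.arg_maxP _ _ _ q0 P kap Pq0) => q /andP[/existsP[r f] qneg] qmax.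
exists q, r; split=> //.
  by rewrite (_ : turn _ _ _ = - del q) ?oppr_ge0 ?ltW // /turn /del; ring.
rewrite (_ : turn _ _ _ = del r); last by rewrite /turn /del; ring.
rewrite leNgt; apply/negP => rneg; have [s f'] := next_face f.
have := qmax r; rewrite /P (nbP _ _ f') rneg => /(_ isT) /= h.
have qr : 0 < del q * del r by rewrite nmulr_rgt0.
by have := lt_le_trans (kap_lt d0 f qr) h; rewrite ltxx.
Qed.
End Cone.

Lemma closed_simplex_sub (s s' : {set V}) (w : 'rV[R]_n0) : closed_simplex s w ->
  (forall v, v \in s -> w ord0 v != 0 -> v \in s') -> closed_simplex s' w.
Proof.
case=> w0 w1 ws h; split=> // v vs'; case vs: (v \in s); last by rewrite ws ?vs.
by apply/eqP; apply: contraNT vs' => /(h _ vs).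
Qed.

Definition star_dir (w : 'rV[R]_n0) (d : plane) := exists p q r, [/\ is_face F p q r,
  closed_simplex [set p; q; r]%SET w &
  exists2 e0, 0 < e0 & forall e, 0 < e -> e <= e0 -> closed_tri (z p) (z q) (z r) (pl_map z w + e *: d)].

Lemma star_dirI p q r w d : is_face F p q r -> closed_simplex [set p; q; r]%SET w ->
  (0 < w ord0 r \/ 0 <= turn (z p) (z q) d) -> (0 < w ord0 p \/ 0 <= turn (z q) (z r) d) ->
  (0 < w ord0 q \/ 0 <= turn (z r) (z p) d) -> star_dir w d.
Proof.
move=> f hw hr hp hq; exists p, q, r; split=> //.
have D0 := is_face_pos f; have D1 := D0; rewrite -orient_rot in D1.
have D2 := D1; rewrite -orient_rot in D2.
have hw1 : closed_simplex [set q; r; p]%SET w by rewrite tri_set_rot.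
have hw2 : closed_simplex [set r; p; q]%SET w by rewrite tri_set_rot.
have /and3P[c1 c2 c3] := pl_map_closed_tri D0 hw.
have g1 : 0 < orient (z p) (z q) (pl_map z w) \/ 0 <= turn (z p) (z q) d.
  by rewrite (orient_pl_map D0 hw) pmulr_lgt0.
have g2 : 0 < orient (z q) (z r) (pl_map z w) \/ 0 <= turn (z q) (z r) d.
  by rewrite (orient_pl_map D1 hw1) pmulr_lgt0.
have g3 : 0 < orient (z r) (z p) (pl_map z w) \/ 0 <= turn (z r) (z p) d.
  by rewrite (orient_pl_map D2 hw2) pmulr_lgt0.
have [e1 e10 h1] := move_nonneg c1 g1; have [e2 e20 h2] := move_nonneg c2 g2.
have [e3 e30 h3] := move_nonneg c3 g3; have [e0 e00 [m1 m2 m3]] := min3_pos e10 e20 e30.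
exists e0 => // e epos ee; apply/and3P; split; rewrite orient_move;
  [apply: h1|apply: h2|apply: h3] => //; exact: le_trans ee _.
Qed.

Lemma star_vertex v w d : ~ on_bd w -> closed_simplex [set v]%SET w -> star_dir w d.
Proof.
move=> nb hw; have wv : w ord0 v = 1.
  case: hw => _ <- h; rewrite (bigD1 v) //= big1 ?addr0 // => u uv.
  by apply: h; rewrite inE.
have vi : interior v.
  apply/negPn/negP => /bd_vertex[q b]; apply: nb; exists v, q; split=> //.
  by apply: closed_simplex_sub hw _ => u; rewrite !inE => ->.
have [q [r [f h1 h2]]] := cone_cover d vi; apply: (star_dirI f).
- by apply: closed_simplex_sub hw _ => u; rewrite !inE => ->.
- by right.
- by left; rewrite wv.
- by right.
Qed.

(** An edge off the boundary has faces on both sides. *)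
Lemma star_edge p q r w d : ~ on_bd w -> is_face F p q r -> closed_simplex [set p; q; r]%SET w ->
  w ord0 r = 0 -> 0 < w ord0 p -> 0 < w ord0 q -> star_dir w d.
Proof.
move=> nb f hw wr wp wq; have [h|h] := leP 0 (turn (z p) (z q) d).
  by apply: (star_dirI f hw); [right|left|left].
have hpq : closed_simplex [set p; q]%SET w.
  apply: closed_simplex_sub hw _ => u; rewrite !inE => /orP[->//|/eqP ->].
  by rewrite wr eqxx.
have [b|[s fs]] := F_opp f; first by case: nb; exists p, q.
have hw' : closed_simplex [set q; p; s]%SET w.
  by apply: closed_simplex_sub hpq _ => u; rewrite !inE orbC => ->.
apply: (star_dirI fs hw'); [right|by left|by left].
by rewrite ltW // (_ : turn _ _ _ = - turn (z p) (z q) d) ?oppr_gt0 // /turn; ring.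
Qed.

(** By cone_cover if the carrier of the point is a vertex, by star_edge if it is
    an edge; in an open face all directions are allowed. *)
Lemma star_cover w d : ~ on_bd w -> in_face w -> star_dir w d.
Proof.
move=> nb [p [q [r [f hw]]]].
have w0 v : 0 <= w ord0 v by case: hw.
have hw1 : closed_simplex [set q; r; p]%SET w by rewrite tri_set_rot.
have hw2 : closed_simplex [set r; p; q]%SET w by rewrite tri_set_rot.
have f1 := is_face_rot f; have f2 := is_face_rot f1.
have only u a b : u \in [set p; q; r]%SET -> [set a; b; u]%SET = [set p; q; r]%SET ->
    w ord0 a = 0 -> w ord0 b = 0 -> star_dir w d.
  move=> _ e wa wb; apply: (@star_vertex u) => //.
  apply: closed_simplex_sub hw _ => v; rewrite -e !inE => /orP[/orP[]|] /eqP -> //.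
    by rewrite wa eqxx.
  by rewrite wb eqxx.
have pos v : w ord0 v != 0 -> 0 < w ord0 v by move=> h; rewrite lt0r h w0.
have [p0|pn] := eqVneq (w ord0 p) 0; have [q0|qn] := eqVneq (w ord0 q) 0.
- by apply: (only r p q) => //; rewrite !inE eqxx !orbT.
- have [r0|rn] := eqVneq (w ord0 r) 0.
    by apply: (only q r p) => //; [rewrite !inE eqxx !orbT | rewrite 2!tri_set_rot].
  by apply: (star_edge d nb f1 hw1); rewrite ?pos.
- have [r0|rn] := eqVneq (w ord0 r) 0.
    by apply: (only p q r) => //; [rewrite !inE eqxx | rewrite tri_set_rot].
  by apply: (star_edge d nb f2 hw2); rewrite ?pos.
have [r0|rn] := eqVneq (w ord0 r) 0.
  by apply: (star_edge d nb f hw); rewrite ?pos.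
by apply: (star_dirI f hw); left; exact: pos.
Qed.

(** If w is off the boundary and w' is another point over x, move from x towards
    the center of the face of w': the image enters the interior of that face, and
    it remains in a face around w.  The two faces overlap, hence they coincide. *)
Lemma inj_off_boundary w w' : ~ on_bd w -> in_face w -> in_face w' ->
  pl_map z w = pl_map z w' -> w = w'.
Proof.
move=> nb iw [p' [q' [r' [f' hw']]]] e; set x := pl_map z w.
have D' := is_face_pos f'; have cl := pl_map_closed_tri D' hw'; rewrite -e -/x in cl.
pose c := center (z p') (z q') (z r').
have [p [q [r [f hw [e0 e00 he]]]]] := star_cover (c - x) nb iw.
have [k k0 [k1 ke _]] := min3_pos ltr01 e00 ltr01.
have same : [set p; q; r]%SET = [set p'; q'; r']%SET.
  exact: (overlap_same f f' (he _ k0 ke) (open_tri_toward_center D' cl k0 k1)).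
by apply: (pl_map_tri_inj (is_face_pos f) hw) => //; rewrite same.
Qed.

Theorem pl_map_inj w w' : in_face w -> in_face w' -> pl_map z w = pl_map z w' -> w = w'.
Proof.
move=> iw iw' e; have [bw|nb] := pselect (on_bd w); last exact: inj_off_boundary.
have [bw'|nb'] := pselect (on_bd w'); first exact: bd_inj.
by apply/esym; apply: inj_off_boundary.
Qed.
End Injective.

(** * Compactness of realizations *)

(** Images of closed subsets are compact, hence closed. *)
Lemma compact_homeomorphism (S : ptopologicalType) (T : topologicalType) (A : set S) (f : S -> T) :
  hausdorff_space T -> compact A -> {within A, continuous f} -> {in A &, injective f} ->
  homeomorphism A (f @` A) f.
Proof.
move=> hT cA cf fi; split=> //.
  by split; [move=> x Ax; exists x | exact: fi | move=> y].
pose g y := get [set x | A x /\ f x = y].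
have gP y : (f @` A) y -> A (g y) /\ f (g y) = y.
  by move=> [x Ax fx]; apply: (@getPex _ [set x | A x /\ f x = y]); exists x.
have gf x : A x -> g (f x) = x.
  move=> Ax; have [|Ag e] := gP (f x); first by exists x.
  by apply: fi; rewrite ?inE.
exists g; first by move=> x; rewrite inE; exact: gf.
apply/continuous_closedP => C cC; apply/closed_subspaceP.
exists (f @` (A `&` C)).
  apply: compact_closed => //; apply: continuous_compact; last exact: compact_closedI.
  by apply: continuous_subspaceW cf; exact: subIsetl.
apply/seteqP; split=> y [].
  move=> [x [Ax Cx] <-] fAx; split=> //; change (C (g (f x))); by rewrite gf.
move=> Cg fAy; have [Ag e] := gP _ fAy; split=> //; by exists (g y).
Qed.

Section Simplices.
Variables (R : realType) (n0 : nat).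
Notation V := 'I_n0.

Lemma compact_closed_simplex (s : {set V}) : compact (@closed_simplex R n0 s).
Proof.
apply: (subclosed_compact _ (@compact_cube R n0)); last first.
  move=> x [x0 x1 _] i; rewrite x0 -x1 (bigD1 i) //= lerDl sumr_ge0 // => j _; exact: x0.
have -> : @closed_simplex R n0 s = (\bigcap_(v in [set: V]) [set x | 0 <= x ord0 v]) `&`
   ([set x | \sum_v x ord0 v <= 1] `&` [set x | 1 <= \sum_v x ord0 v]) `&`
   (\bigcap_(v in [set v : V | v \notin s]) ([set x | x ord0 v <= 0] `&` [set x | 0 <= x ord0 v])).
  apply/seteqP; split=> x.
    move=> [x0 x1 xs]; split; first (split; last by rewrite /= x1 lexx).
      by move=> v _; exact: x0.
    by move=> v vs; rewrite /= xs ?lexx.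
  move=> [[h0 [/= h1 h2]] h3]; split=> [v||v vs]; first exact: h0.
    by apply/le_anti; rewrite h1.
  by apply/le_anti/andP; case: (h3 v vs).
have cc v : continuous (fun x : 'rV[R]_n0 => x ord0 v) by exact: coord_continuous.
have cs : continuous (fun x : 'rV[R]_n0 => \sum_v x ord0 v) by apply: cont_sum.
apply: closedI; first apply: closedI.
- by apply: closed_bigI => v _; apply: closed_le; [exact: cont_cst | exact: cc].
- by apply: closedI; apply: closed_le => //; exact: cont_cst.
by apply: closed_bigI => v _; apply: closedI; apply: closed_le; by [exact: cont_cst | exact: cc].
Qed.

Lemma compact_finite_bigcup (I : finType) (P : set I) (A : I -> set 'rV[R]_n0) :
  (forall i, compact (A i)) -> compact (\bigcup_(i in P) A i).
Proof.
move=> cA; rewrite -bigsetU_fset_set; last exact: finite_finset.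
by apply: bigsetU_compact => i _.
Qed.

Lemma compact_skeleton1 (T : complex2 n0) : compact (@skeleton1 R n0 T).
Proof.
by apply: compactU; apply: compact_finite_bigcup => i; exact: compact_closed_simplex.
Qed.

Lemma compact_realization (T : complex2 n0) : compact (@realization R n0 T).
Proof.
apply: compactU; first exact: compact_skeleton1.
by apply: compact_finite_bigcup => i; exact: compact_closed_simplex.
Qed.

Lemma edge_simplexP (p q : V) (w : 'rV[R]_n0) : p != q -> closed_simplex [set p; q]%SET w ->
  0 <= w ord0 q <= 1 /\ w = segment_path (vertex_point R p) (vertex_point R q) (w ord0 q).
Proof.
move=> pq [w0 w1 ws]; have s1 : w ord0 p + w ord0 q = 1.
  rewrite -w1 (bigD1 p) //= (bigD1 q) /= 1?eq_sym // big1 ?addr0 // => v /andP[vp vq].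
  by apply: ws; rewrite !inE negb_or vp.
split; first by rewrite w0 -s1 lerDr w0.
apply/rowP => v; rewrite /segment_path !mxE /=.
have -> : 1 - w ord0 q = w ord0 p by rewrite -s1 addrK.
have [->|vp] := eqVneq v p; first by rewrite (negbTE pq) mulr1 mulr0 addr0.
have [->|vq] := eqVneq v q; first by rewrite mulr1 mulr0 add0r.
by rewrite !mulr0 addr0 ws // !inE negb_or vp.
Qed.

Lemma segment_in_edge (p q : V) (t : R) : 0 <= t <= 1 ->
  closed_simplex [set p; q]%SET (segment_path (vertex_point R p) (vertex_point R q) t).
Proof.
move=> /andP[t0 t1].
have -> : segment_path (vertex_point R p) (vertex_point R q) t = tri_point p q q (1 - t) t 0.
  by rewrite /tri_point scale0r addr0.
have := @tri_point_in R n0 p q q (1 - t) t 0.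
rewrite (_ : [set p; q; q]%SET = [set p; q]%SET); last by apply/setP => v; rewrite !inE -orbA orbb.
by apply=> //; [rewrite subr_ge0 | rewrite addr0 subrK].
Qed.

Section RealizationOf.
Variable F : seq (V * V * V).
Hypothesis F_distinct : forall p q r, (p, q, r) \in F -> [/\ p != q, q != r & p != r].
Hypothesis F_vertex : forall v, exists q r, is_face F v q r.

Lemma tri_facesP (f : {set V}) : f \in tri_faces F ->
  exists p q r, (p, q, r) \in F /\ f = [set p; q; r]%SET.
Proof. by rewrite inE => /andP[_ /hasP[[[p q] r] tF /eqP ->]]; exists p, q, r. Qed.

Lemma mem_tri_faces p q r : is_face F p q r -> [set p; q; r]%SET \in tri_faces F.
Proof.
have listed a b c : (a, b, c) \in F -> [set a; b; c]%SET \in tri_faces F.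
  move=> tF; have [ab bc ac] := F_distinct tF.
  rewrite inE finset.setUC cardsU1 cards2 ab !inE negb_or ![c == _]eq_sym ac bc /=.
  by apply/hasP; exists (a, b, c); rewrite // finset.setUC.
by case/or3P => /listed //; [rewrite tri_set_rot | rewrite -tri_set_rot].
Qed.

Lemma is_face_distinct p q r : is_face F p q r -> [/\ p != q, q != r & p != r].
Proof. by case/or3P => /F_distinct[h1 h2 h3]; split=> //; rewrite eq_sym. Qed.

Lemma mem_tri_edges p q r : is_face F p q r -> [set p; q]%SET \in tri_edges F.
Proof.
move=> f; have [pq _ _] := is_face_distinct f.
apply: (tri_face_edges (mem_tri_faces f)); last by rewrite cards2 pq.
by apply/fintype.subsetP => v; rewrite !inE => ->.
Qed.

Lemma skeleton1_in_face (w : 'rV[R]_n0) : skeleton1 (complex_of F) w -> in_face F w.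
Proof.
case=> [[v _ hw]|[e /= eF hw]].
  have [q [r f]] := F_vertex v; exists v, q, r; split=> //.
  by apply: closed_simplex_sub hw _ => u; rewrite !inE => ->.
move: eF; rewrite inE => /andP[_ /existsP[f /andP[/tri_facesP[p [q [r [tF ->]]]] ef]]].
exists p, q, r; split; first exact: mem_is_face.
by apply: closed_simplex_sub hw _ => u /(fintype.subsetP ef).
Qed.

Lemma realization_of : @realization R n0 (complex_of F) = in_face F.
Proof.
apply/seteqP; split=> w; first case=> [/skeleton1_in_face //|[f /= fF hw]].
  have [p [q [r [tF e]]]] := tri_facesP fF; exists p, q, r; rewrite -e; split=> //.
  exact: mem_is_face.
by move=> [p [q [r [f hw]]]]; right; exists [set p; q; r]%SET => //; exact: mem_tri_faces.
Qed.
End RealizationOf.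
End Simplices.

(** * Positive vertex positions give triangulations *)

Section GeometricTriangulation.
Variables (R : realType) (kL kU k : nat) (L U : nat -> 'rV[R]_2).
Hypothesis chains : monotone_chains kL kU L U.
Let k2 := sides_gt2 chains.
Let incrL := lower_incr chains.
Let incrU := upper_incr chains.
Let startLU := chains_start chains.
Let endLU := chains_end chains.
Notation m := (kL + kU)%N.
Notation V := 'I_(k + (kL + kU)).
Notation plane := 'rV[R]_2.
Let phi : 'I_m -> plane := @mono_polygon R kL kU L U.
Notation bv := (@boundary_vertex m k).
Variables (z : V -> plane) (F : seq (V * V * V)).
Hypothesis z_bd : forall j, z (bv j) = phi j.
Hypothesis F_pos : forall p q r, (p, q, r) \in F -> 0 < orient (z p) (z q) (z r).
Hypothesis F_vertex : forall v, exists q r, is_face F v q r.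
Hypothesis F_opp : forall p q r, is_face F p q r ->
  (exists j, p = bv j /\ q = bv (ordS j)) \/ exists s, is_face F q p s.
Hypothesis F_bd : forall j, exists s, is_face F (bv j) (bv (ordS j)) s.
Hypothesis F_sum : forall c : V -> V -> R, (forall u v, c v u = - c u v) ->
  \sum_(t <- F) (c t.1.1 t.1.2 + c t.1.2 t.2 + c t.2 t.1.1) = \sum_j c (bv j) (bv (ordS j)).

Let T : complex2 (k + m) := complex_of F.
Let psi : 'rV[R]_(k + m) -> plane := pl_map z.
Let region := mono_region kL kU L U.
Let halfopen x := (px (L 0%N) <= px x < px (L kL)) && (polyfun L kL (px x) <= py x < polyfun U kU (px x)).

Lemma F_distinct p q r : (p, q, r) \in F -> [/\ p != q, q != r & p != r].
Proof. by move=> /F_pos; exact: tri_distinct. Qed.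

(** The ray below x meets the lower chain, if x is above it, and the upper chain
    with the opposite sign, if x is above that one too. *)
Lemma boundary_crossing x : \sum_(j : 'I_m) crossing (phi j) (phi (ordS j)) x = (halfopen x)%:R.
Proof.
rewrite big_split_ord /=.
have -> : \sum_(i < kL) crossing (phi (lshift kU i)) (phi (ordS (lshift kU i))) x =
    \sum_(i < kL) crossing (L i) (L i.+1) x.
  by apply: eq_bigr => i _; rewrite /phi; have [-> ->] := mono_lower chains (j := lshift kU i) (ltn_ord i).
have -> : \sum_(i < kU) crossing (phi (rshift kL i)) (phi (ordS (rshift kL i))) x =
    \sum_(i < kU) - crossing (U i) (U i.+1) x.
  rewrite (reindex_inj rev_ord_inj) /=; apply: eq_bigr => i _; rewrite -crossingC.
  rewrite /phi; have [-> ->] := mono_upper chains (j := rshift kL (rev_ord i)) (leq_addr _ _).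
  have -> : (kL + kU - rshift kL (rev_ord i) = i.+1)%N.
    by rewrite /= subnDl subKn.
  by [].
rewrite sumrN (sum_crossing incrL) (sum_crossing incrU) -startLU -endLU /halfopen.
case: (px (L 0%N) <= px x < px (L kL)) / boolP => [/andP[h0 h1]|] /=; last by rewrite subrr.
have := lo_le_up chains (X := px x).
rewrite h0 (ltW h1) => /(_ isT) lu.
case: (leP (polyfun L kL (px x)) (py x)) => hl; case: (leP (polyfun U kU (px x)) (py x)) => hu //=; rewrite ?subrr ?subr0 //.
by move: (lt_le_trans hl (le_trans lu hu)); rewrite ltxx.
Qed.

(** Inner edges are traversed twice, in opposite directions. *)
Lemma total_crossing x :
  \sum_(t <- F) tri_crossing (z t.1.1) (z t.1.2) (z t.2) x = (halfopen x)%:R.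
Proof.
rewrite -boundary_crossing (F_sum (c := fun u v => crossing (z u) (z v) x)) => [|u v].
  by apply: eq_bigr => j _; rewrite !z_bd.
exact: crossingC.
Qed.

(** A face listed twice would count its center twice. *)
Lemma F_uniq : uniq F.
Proof.
apply: count_mem_uniq => -[[p q] r]; have [tF|tF] := boolP ((p, q, r) \in F); last by rewrite (count_memPn tF).
apply/eqP; rewrite eqn_leq -has_count has_pred1 tF andbT.
pose x := center (z p) (z q) (z r).
have D0 := F_pos tF; have o : open_tri (z p) (z q) (z r) x := open_center D0.
have [_ /(_ o) t1 _] := tri_crossingP x D0.
have : \sum_(t <- F) (t == (p, q, r))%:R <= (halfopen x)%:R :> R.
  rewrite -total_crossing big_seq [X in _ <= X]big_seq; apply: ler_sum => -[[a b] c] /F_pos/(tri_crossingP x)[c0 _ _] /=.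
  by case: eqP => [[-> -> ->]|_]; rewrite ?t1.
rewrite -natr_sum (_ : \sum_(t <- F) (t == (p, q, r)) = count_mem (p, q, r) F)%N; last first.
  by rewrite -sum1_count [RHS]big_mkcond; apply: eq_bigr => t _ /=; case: eqP.
case: (halfopen x); rewrite ler_nat // => h; exact: leq_trans h _.
Qed.

Let interior (v : V) := (v < k)%N.
Let bd (p q : V) := exists j, p = bv j /\ q = bv (ordS j).

Lemma ordS_neq (j : 'I_m) : ordS j != j.
Proof.
rewrite -val_eqE /=; have := ltn_ord j; rewrite leq_eqVlt => /orP[/eqP e|h].
  by rewrite e modnn; apply/eqP => j0; rewrite -j0 in e; move: k2; rewrite -e.
by rewrite modn_small // gtn_eqF.
Qed.

Lemma on_bd_path (w : 'rV[R]_(k + m)) : on_bd bd w -> exists j s, 0 <= s < 1 /\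
  w = segment_path (vertex_point R (bv j)) (vertex_point R (bv (ordS j))) s.
Proof.
move=> [p [q [[j [-> ->]] hw]]].
have jS : bv j != bv (ordS j) by rewrite (inj_eq (@rshift_inj _ _)) eq_sym ordS_neq.
have [/andP[s0]] := edge_simplexP jS hw; rewrite le_eqVlt => /orP[/eqP -> wE|s1 wE].
  exists (ordS j), 0; rewrite lexx ltr01; split=> //.
  by rewrite wE /segment_path subrr !scale0r subr0 !scale1r add0r addr0.
by exists j, (w ord0 (bv (ordS j))); rewrite s0.
Qed.

Lemma psi_path j s : psi (segment_path (vertex_point R (bv j)) (vertex_point R (bv (ordS j))) s) =
  segment_path (phi j) (phi (ordS j)) s.
Proof. by rewrite /psi pl_map_segment !pl_map_vertex !z_bd. Qed.

Lemma psi_bd_inj w w' : on_bd bd w -> on_bd bd w' -> psi w = psi w' -> w = w'.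
Proof.
move=> /on_bd_path[j [s [s01 ->]]] /on_bd_path[j' [s' [s01' ->]]]; rewrite !psi_path => e.
have [_ inj] := mono_embedded chains.
by have [-> ->] := inj _ _ _ _ s01 s01' e.
Qed.

Lemma psi_inj w w' : in_face F w -> in_face F w' -> psi w = psi w' -> w = w'.
Proof.
have uF := F_uniq; apply: (@pl_map_inj _ _ z F interior bd) => //.
- by move=> x; rewrite total_crossing; case: (halfopen x).
- by move=> p q [j [-> ->]]; rewrite /interior /= -!leqNgt !leq_addr.
- move=> v; rewrite /interior -leqNgt => kv.
  have vm : (v - k < m)%N by rewrite ltn_subLR.
  exists (bv (ordS (Ordinal vm))), (Ordinal vm); split=> //.
  by apply: val_inj; rewrite /= subnKC.
exact: psi_bd_inj.
Qed.

Lemma realizationE : @realization R _ T = in_face F.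
Proof. exact: (realization_of R F_distinct F_vertex). Qed.

Lemma open_tri_region p q r x : (p, q, r) \in F -> open_tri (z p) (z q) (z r) x -> region x.
Proof.
move=> tF o; have [h|] := boolP (halfopen x).
  by move: h => /andP[/andP[h0 h1] /andP[h2 h3]]; split; rewrite ?h0 ?h2 ltW.
move=> /negbTE nh; have := total_crossing x; rewrite nh (bigD1_seq (p, q, r) tF F_uniq) /= => e.
have [_ /(_ o) t1 _] := tri_crossingP x (F_pos tF).
have : 0 <= \sum_(t <- F | t != (p, q, r)) tri_crossing (z t.1.1) (z t.1.2) (z t.2) x.
  by rewrite big_seq_cond; apply: sumr_ge0 => -[[a b] c] /andP[/F_pos/(tri_crossingP x)[]].
by move: e; rewrite t1 mulr0n; lra.
Qed.

Lemma closed_tri_region p q r x : (p, q, r) \in F -> closed_tri (z p) (z q) (z r) x -> region x.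
Proof.
move=> tF cl; apply: contrapT => nx; pose c := center (z p) (z q) (z r).
pose y (d : R) := x + d *: (c - x).
have cy : continuous y by apply: cont_mx => i j; under eq_fun do rewrite !mxE; cont_tac.
have oR : open (~` region) by apply: closed_openC; exact: closed_mono_region.
have : nbhs (0 : R) (y @^-1` (~` region)).
  by apply: cy; apply: open_nbhs_nbhs; split=> //; rewrite /y scale0r addr0.
move=> /nbhs_ballP[e /= e0 he].
have [d d0 [d1 de _]] := min3_pos ltr01 (divr_gt0 e0 (ltr0n _ 2)) ltr01.
have : ~ region (y d).
  by apply: he; rewrite /ball /= sub0r normrN gtr0_norm //; lra.
apply; exact: (open_tri_region tF (open_tri_toward_center (F_pos tF) cl d0 d1)).
Qed.

Lemma psi_region w : in_face F w -> region (psi w).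
Proof.
move=> [p [q [r [f hw]]]].
have [a [b [c [tF e]]]] := tri_facesP (mem_tri_faces F_distinct f).
by apply: (closed_tri_region tF); apply: pl_map_closed_tri; [exact: F_pos | rewrite -e].
Qed.

(** A point of the region off the upper chain and the right end has total crossing
    number 1, hence lies in a face; the rest of the region is on the boundary. *)
Lemma psi_image : psi @` in_face F = region.
Proof.
apply/seteqP; split=> [_ [w hw <-]|x]; first exact: psi_region.
have [h _|nh] := boolP (halfopen x).
  have [[[p q] r] tF tp] : exists2 t, t \in F & 0 < tri_crossing (z t.1.1) (z t.1.2) (z t.2) x.
    apply: contrapT => h'; have := total_crossing x; rewrite h big_seq big1 => [/eqP|t tF].
      by rewrite eq_sym oner_eq0.
    apply/eqP; apply: contraT => n0; case: h'; exists t => //; rewrite lt0r n0 /=.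
    by case: t tF {n0} => [[a b] c] /F_pos/(tri_crossingP x)[].
  have [_ _ /(_ tp) cl] := tri_crossingP x (F_pos tF).
  have [w hw <-] := closed_tri_point (F_pos tF) cl.
  by exists w => //; exists p, q, r; split=> //; exact: mem_is_face.
rewrite /region mono_regionE // => -[[j _ [s]]|[/andP[h0 h1] /andP[l u]]].
  rewrite /= in_itv /= => s01 <-; have [a f] := F_bd j.
  exists (segment_path (vertex_point R (bv j)) (vertex_point R (bv (ordS j))) s); last exact: psi_path.
  exists (bv j), (bv (ordS j)), a; split=> //.
  by apply: closed_simplex_sub (segment_in_edge _ _ s01) _ => v; rewrite !inE => ->.
by move: nh; rewrite /halfopen (ltW h0) h1 u (ltW l).
Qed.

Lemma psi_homeo (A : set 'rV[R]_(k + m)) : compact A -> A `<=` in_face F ->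
  homeomorphism A (psi @` A) psi.
Proof.
move=> cA Af; apply: (compact_homeomorphism (@norm_hausdorff R plane) cA).
- by apply: continuous_subspaceT; exact: cont_pl_map.
- by move=> w w'; rewrite !inE => /Af hw /Af hw'; exact: psi_inj.
Qed.

Theorem geometric_is_triangulation : is_triangulation phi T.
Proof.
split=> [j|]; first by have [s f] := F_bd j; exact: (mem_tri_edges F_distinct f).
exists psi; split.
- have <- : psi @` @realization R _ T = polygon_region phi.
    by rewrite realizationE psi_image (mono_polygon_region chains).
  by apply: psi_homeo; [exact: compact_realization | move=> w; rewrite realizationE].
- by move=> j; rewrite /psi pl_map_vertex z_bd.
move=> j; have jS : bv j != bv (ordS j) by rewrite (inj_eq (@rshift_inj _ _)) eq_sym ordS_neq.
apply/seteqP; split=> [x [w hw <-{x}]|x [s] /=].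
  have [s01 ->] := edge_simplexP jS hw; exists (w ord0 (bv (ordS j))); last by rewrite psi_path.
  by rewrite /= in_itv.
rewrite in_itv /= => s01 <-{x}; eexists; last exact: psi_path.
exact: segment_in_edge.
Qed.

Theorem pl_map_geodesic : geodesic_triangulation phi T psi.
Proof.
have sk : @skeleton1 R _ T `<=` in_face F by move=> w; exact: skeleton1_in_face.
split.
- by apply: psi_homeo => //; exact: compact_skeleton1.
- by rewrite (mono_polygon_region chains) => _ [w /sk hw <-]; exact: psi_region.
- by move=> j; rewrite /psi pl_map_vertex z_bd.
by move=> u v _ t _; rewrite /psi pl_map_segment.
Qed.
End GeometricTriangulation.

(** * Leaving a triangle along a line *)

Section PlaneLemmas.
Variable R : realType.
Notation plane := 'rV[R]_2.
Implicit Types a b c x : plane.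

Lemma bary_plane a b c x (D := orient a b c) : D != 0 ->
  x = (orient b c x / D) *: a + (orient c a x / D) *: b + (orient a b x / D) *: c.
Proof.
move=> D0; apply: plane_eq; rewrite !pE; move: D0; rewrite /D /orient => D0; by field.
Qed.

Lemma bary_sum a b c x (D := orient a b c) : D != 0 ->
  orient b c x / D + orient c a x / D + orient a b x / D = 1.
Proof. by move=> D0; rewrite -!mulrDl orient_sum divff. Qed.

Lemma collinear_path a b x : a != b -> orient a b x = 0 -> exists t, x = segment_path a b t.
Proof.
move=> ab o; pose dx := px b - px a; pose dy := py b - py a.
have n0 : dx ^+ 2 + dy ^+ 2 != 0.
  rewrite paddr_eq0 ?sqr_ge0 // !sqrf_eq0 !subr_eq0; apply: contra ab => /andP[/eqP ex /eqP ey].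
  by apply/eqP; apply: plane_eq.
exists ((dx * (px x - px a) + dy * (py x - py a)) / (dx ^+ 2 + dy ^+ 2)).
have o' : dx * (py x - py a) = dy * (px x - px a) by apply/eqP; rewrite -subr_eq0 -/(orient a b x) o.
apply: plane_eq; rewrite ?px_segment_path ?py_segment_path -/dx -/dy.
  apply: (mulIf n0); rewrite mulrDl mulrAC divfK //.
  have -> : (dx * (px x - px a) + dy * (py x - py a)) * dx =
     dx * dx * (px x - px a) + dy * (dx * (py x - py a)) by ring.
  by rewrite o'; ring.
apply: (mulIf n0); rewrite mulrDl mulrAC divfK //.
have -> : (dx * (px x - px a) + dy * (py x - py a)) * dy =
   dx * (dy * (px x - px a)) + dy * dy * (py x - py a) by ring.
by rewrite -o'; ring.
Qed.

(** The time t is the first one at which some quantity e.1 + t e.2 vanishes. *)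
Lemma first_zero (s : seq (R * R)) : all (fun e : R * R => 0 < e.1) s -> has (fun e : R * R => e.2 < 0) s ->
  exists2 t, 0 < t & all (fun e : R * R => 0 <= e.1 + t * e.2) s && has (fun e : R * R => e.1 + t * e.2 == 0) s.
Proof.
elim: s => // -[u a] s IH /= /andP[u0 s0] neg.
have stop : a < 0 -> all (fun e : R * R => 0 <= e.1 + u / - a * e.2) s ->
    exists2 t, 0 < t & ((0 <= u + t * a) && all (fun e : R * R => 0 <= e.1 + t * e.2) s) &&
      ((u + t * a == 0) || has (fun e : R * R => e.1 + t * e.2 == 0) s).
  move=> a0 h; exists (u / - a); first by rewrite divr_gt0 // oppr_gt0.
  have z : u + u / - a * a = 0 by field; rewrite lt_eqF.
  by rewrite z lexx eqxx h.
have [sneg|spos] := boolP (has (fun e : R * R => e.2 < 0) s); last first.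
  move: neg; rewrite (negbTE spos) orbF => a0; apply: (stop a0).
  apply/allP => -[v b] vb; apply: addr_ge0; first exact: ltW (allP s0 _ vb).
  apply: mulr_ge0; first by rewrite ltW // divr_gt0 // oppr_gt0.
  by rewrite leNgt; apply: contra spos => b0; apply/hasP; exists (v, b).
have [t t0 /andP[tall thas]] := IH s0 sneg.
have [ut|ut] := leP 0 (u + t * a); first by exists t; rewrite // tall thas ut orbT.
have a0 : a < 0 by rewrite -(pmulr_rlt0 _ t0); lra.
apply: (stop a0); apply/allP => -[v b] vb /=.
have v0 : 0 < v := allP s0 _ vb; have vt : 0 <= v + t * b := allP tall _ vb.
have [b0|b0] := leP 0 b.
  by rewrite addr_ge0 ?(ltW v0) // mulr_ge0 // ltW // divr_gt0 // oppr_gt0.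
have le_t : u / - a <= t by rewrite ler_pdivrMr ?oppr_gt0 // mulrN; lra.
by apply: le_trans vt _; rewrite lerD2l ler_wnM2r // ltW.
Qed.

Lemma exit_triangle (u v w a b c : R) : 0 < u -> 0 < v -> 0 < w -> [|| a < 0, b < 0 | c < 0] ->
  exists2 t, 0 < t & [/\ 0 <= u + t * a, 0 <= v + t * b, 0 <= w + t * c &
     [\/ u + t * a = 0, v + t * b = 0 | w + t * c = 0]].
Proof.
move=> u0 v0 w0 neg; have [||t t0] := @first_zero [:: (u, a); (v, b); (w, c)].
- by rewrite /= u0 v0 w0.
- by rewrite /= orbF.
rewrite /= andbT orbF => /andP[/and3P[h1 h2 h3] /or3P[] /eqP h]; exists t => //; split=> //.
- exact: Or31.
- exact: Or32.
exact: Or33.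
Qed.
End PlaneLemmas.

(** * Faces of geodesic triangulations *)

Section GeodesicFaces.
Variables (R : realType) (kL kU k : nat) (L U : nat -> 'rV[R]_2).
Hypothesis chains : monotone_chains kL kU L U.
Let kU0 := upper_pos chains.
Let incrU := upper_incr chains.
Notation m := (kL + kU)%N.
Notation V := 'I_(k + (kL + kU)).
Notation plane := 'rV[R]_2.
Let phi : 'I_m -> plane := @mono_polygon R kL kU L U.
Notation bv := (@boundary_vertex m k).
Variable F : seq (V * V * V).
Hypothesis F_distinct : forall p q r, (p, q, r) \in F -> [/\ p != q, q != r & p != r].
Hypothesis F_boundary_nbr : forall (v : V) p q r, (v < k)%N -> is_face F p q r ->
  v \notin [set p; q; r]%SET ->
  exists j, bv j \notin [set p; q; r]%SET /\ [set v; bv j]%SET \in tri_edges F.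
Variable psi : 'rV[R]_(k + m) -> plane.
Hypothesis psi_geo : geodesic_triangulation phi (complex_of F) psi.
Let z (v : V) := psi (vertex_point R v).
Let region := mono_region kL kU L U.

Let t00 : 0 <= (0 : R) <= 1. Proof. by rewrite lexx ler01. Qed.
Let t11 : 0 <= (1 : R) <= 1. Proof. by rewrite ler01 lexx. Qed.

Lemma z_boundary j : z (bv j) = phi j. Proof. by case: psi_geo => _ _ /(_ j). Qed.

Lemma skel_inj w w' : skeleton1 (complex_of F) w -> skeleton1 (complex_of F) w' ->
  psi w = psi w' -> w = w'.
Proof. by case: psi_geo => -[[_ inj _] _ _] _ _ _ h h' e; apply: inj; rewrite ?inE. Qed.

Let edge (u v : V) := [set u; v]%SET \in tri_edges F.

Lemma edge_distinct u v : edge u v -> u != v.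
Proof. by move=> /card_tri_edge; rewrite cards2; case: eqP. Qed.

Lemma edgeC u v : edge u v = edge v u. Proof. by rewrite /edge finset.setUC. Qed.

Lemma edge_skel u v t : edge u v -> 0 <= t <= 1 ->
  skeleton1 (complex_of F) (segment_path (vertex_point R u) (vertex_point R v) t).
Proof. by move=> uv t01; right; exists [set u; v]%SET => //; exact: segment_in_edge. Qed.

Lemma psi_edge u v t : edge u v -> 0 <= t <= 1 ->
  psi (segment_path (vertex_point R u) (vertex_point R v) t) = segment_path (z u) (z v) t.
Proof. by case: psi_geo => _ _ _ h uv t01; exact: h. Qed.

Lemma edge_region u v t : edge u v -> 0 <= t <= 1 -> region (segment_path (z u) (z v) t).
Proof.
move=> uv t01; rewrite -psi_edge // /region -(mono_polygon_region chains).
by case: psi_geo => _ h _ _; apply: h; exists (segment_path (vertex_point R u) (vertex_point R v) t) => //; exact: edge_skel.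
Qed.

Lemma path_coord (u v x : V) (t : R) :
  segment_path (vertex_point R u) (vertex_point R v) t ord0 x =
  (1 - t) * (x == u)%:R + t * (x == v)%:R.
Proof. by rewrite /segment_path !mxE eqxx. Qed.

Lemma edges_disjoint u v u' v' s t : edge u v -> edge u' v' -> 0 <= s <= 1 -> 0 <= t <= 1 ->
  u' \notin [set u; v]%SET -> v' \notin [set u; v]%SET ->
  segment_path (z u) (z v) s <> segment_path (z u') (z v') t.
Proof.
move=> e e' s01 t01; rewrite !inE !negb_or => /andP[h1 h2] /andP[h3 h4].
rewrite -psi_edge // -psi_edge // => /(skel_inj (edge_skel e s01) (edge_skel e' t01)) eq.
have uv' := edge_distinct e'.
have := congr1 (fun w : 'rV[R]_(k + m) => w ord0 u' + w ord0 v') eq; rewrite /= !path_coord !eqxx.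
rewrite (negbTE h1) (negbTE h2) (negbTE h3) (negbTE h4) (negbTE uv') eq_sym (negbTE uv').
rewrite !mulr0 !mulr1 !addr0 add0r subrK => /eqP; by rewrite eq_sym oner_eq0.
Qed.

Lemma vertex_edge_disjoint v p q t : edge p q -> 0 <= t <= 1 -> v \notin [set p; q]%SET ->
  z v <> segment_path (z p) (z q) t.
Proof.
move=> e t01; rewrite !inE negb_or => /andP[h1 h2]; rewrite -psi_edge // /z => eq.
have sv : skeleton1 (complex_of F) (vertex_point R v).
  left; exists v => //; split=> [u||u].
  - by rewrite mxE eqxx /=; case: (u == v).
  - rewrite (bigD1 v) //= mxE !eqxx big1 ?addr0 // => u /negbTE uv.
    by rewrite mxE uv andbF.
  - by rewrite inE mxE => /negbTE ->; rewrite andbF.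
have := congr1 (fun w : 'rV[R]_(k + m) => w ord0 v) (skel_inj sv (edge_skel e t01) eq).
rewrite /= path_coord (negbTE h1) (negbTE h2) mxE !eqxx !mulr0 addr0 => /eqP.
by rewrite oner_eq0.
Qed.

Lemma face_edges3 p q r : is_face F p q r -> [/\ edge p q, edge q r & edge r p].
Proof.
move=> f; split; apply: (mem_tri_edges F_distinct); [exact: f | exact: is_face_rot f |].
exact: is_face_rot (is_face_rot f).
Qed.

Lemma z_inj u v : (exists w, edge v w) -> u != v -> z u != z v.
Proof.
move=> [w e] uv; have [uw|uw] := eqVneq u w.
  apply/eqP => eq; have sk (x : V) t : 0 <= t <= 1 -> edge v x -> skeleton1 (complex_of F)
      (segment_path (vertex_point R v) (vertex_point R x) t) by move=> *; exact: edge_skel.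
  have h : psi (segment_path (vertex_point R v) (vertex_point R w) 0) =
           psi (segment_path (vertex_point R v) (vertex_point R w) 1).
    rewrite (psi_edge e t00) (psi_edge e t11) /segment_path subr0 subrr !scale0r !scale1r addr0 add0r.
    by rewrite -uw eq.
  have := congr1 (fun y : 'rV[R]_(k + m) => y ord0 v)
     (skel_inj (sk _ _ t00 e) (sk _ _ t11 e) h).
  rewrite /= !path_coord eqxx; have /negbTE -> := edge_distinct e.
  by rewrite subr0 subrr !mulr0 !addr0 mulr1 mul0r => /eqP; rewrite oner_eq0.
apply/eqP => eq; apply: (vertex_edge_disjoint e t00 (v := u)).
  by rewrite !inE negb_or uv.
by rewrite eq /segment_path subr0 scale1r scale0r addr0.
Qed.

(** If the vertices were collinear, one of them would lie on the opposite edge. *)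
Lemma face_nondegenerate p q r : is_face F p q r -> orient (z p) (z q) (z r) != 0.
Proof.
move=> f; have [epq eqr erp] := face_edges3 f; have [pq qr pr] := is_face_distinct F_distinct f.
have zpq : z p != z q by apply: z_inj pq; exists r.
apply/eqP => /(collinear_path zpq)[t rE].
have [t0|t0] := ltP t 0.
  have s01 : 0 <= (1 - t)^-1 <= 1 by rewrite invr_ge0 invf_le1 ?lerBrDl; lra.
  apply: (vertex_edge_disjoint eqr s01 (v := p)).
    by rewrite !inE negb_or pq.
  by rewrite rE; apply: plane_eq; rewrite !(px_segment_path, py_segment_path); field; rewrite gt_eqF //; lra.
have [t1|t1] := leP t 1.
  have t01 : 0 <= t <= 1 by rewrite t0.
  apply: (vertex_edge_disjoint epq t01 _ rE).
  by rewrite !inE negb_or eq_sym pr eq_sym.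
have i1 : t^-1 <= 1 by rewrite invf_le1; lra.
have i0 : 0 <= t^-1 by rewrite invr_ge0.
have s01 : 0 <= 1 - t^-1 <= 1 by lra.
apply: (vertex_edge_disjoint erp s01 (v := q)).
  by rewrite !inE negb_or qr eq_sym.
by rewrite rE; apply: plane_eq; rewrite !(px_segment_path, py_segment_path); field; rewrite gt_eqF //; lra.
Qed.

Lemma on_side_false p q r v u w' : is_face F p q r -> v \notin [set p; q; r]%SET ->
  edge u w' -> u \in [set p; q; r]%SET -> w' \in [set p; q; r]%SET ->
  forall t, 0 <= t <= 1 -> z v <> segment_path (z u) (z w') t.
Proof.
move=> f vn e hu hw t t01; apply: vertex_edge_disjoint => //.
rewrite !inE negb_or.
by apply/andP; split; apply: contraNneq vn => ->.
Qed.

Let bary p q r (x : plane) (a b c : R) :=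
  a + b + c = 1 /\ x = a *: z p + b *: z q + c *: z r.

Lemma bary_exists p q r x : is_face F p q r -> exists a b c, bary p q r x a b c.
Proof.
move=> /face_nondegenerate D0; exists (orient (z q) (z r) x / orient (z p) (z q) (z r)),
  (orient (z r) (z p) x / orient (z p) (z q) (z r)), (orient (z p) (z q) x / orient (z p) (z q) (z r)).
by split; [exact: bary_sum | exact: bary_plane].
Qed.

Lemma bary_side p q r x a b c : is_face F p q r -> bary p q r x a b c ->
  0 <= a -> 0 <= b -> 0 <= c -> [\/ a = 0, b = 0 | c = 0] ->
  exists u v t, [/\ edge u v, u \in [set p; q; r]%SET, v \in [set p; q; r]%SET, 0 <= t <= 1 & x = segment_path (z u) (z v) t].
Proof.
move=> f [s ->] a0 b0 c0; have [e1 e2 e3] := face_edges3 f; case=> e; subst.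
- exists q, r, c; rewrite !inE !eqxx ?orbT; split=> //; first by apply/andP; split=> //; lra.
  by rewrite scale0r add0r /segment_path (_ : 1 - c = b) //; lra.
- exists r, p, a; rewrite !inE !eqxx ?orbT; split=> //; first by apply/andP; split=> //; lra.
  by rewrite scale0r addr0 addrC /segment_path (_ : 1 - a = c) //; lra.
exists p, q, b; rewrite !inE !eqxx ?orbT; split=> //; first by apply/andP; split=> //; lra.
by rewrite scale0r addr0 /segment_path (_ : 1 - b = a) //; lra.
Qed.

(** One can leave the triangle through a side, and sides lie in the region. *)
Lemma vertical_exit p q r x a b c (s : R) : is_face F p q r -> bary p q r x a b c ->
  0 < a -> 0 < b -> 0 < c -> s != 0 -> exists2 t, 0 < t & region (x + pt 0 (t * s)).
Proof.
move=> f [sm xE] a0 b0 c0 s0; have D0 := face_nondegenerate f.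
have [a' [b' [c' [sm' xE']]]] := bary_exists (x + pt 0 s) f.
have s0' : (a' - a) + (b' - b) + (c' - c) = 0 by lra.
have dE : pt 0 s = (a' - a) *: z p + (b' - b) *: z q + (c' - c) *: z r.
  have -> : pt 0 s = (x + pt 0 s) - x by rewrite addrC addKr.
  by rewrite xE' [X in _ - X]xE !scalerBl; apply: plane_eq; rewrite !pE; ring.
have neg : [|| a' - a < 0, b' - b < 0 | c' - c < 0].
  apply: contraT; rewrite !negb_or -!leNgt => /and3P[h1 h2 h3].
  have [e1 e2 e3] : [/\ a' - a = 0, b' - b = 0 & c' - c = 0] by split; lra.
  move: dE; rewrite e1 e2 e3 !scale0r !addr0 => /(congr1 (@py R)); rewrite py_pt /py mxE => e.
  by rewrite e eqxx in s0.
have [t t0 [h1 h2 h3 h]] := exit_triangle a0 b0 c0 neg; exists t => //.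
have bt : bary p q r (x + pt 0 (t * s)) (a + t * (a' - a)) (b + t * (b' - b)) (c + t * (c' - c)).
  split; first by have : t * (a' - a + (b' - b) + (c' - c)) = 0 by [rewrite s0' mulr0]; lra.
  have -> : pt 0 (t * s) = t *: pt 0 s by apply: plane_eq; rewrite !pE ?mulr0.
  by rewrite dE {1}xE; apply: plane_eq; rewrite !pE; ring.
have [u [v [t' [e _ _ t01 ->]]]] := bary_side f bt h1 h2 h3 h.
exact: edge_region.
Qed.

(** A point in an open face has points of the region above and below it, whereas
    a vertex of the polygon is on the lower or the upper boundary. *)
Lemma boundary_not_in_face p q r j a b c : is_face F p q r -> bv j \notin [set p; q; r]%SET ->
  bary p q r (z (bv j)) a b c -> 0 <= a -> 0 <= b -> 0 <= c -> False.
Proof.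
move=> f jn bj a0 b0 c0.
have side : [\/ a = 0, b = 0 | c = 0] -> False.
  move=> h; have [u [v [t [e hu hv t01]]]] := bary_side f bj a0 b0 c0 h.
  exact: (on_side_false f jn e hu hv t01).
have [a1|an] := eqVneq a 0; first by apply: side; exact: Or31.
have [b1|bn] := eqVneq b 0; first by apply: side; exact: Or32.
have [c1|cn] := eqVneq c 0; first by apply: side; exact: Or33.
have [ap bp cp] : [/\ 0 < a, 0 < b & 0 < c] by rewrite !lt0r an bn cn.
have [t t0 [_ /andP[_ h1]]] := vertical_exit f bj ap bp cp (oner_neq0 R).
have [t' t'0 [_ /andP[h2 _]]] := vertical_exit (s := -1) f bj ap bp cp ltac:(by rewrite oppr_eq0 oner_neq0).
have : polygon_curve phi (phi j).
  exists j => //; exists 0; first by rewrite /= in_itv /= lexx ler01.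
  by rewrite /segment_path subr0 scale1r scale0r addr0.
rewrite (mono_curve chains) -z_boundary => -[_ hc]; move: h1 h2.
rewrite !pE !addr0 mulr1 mulrN1 => h1 h2; case: hc => hc; lra.
Qed.

(** An interior vertex in a foreign face would be joined by an edge to a vertex of
    the polygon that is not in this face, and the edge would cross a side of the
    face. *)
Lemma vertex_not_in_face p q r v a b c : is_face F p q r -> v \notin [set p; q; r]%SET ->
  bary p q r (z v) a b c -> 0 <= a -> 0 <= b -> 0 <= c -> False.
Proof.
move=> f vn bj a0 b0 c0; have [vk|kv] := ltnP v k; last first.
  have vm : (v - k < m)%N by rewrite ltn_subLR.
  have vE : v = bv (Ordinal vm) by apply: val_inj; rewrite /= subnKC.
  by rewrite vE in vn bj; exact: (boundary_not_in_face f vn bj).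
have side : [\/ a = 0, b = 0 | c = 0] -> False.
  move=> h; have [u [v' [t [e hu hv t01]]]] := bary_side f bj a0 b0 c0 h.
  exact: (on_side_false f vn e hu hv t01).
have [a1|an] := eqVneq a 0; first by apply: side; exact: Or31.
have [b1|bn] := eqVneq b 0; first by apply: side; exact: Or32.
have [c1|cn] := eqVneq c 0; first by apply: side; exact: Or33.
have [ap bp cp] : [/\ 0 < a, 0 < b & 0 < c] by rewrite !lt0r an bn cn.
have [j [jn vj]] := F_boundary_nbr vk f vn.
have [a' [b' [c' bw]]] := bary_exists (z (bv j)) f.
have neg' : [|| a' < 0, b' < 0 | c' < 0].
  apply: contraT; rewrite !negb_or -!leNgt => /and3P[h1 h2 h3].
  by case: (boundary_not_in_face f jn bw h1 h2 h3).
have neg : [|| a' - a < 0, b' - b < 0 | c' - c < 0].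
  by move: neg' => /or3P[] h; apply/or3P; [apply: Or31|apply: Or32|apply: Or33]; lra.
have [t t0 [h1 h2 h3 h]] := exit_triangle ap bp cp neg.
have t1 : t <= 1.
  have inv : t^-1 > 0 by rewrite invr_gt0.
  have aux (u u' : R) : 0 < u -> 0 <= u + t * (u' - u) -> u' < 0 -> t <= 1.
    by move=> u0 hu u'0; rewrite leNgt; apply/negP => tt; nra.
  by move: neg' => /or3P[] hn; [apply: aux ap h1 hn | apply: aux bp h2 hn | apply: aux cp h3 hn].
have t01 : 0 <= t <= 1 by rewrite ltW.
have bt : bary p q r (segment_path (z v) (z (bv j)) t)
    (a + t * (a' - a)) (b + t * (b' - b)) (c + t * (c' - c)).
  case: bj => s xE; case: bw => s' xE'; split.
    have : t * (a' - a + (b' - b) + (c' - c)) = 0 by rewrite (_ : _ + _ = 0) ?mulr0 //; lra.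
    lra.
  by rewrite xE xE'; apply: plane_eq; rewrite !(px_segment_path, py_segment_path) !pE; ring.
have [u [w [t' [e hu hw t'01 eq]]]] := bary_side f bt h1 h2 h3 h.
have notin x : x \in [set p; q; r]%SET -> x \notin [set v; bv j]%SET.
  by move=> hx; rewrite !inE negb_or; apply/andP; split; apply: contraTneq hx => ->.
exact: (edges_disjoint vj e t01 t'01 (notin _ hu) (notin _ hw) eq).
Qed.

(** If r and s were on the same side of p q, one of them would be in the triangle
    of the other, or two edges would cross. *)
Lemma adjacent_positive p q r s : is_face F p q r -> is_face F q p s -> r != s ->
  0 < orient (z p) (z q) (z r) -> 0 < orient (z q) (z p) (z s).
Proof.
move=> f f' rs D0; have Dn : orient (z p) (z q) (z r) != 0 by rewrite gt_eqF.
have [pq qr pr] := is_face_distinct F_distinct f.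
have [_ ps qs] := is_face_distinct F_distinct f'.
have sn : s \notin [set p; q; r]%SET by rewrite !inE !negb_or eq_sym ps eq_sym qs eq_sym rs.
have rn : r \notin [set q; p; s]%SET by rewrite !inE !negb_or eq_sym qr eq_sym pr rs.
have bs : bary p q r (z s) (orient (z q) (z r) (z s) / orient (z p) (z q) (z r))
   (orient (z r) (z p) (z s) / orient (z p) (z q) (z r)) (orient (z p) (z q) (z s) / orient (z p) (z q) (z r)).
  by split; [exact: bary_sum | exact: bary_plane].
rewrite orientC oppr_gt0 ltNge; apply/negP => side.
have side' : 0 < orient (z p) (z q) (z s).
  by rewrite lt0r side andbT; have := face_nondegenerate f'; rewrite orientC oppr_eq0.
have c0 : 0 < orient (z p) (z q) (z s) / orient (z p) (z q) (z r) by exact: divr_gt0.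
move: bs c0; move: (_ / _) (_ / _) (_ / _) => c b a [sm sE] c0.
have [e1 e2 e3] := face_edges3 f; have [e1' e2' e3'] := face_edges3 f'.
have [a0|a0] := leP 0 a; have [b0|b0] := leP 0 b.
- by apply: (vertex_not_in_face f sn (conj sm sE)) => //; exact: ltW.
- have b1 : 0 < 1 - b by lra.
  have s01 : 0 <= - b / (1 - b) <= 1.
    by apply/andP; split; rewrite ?divr_ge0 ?ler_pdivrMr; lra.
  have t01 : 0 <= a / (1 - b) <= 1.
    by apply/andP; split; rewrite ?divr_ge0 ?ler_pdivrMr; lra.
  apply: (edges_disjoint e3' e3 s01 t01).
  + by rewrite !inE negb_or; apply/andP; split=> //; rewrite eq_sym.
  + by rewrite !inE negb_or; apply/andP; split=> //; rewrite eq_sym.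
  have cE : c = 1 - a - b by lra.
  by rewrite sE cE; apply: plane_eq; rewrite !(px_segment_path, py_segment_path) !pE; field; rewrite gt_eqF.
- have a1 : 0 < 1 - a by lra.
  have s01 : 0 <= - a / (1 - a) <= 1.
    by apply/andP; split; rewrite ?divr_ge0 ?ler_pdivrMr; lra.
  have t01 : 0 <= c / (1 - a) <= 1.
    by apply/andP; split; rewrite ?divr_ge0 ?ler_pdivrMr; lra.
  have e4 : edge s p by rewrite edgeC.
  apply: (edges_disjoint e4 e2 s01 t01).
  + by rewrite !inE negb_or; apply/andP; split=> //; rewrite eq_sym.
  + by rewrite !inE negb_or; apply/andP; split=> //; rewrite eq_sym.
  have cE : c = 1 - a - b by lra.
  by rewrite sE cE; apply: plane_eq; rewrite !(px_segment_path, py_segment_path) !pE; field; rewrite gt_eqF.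
have cn : c != 0 by rewrite gt_eqF.
apply: (@vertex_not_in_face q p s r (- b / c) (- a / c) (1 / c) f' rn).
- split; first by have -> : c = 1 - a - b; [lra | field; rewrite gt_eqF //; lra].
  by rewrite sE; apply: plane_eq; rewrite !pE; field.
- by rewrite divr_ge0 //; lra.
- by rewrite divr_ge0 //; lra.
- by rewrite divr_ge0 //; lra.
Qed.

(** At the leftmost vertex of the polygon the position of an edge relative to
    the first upper side is forced, which starts the propagation. *)
Lemma first_face_positive (a : V) (j j' : 'I_m) : is_face F (bv j) a (bv j') ->
  phi j = U 0%N -> phi j' = U 1%N -> 0 < orient (z (bv j)) (z a) (z (bv j')).
Proof.
move=> f jE j'E; have [e1 e2 e3] := face_edges3 f; rewrite lt0r face_nondegenerate //=.
have iU := incrU kU0.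
have rj : region (z (bv j)) by have := edge_region e1 t00; rewrite /segment_path subr0 scale1r scale0r addr0.
have ra : region (z a) by have := edge_region e1 t11; rewrite /segment_path subrr scale0r scale1r add0r.
have xa : px (U 0%N) <= px (z a) by case: ra => /andP[]; rewrite (chains_start chains).
pose w := px (U 1%N) - px (U 0%N); have w0 : 0 < w by rewrite subr_gt0.
pose t := w / (w + (px (z a) - px (U 0%N))).
have den : 0 < w + (px (z a) - px (U 0%N)) by lra.
have t0 : 0 < t by exact: divr_gt0.
have t01 : 0 <= t <= 1 by rewrite ltW //= ler_pdivrMr // mul1r; lra.
have [_ /andP[_]] := edge_region e1 t01.
rewrite z_boundary jE; set x := segment_path _ _ t.
have xx : px (U 0%N) <= px x <= px (U 1%N).
  rewrite px_segment_path; have tz : t * (px (z a) - px (U 0%N)) <= w.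
    rewrite /t mulrAC ler_pdivrMr // ler_pM2l //; lra.
  have : 0 <= t * (px (z a) - px (U 0%N)) by apply: mulr_ge0; [exact: ltW | lra].
  move: tz; rewrite /w; lra.
rewrite (polyfun_seg incrU kU0 (leqnn _) xx) => h.
have : orient (U 0%N) (U 1%N) x <= 0.
  by rewrite (orient_seg incrU _ kU0) pmulr_rle0 // subr_le0.
rewrite z_boundary j'E.
have -> : orient (U 0%N) (U 1%N) x = t * - orient (U 0%N) (z a) (U 1%N).
  by rewrite /x /orient px_segment_path py_segment_path; ring.
by rewrite pmulr_rle0 // oppr_le0.
Qed.
End GeodesicFaces.

(** * Combinatorics of the corridor *)

Section GadgetComplex.
Variables (n0 : nat) (N : nat) (low upp a b c : nat -> 'I_n0) (inner : pred 'I_n0).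
Notation V := 'I_n0.
Notation O i := (upp (i * 5).+1).
Notation pab i := (upp (i * 5).+2).
Notation roof1 i := (upp (i * 5).+3).
Notation roof2 i := (upp (i * 5).+4).
Notation pbc i := (upp (i * 5).+4.+1).
Notation pca i := (low (i * 2).+1).
Notation Q i := (low (i * 2).+2).

(** The triangle a b c faces three vertices pab, pbc, pca of the polygon, one for
    each side; roof1 and roof2 lie between pab and pbc on the upper chain.  The
    gadget is closed on the left by O and on the right by Q, by the next O and
    by the next a, where a N stands for the right end of the polygon.  All
    triples are meant to be counterclockwise. *)
Definition gadget (i : nat) : seq (V * V * V) :=
  [:: (a i, c i, b i); (a i, b i, pab i); (b i, c i, pbc i); (c i, a i, pca i);
      (O i, a i, pab i); (pab i, b i, roof1 i); (roof1 i, b i, roof2 i);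
      (roof2 i, b i, pbc i); (pbc i, c i, O i.+1); (pca i, Q i, c i);
      (c i, a i.+1, O i.+1); (Q i, a i.+1, c i); (low (i * 2), pca i, a i)].

Definition gadget_faces : seq (V * V * V) :=
  (low 0, a 0, O 0) :: flatten [seq gadget i | i <- iota 0 N].
Notation F := gadget_faces.

Lemma gadget_facesP t : t \in F -> t = (low 0, a 0, O 0) \/ exists2 i, (i < N)%N & t \in gadget i.
Proof.
rewrite inE => /orP[/eqP|/flatten_mapP[i]]; first by left.
by rewrite mem_iota => /andP[_ iN] ti; right; exists i.
Qed.

Lemma first_face : (low 0, a 0, O 0) \in F. Proof. exact: mem_head. Qed.

Lemma mem_gadget i t : (i < N)%N -> t \in gadget i -> t \in F.
Proof. by move=> iN ti; rewrite inE; apply/orP; right; apply/flatten_mapP; exists i; rewrite ?mem_iota. Qed.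

Lemma gadget_face i s (t := nth (low 0, low 0, low 0) (gadget i) s) :
  (i < N)%N -> (s < 13)%N -> is_face F t.1.1 t.1.2 t.2.
Proof.
by move=> iN s13; apply: mem_is_face; rewrite -!surjective_pairing; apply: (mem_gadget iN); exact: mem_nth.
Qed.

Ltac rotated_face f :=
  first [exact: f | exact: (is_face_rot f) | exact: (is_face_rot (is_face_rot f))].
Ltac in_gadget iN :=
  first [rotated_face (@gadget_face _ 0 iN isT) | rotated_face (@gadget_face _ 1 iN isT)
       | rotated_face (@gadget_face _ 2 iN isT) | rotated_face (@gadget_face _ 3 iN isT)
       | rotated_face (@gadget_face _ 4 iN isT) | rotated_face (@gadget_face _ 5 iN isT)
       | rotated_face (@gadget_face _ 6 iN isT) | rotated_face (@gadget_face _ 7 iN isT)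
       | rotated_face (@gadget_face _ 8 iN isT) | rotated_face (@gadget_face _ 9 iN isT)
       | rotated_face (@gadget_face _ 10 iN isT) | rotated_face (@gadget_face _ 11 iN isT)
       | rotated_face (@gadget_face _ 12 iN isT)].

Hypothesis N0 : (0 < N)%N.
Hypothesis start : low 0 = upp 0.
Hypothesis end_low : a N = low (N * 2).+1.
Hypothesis end_upp : a N = upp (N * 5).+2.

(** The sides of the polygon, directed counterclockwise. *)
Definition boundary_arc (u v : V) :=
  (exists2 j, (j < (N * 2).+1)%N & u = low j /\ v = low j.+1) \/
  (exists2 r, (r < (N * 5).+2)%N & u = upp r.+1 /\ v = upp r).


Lemma low_arc_face j : (j < (N * 2).+1)%N -> exists s, is_face F (low j) (low j.+1) s.
Proof.
rewrite (divn_eq j 2) => h; have : (j %% 2 < 2)%N by rewrite ltn_mod.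
move: (j %/ 2)%N (j %% 2)%N h => i e h e2; have [iN|Ni] := ltnP i N.
  by case: e e2 {h} => [|[|]] // _; rewrite ?addn0 ?addn1; eexists; in_gadget iN.
have [-> ->] : i = N.-1.+1 /\ e = 0%N by lia.
have iN : (N.-1 < N)%N by lia.
exists (c N.-1); move: (@gadget_face _ 11 iN isT) => /=.
by rewrite prednK // end_low addn0 -[in (N * 2).+1](prednK N0) -[in (N * 2)%N](prednK N0).
Qed.

Lemma upp_arc_face r : (r < (N * 5).+2)%N -> exists s, is_face F (upp r.+1) (upp r) s.
Proof.
case: r => [_|r].
  exists (a 0); rewrite -start; exact: (is_face_rot (is_face_rot (mem_is_face first_face))).
rewrite (divn_eq r 5) => h; have : (r %% 5 < 5)%N by rewrite ltn_mod.
move: (r %/ 5)%N (r %% 5)%N h => i e h e5; have [iN|Ni] := ltnP i N.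
  by case: e e5 {h} => [|[|[|[|[|]]]]] // _; rewrite ?addn0 ?addn1 ?addn2 ?addn3 ?addn4; eexists; in_gadget iN.
have [-> ->] : i = N.-1.+1 /\ e = 0%N by lia.
have iN : (N.-1 < N)%N by lia.
exists (c N.-1); move: (is_face_rot (@gadget_face _ 10 iN isT)) => /=.
by rewrite prednK // addn0 end_upp.
Qed.

Lemma boundary_arc_face u v : boundary_arc u v -> exists s, is_face F u v s.
Proof. by case=> -[x xN [-> ->]]; [exact: low_arc_face | exact: upp_arc_face]. Qed.


Let opposite u v := boundary_arc u v \/ exists s, is_face F v u s.

Lemma low_arc j : (j < (N * 2).+1)%N -> opposite (low j) (low j.+1).
Proof. by move=> h; left; left; exists j. Qed.
Lemma upp_arc r : (r < (N * 5).+2)%N -> opposite (upp r.+1) (upp r).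
Proof. by move=> h; left; right; exists r. Qed.

Lemma opposite_left_low i : (i < N)%N -> opposite (a i) (low (i * 2)).
Proof.
case: i => [|i] iN; right.
  by exists (O 0); rewrite mul0n; exact: (mem_is_face first_face).
by exists (c i); exact: (@gadget_face _ 11 (ltnW iN) isT).
Qed.

Lemma opposite_left_upp i : (i < N)%N -> opposite (O i) (a i).
Proof.
case: i => [|i] iN; right.
  by exists (low 0); exact: (is_face_rot (mem_is_face first_face)).
by exists (c i); exact: (is_face_rot (@gadget_face _ 10 (ltnW iN) isT)).
Qed.

Lemma opposite_right_low i : (i < N)%N -> opposite (Q i) (a i.+1).
Proof.
rewrite leq_eqVlt => /orP[/eqP iN|iN].
  by rewrite iN end_low -[low _]/(low (i.+1 * 2)) iN; exact: low_arc.
by right; exists (pca i.+1); exact: (is_face_rot (is_face_rot (@gadget_face _ 12 iN isT))).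
Qed.

Lemma opposite_right_upp i : (i < N)%N -> opposite (a i.+1) (O i.+1).
Proof.
rewrite leq_eqVlt => /orP[/eqP iN|iN].
  by rewrite iN end_upp; exact: upp_arc.
by right; exists (pab i.+1); exact: (@gadget_face _ 4 iN isT).
Qed.

Lemma gadget_faces_opposite p q r : is_face F p q r ->
  boundary_arc p q \/ exists s, is_face F q p s.
Proof.
suff all3 t : t \in F -> [/\ opposite t.1.1 t.1.2, opposite t.1.2 t.2 & opposite t.2 t.1.1].
  by case/or3P => /all3[].
case/gadget_facesP => [->|[i iN]] /=.
  split.
  - by right; exists (pca 0); have := is_face_rot (is_face_rot (@gadget_face 0 12 N0 isT)).
  - by right; exists (pab 0); exact: (@gadget_face _ 4 N0 isT).
  by rewrite start; exact: upp_arc.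
have i2 e : (e < 3)%N -> (i * 2 + e < (N * 2).+1)%N by lia.
have i5 e : (e < 7)%N -> (i * 5 + e < (N * 5).+2)%N by lia.
have := (i2 0%N isT, i2 1%N isT, (i5 1%N isT, i5 2%N isT, i5 3%N isT, i5 4%N isT, i5 5%N isT)).
rewrite !(addn0, addn1, addnS) => -[[h0 h1] [[[[g1 g2] g3] g4] g5]].
rewrite !inE.
repeat (case/orP; [move/eqP=> -> /=; split | ]); last (move/eqP=> -> /=; split);
  first [exact: opposite_left_low | exact: opposite_left_upp | exact: opposite_right_low
       | exact: opposite_right_upp | exact: low_arc | exact: upp_arc
       | by right; eexists; in_gadget iN].
Qed.

(** The sum over one gadget consists of the sides of the polygon in it and of two
    cuts, which join the lower to the upper chain through a; the cuts telescope. *)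
Lemma gadget_boundary_sum (T : comNzRingType) (f : V -> V -> T) :
  (forall u v, f v u = - f u v) ->
  \sum_(t <- F) (f t.1.1 t.1.2 + f t.1.2 t.2 + f t.2 t.1.1) =
  \sum_(j < (N * 2).+1) f (low j) (low j.+1) + \sum_(r < (N * 5).+2) f (upp r.+1) (upp r).
Proof.
move=> anti; rewrite big_cons big_flatten big_map /=.
pose cut i := f (low (i * 2)) (a i) + f (a i) (O i).
have step i : \sum_(t <- gadget i) (f t.1.1 t.1.2 + f t.1.2 t.2 + f t.2 t.1.1) =
   f (low (i * 2)) (pca i) + f (pca i) (Q i) + (f (pab i) (O i) + f (roof1 i) (pab i) +
   f (roof2 i) (roof1 i) + f (pbc i) (roof2 i) + f (O i.+1) (pbc i)) + cut i.+1 - cut i.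
  rewrite /gadget !big_cons big_nil /cut /=.
  rewrite (anti (a i) (c i)) (anti (b i) (c i)) (anti (a i) (b i)) (anti (pab i) (b i)).
  rewrite (anti (a i) (pab i)) (anti (pbc i) (c i)) (anti (b i) (pbc i)) (anti (pca i) (a i)).
  rewrite (anti (c i) (pca i)) (anti (b i) (roof1 i)) (anti (b i) (roof2 i)).
  rewrite (anti (c i) (O i.+1)) (anti (c i) (a i.+1)) (anti (c i) (Q i)).
  by rewrite (anti (O i) (a i)) (anti (low (i * 2)) (a i)); ring.
have total n : \sum_(i <- iota 0 n) \sum_(t <- gadget i) (f t.1.1 t.1.2 + f t.1.2 t.2 + f t.2 t.1.1) =
   \sum_(j < n * 2) f (low j) (low j.+1) + \sum_(r < n * 5) f (upp r.+2) (upp r.+1) + cut n - cut 0%N.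
  elim: n => [|n IH]; first by rewrite /= big_nil !big_ord0 !add0r subrr.
  rewrite -{1}addn1 iotaD big_cat /= big_seq1 IH step add0n.
  rewrite -[(n.+1 * 2)%N]/((n * 2).+2) -[in X in _ = _ + X + _ - _](_ : (n * 5).+4.+1 = (n.+1 * 5)%N) //.
  by rewrite !big_ord_recr /=; ring.
have -> : \sum_(r < (N * 5).+2) f (upp r.+1) (upp r) =
    f (upp 1) (upp 0) + \sum_(r < (N * 5).+1) f (upp r.+2) (upp r.+1) by rewrite big_ord_recl.
by rewrite total !big_ord_recr /cut !mul0n start /= -end_low -end_upp; ring.
Qed.

(** The faces form a strip: each is reached from the first one across shared
    edges, gadget by gadget. *)
Lemma gadget_faces_connected (P : V -> V -> V -> Prop) :
  (forall p q r, P p q r -> P q r p) ->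
  (forall p q r s, is_face F p q r -> is_face F q p s -> P p q r -> P q p s) ->
  P (low 0) (a 0) (O 0) -> forall p q r, (p, q, r) \in F -> P p q r.
Proof.
move=> turn adj P0.
have all_gadget i t : (i < N)%N -> P (O i) (a i) (pab i) -> t \in gadget i -> P t.1.1 t.1.2 t.2.
  move=> iN P4.
  have cross p q r s : P p q r -> is_face F p q r -> is_face F q p s -> P q p s.
    by move=> h f f'; exact: adj _ _ _ _ f f' h.
  have P1 : P (a i) (b i) (pab i) by apply: (turn _ _ _ (cross _ _ _ _ (turn _ _ _ P4) _ _)); in_gadget iN.
  have P0' : P (b i) (a i) (c i) by apply: (cross _ _ _ _ P1 _ _); in_gadget iN.
  have P2 : P (b i) (c i) (pbc i) by apply: (cross _ _ _ _ (turn _ _ _ (turn _ _ _ P0')) _ _); in_gadget iN.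
  have P3 : P (c i) (a i) (pca i) by apply: (cross _ _ _ _ (turn _ _ _ P0') _ _); in_gadget iN.
  have P5 : P (pab i) (b i) (roof1 i) by apply: (cross _ _ _ _ (turn _ _ _ P1) _ _); in_gadget iN.
  have P6 : P (roof1 i) (b i) (roof2 i) by apply: (cross _ _ _ _ (turn _ _ _ P5) _ _); in_gadget iN.
  have P7 : P (roof2 i) (b i) (pbc i) by apply: (cross _ _ _ _ (turn _ _ _ P6) _ _); in_gadget iN.
  have P8 : P (pbc i) (c i) (O i.+1) by apply: (cross _ _ _ _ (turn _ _ _ P2) _ _); in_gadget iN.
  have P9 : P (c i) (pca i) (Q i) by apply: (cross _ _ _ _ (turn _ _ _ (turn _ _ _ P3)) _ _); in_gadget iN.
  have P10 : P (O i.+1) (c i) (a i.+1) by apply: (cross _ _ _ _ (turn _ _ _ P8) _ _); in_gadget iN.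
  have P11 : P (a i.+1) (c i) (Q i) by apply: (cross _ _ _ _ (turn _ _ _ P10) _ _); in_gadget iN.
  have P12 : P (pca i) (a i) (low (i * 2)) by apply: (cross _ _ _ _ (turn _ _ _ P3) _ _); in_gadget iN.
  rewrite !inE; repeat (case/orP; [move/eqP=> -> /= | ]); last (move/eqP=> -> /=);
    first [by [] | exact: (turn _ _ _) | exact: (turn _ _ _ (turn _ _ _ _))].
have entry i : (i < N)%N -> P (O i) (a i) (pab i).
  elim: i => [|i IH] iN.
    apply: (adj _ _ (low 0) _); [exact: (is_face_rot (mem_is_face first_face)) | in_gadget iN | exact: (turn _ _ _)].
  have iN' := ltnW iN; apply: (adj _ _ (c i) _); [in_gadget iN' | in_gadget iN | apply: (turn _ _ _)].
  by apply: (all_gadget i (c i, a i.+1, O i.+1) iN' (IH iN')); rewrite !inE eqxx ?orbT.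
move=> p q r /gadget_facesP[[-> -> ->] //|[i iN]].
exact: (all_gadget i (p, q, r) iN (entry i iN)).
Qed.

Hypothesis inner_a : forall i, (i < N)%N -> inner (a i).
Hypothesis inner_b : forall i, (i < N)%N -> inner (b i).
Hypothesis inner_c : forall i, (i < N)%N -> inner (c i).

Lemma face_meets_interior p q r : is_face F p q r -> [|| inner p, inner q | inner r].
Proof.
suff all1 t : t \in F -> [|| inner t.1.1, inner t.1.2 | inner t.2].
  by case/or3P => /all1 /or3P[] /= ->; rewrite ?orbT.
case/gadget_facesP => [->|[i iN]] /=; first by rewrite inner_a ?orbT.
by rewrite !inE; repeat (case/orP; [move/eqP=> -> /=; rewrite ?(inner_a iN) ?(inner_b iN) ?(inner_c iN) ?orbT // |]);
  move/eqP => -> /=; rewrite (inner_a iN) ?orbT.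
Qed.

Hypothesis outer_uniq : forall i, (i < N)%N ->
  uniq [:: pab i; O i; roof1 i; roof2 i; pbc i; pca i; Q i].
Hypothesis outer_upp : forall r, (r <= (N * 5).+2)%N -> ~~ inner (upp r).
Hypothesis outer_low : forall j, (j <= (N * 2).+1)%N -> ~~ inner (low j).
Hypothesis F_distinct : forall p q r, (p, q, r) \in F -> [/\ p != q, q != r & p != r].

Let linked v x := ~~ inner x /\ [set v; x]%SET \in tri_edges F.

Lemma boundary_neighbors i v : (i < N)%N -> v \in [:: a i; b i; c i] ->
  exists2 s : seq V, uniq s /\ size s = 3%N & forall x, x \in s -> linked v x.
Proof.
move=> iN vi.
have link x y : is_face F v x y -> ~~ inner x -> linked v x.
  by move=> f ?; split=> //; exact: mem_tri_edges F_distinct _ _ _ f.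
have link' x y : is_face F x v y -> ~~ inner x -> linked v x.
  by move=> f ?; split=> //; rewrite finset.setUC; exact: mem_tri_edges F_distinct _ _ _ f.
have up e : (e < 6)%N -> ~~ inner (upp (i * 5 + e)) by move=> ?; apply: outer_upp; lia.
have dn e : (e < 3)%N -> ~~ inner (low (i * 2 + e)) by move=> ?; apply: outer_low; lia.
move: (up 1%N isT) (up 2%N isT) (up 3%N isT) (up 4%N isT) (up 5%N isT) (dn 1%N isT) (dn 2%N isT).
rewrite !(addn0, addn1, addnS) => u1 u2 u3 u4 u5 d1 d2.
have all3 (x y w : V) : uniq [:: x; y; w] -> linked v x -> linked v y -> linked v w ->
    exists2 s : seq V, uniq s /\ size s = 3%N & forall x, x \in s -> linked v x.
  by move=> us hx hy hw; exists [:: x; y; w] => // t; rewrite !inE => /or3P[] /eqP ->.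
move: vi; rewrite !inE => /or3P[] /eqP vE; rewrite {v}vE in link link' all3 *.
- apply: (all3 (pab i) (O i) (pca i)).
  + exact: (mask_uniq (outer_uniq iN) [:: true; true; false; false; false; true; false]).
  + by apply: (link' _ (b i)) => //; in_gadget iN.
  + by apply: (link' _ (pab i)) => //; in_gadget iN.
  + by apply: (link _ (c i)) => //; in_gadget iN.
- apply: (all3 (pab i) (roof1 i) (roof2 i)).
  + exact: (mask_uniq (outer_uniq iN) [:: true; false; true; true; false; false; false]).
  + by apply: (link _ (a i)) => //; in_gadget iN.
  + by apply: (link' _ (roof2 i)) => //; in_gadget iN.
  + by apply: (link _ (roof1 i)) => //; in_gadget iN.
apply: (all3 (pbc i) (pca i) (Q i)).
+ exact: (mask_uniq (outer_uniq iN) [:: false; false; false; false; true; true; true]).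
+ by apply: (link _ (b i)) => //; in_gadget iN.
+ by apply: (link _ (Q i)) => //; in_gadget iN.
by apply: (link' _ (pca i)) => //; in_gadget iN.
Qed.

(** An interior vertex has three neighbors on the boundary, but a face has at most
    two vertices there. *)
Lemma avoiding_boundary_neighbor i v p q r : (i < N)%N -> v \in [:: a i; b i; c i] ->
  is_face F p q r ->
  exists x, [/\ ~~ inner x, x \notin [set p; q; r]%SET & [set v; x]%SET \in tri_edges F].
Proof.
move=> iN vi f; have [s [us s3] link] := boundary_neighbors iN vi.
apply: contrapT => no; have sub : {subset s <= [:: p; q; r]}.
  move=> x xs; have [ix vx] := link x xs; apply: contraT => xn; case: no; exists x; split=> //.
  by move: xn; rewrite !inE -orbA.
have [_ eq_s] := uniq_min_size us sub ltac:(by rewrite s3).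
have outer x : x \in [:: p; q; r] -> ~~ inner x by rewrite -eq_s => /link[].
by have := face_meets_interior f; rewrite !(negbTE (outer _ _)) // !inE eqxx ?orbT.
Qed.
End GadgetComplex.

(** * The polygon around the corridor *)

Section Affine.
Variables (R : realType) (P : nat -> 'rV[R]_2) (k : nat).
Hypothesis incr : forall j, (j < k)%N -> px (P j) < px (P j.+1).

(** Used to locate broken lines with respect to straight lines. *)
Lemma polyfun_affine j X : (j < k)%N -> px (P j) <= X < px (P j.+1) ->
  exists w, [/\ 0 <= w < 1, px (P j) < X -> 0 < w & forall u v t : R,
    u * X + v * polyfun P k X + t =
    (1 - w) * (u * px (P j) + v * py (P j) + t) + w * (u * px (P j.+1) + v * py (P j.+1) + t)].
Proof.
move=> jk /andP[h1 h2]; have d0 : 0 < px (P j.+1) - px (P j) by rewrite subr_gt0 incr.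
exists ((X - px (P j)) / (px (P j.+1) - px (P j))); split.
- by apply/andP; split; [apply: divr_ge0; [rewrite subr_ge0 | exact: ltW] | rewrite ltr_pdivrMr // mul1r ltrD2r].
- by move=> h; rewrite divr_gt0 // subr_gt0.
move=> u v t; rewrite (polyfun_seg incr jk (leqnn _)) ?h1 ?ltW // /slope_of.
by field; rewrite gt_eqF.
Qed.
End Affine.

Section Corridor.
Variables (R : realType) (N : nat).

Definition place (i : nat) (x y : R) : 'rV[R]_2 := pt (x + 24 * i%:R) (y - 6 * i%:R).

Lemma px_place i x y : px (place i x y) = x + 24 * i%:R. Proof. exact: px_pt. Qed.
Lemma py_place i x y : py (place i x y) = y - 6 * i%:R. Proof. exact: py_pt. Qed.
Lemma place_succ i x y : place i.+1 x y = place i (x + 24) (y - 6).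
Proof. by apply: plane_eq; rewrite !(px_place, py_place) -natr1; ring. Qed.

(** In each gadget the vertices are pca at (4, -4) and Q at (8, -10); the latter
    is (-16, -4) in the coordinates of the next gadget. *)
Definition lower_chain (j : nat) : 'rV[R]_2 :=
  if j is 0 then place 0 (-10) 0 else
  if ~~ odd j then place (j %/ 2) (-16) (-4) else
  if (j %/ 2 == N)%N then place N (-3) 0 else place (j %/ 2) 4 (-4).

(** In each gadget the vertices are O, pab, roof1, roof2 and pbc. *)
Definition upper_chain (r : nat) : 'rV[R]_2 :=
  if r is r.+1 then
    if ((r %/ 5 == N) && (r %% 5 == 1))%N then place N (-3) 0 else
    nth (place 0 0 0) [:: place (r %/ 5) (-9) 0; place (r %/ 5) (-6) 12; place (r %/ 5) (-5) 14;
      place (r %/ 5) (-4) 10; place (r %/ 5) 3 (-2)] (r %% 5)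
  else place 0 (-10) 0.

Lemma lower_evenS i : lower_chain (i * 2).+2 = place i 8 (-10).
Proof.
rewrite /lower_chain; have -> : odd (i * 2).+2 = false by lia.
have -> : ((i * 2).+2 %/ 2 = i.+1)%N by lia.
by rewrite /= place_succ; apply: plane_eq; rewrite !(px_place, py_place); ring.
Qed.

Lemma lower_odd i : (i < N)%N -> lower_chain (i * 2).+1 = place i 4 (-4).
Proof.
move=> iN; rewrite /lower_chain; have -> : odd (i * 2).+1 = true by lia.
have -> : ((i * 2).+1 %/ 2 = i)%N by lia.
by rewrite /= ltn_eqF.
Qed.

Lemma lower_last : lower_chain (N * 2).+1 = place N (-3) 0.
Proof.
rewrite /lower_chain; have -> : odd (N * 2).+1 = true by lia.
have -> : ((N * 2).+1 %/ 2 = N)%N by lia.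
by rewrite eqxx.
Qed.

Lemma upper_gadget i : (i < N)%N ->
  [/\ upper_chain (i * 5).+2 = place i (-6) 12, upper_chain (i * 5).+3 = place i (-5) 14,
      upper_chain (i * 5).+4 = place i (-4) 10 & upper_chain (i * 5).+4.+1 = place i 3 (-2)].
Proof.
move=> iN; have at_e e : (e < 5)%N -> upper_chain (i * 5 + e).+1 =
    nth (place 0 0 0) [:: place i (-9) 0; place i (-6) 12; place i (-5) 14;
      place i (-4) 10; place i 3 (-2)] e.
  move=> e5; rewrite /upper_chain; have -> : ((i * 5 + e) %/ 5 = i)%N by lia.
  have -> : ((i * 5 + e) %% 5 = e)%N by lia.
  by rewrite ltn_eqF.
by move: (at_e 1%N isT) (at_e 2%N isT) (at_e 3%N isT) (at_e 4%N isT); rewrite addn1 addn2 addn3 addn4.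
Qed.

Lemma upper_O i : upper_chain (i * 5).+1 = place i (-9) 0.
Proof.
rewrite /upper_chain; have -> : (i * 5 %/ 5 = i)%N by lia.
have -> : (i * 5 %% 5 = 0)%N by lia.
by rewrite andbF.
Qed.

Lemma upper_last : upper_chain (N * 5).+2 = place N (-3) 0.
Proof.
rewrite /upper_chain; have -> : ((N * 5).+1 %/ 5 = N)%N by lia.
have -> : ((N * 5).+1 %% 5 = 1)%N by lia.
by rewrite eqxx.
Qed.

Lemma lower_chain_incr j : (j < (N * 2).+1)%N -> px (lower_chain j) < px (lower_chain j.+1).
Proof.
rewrite (divn_eq j 2) => h; have : (j %% 2 < 2)%N by rewrite ltn_mod.
move: (j %/ 2)%N (j %% 2)%N h => i [|[|]] // h _; rewrite ?addn0 ?addn1 in h *; last first.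
  by rewrite lower_odd ?lower_evenS ?px_place ?ltrD2r //; [lra | lia].
have e : px (lower_chain (i * 2)) <= -10 + 24 * i%:R.
  case: i {h} => [|i]; first by rewrite px_place.
  by rewrite lower_evenS px_place -natr1; lra.
have [iN|Ni] := ltnP i N; first by rewrite lower_odd // px_place; lra.
have iE : i = N by lia.
by move: e; rewrite iE lower_last px_place; lra.
Qed.

Lemma upper_chain_incr r : (r < (N * 5).+2)%N -> px (upper_chain r) < px (upper_chain r.+1).
Proof.
case: r => [_|r]; first by rewrite (upper_O 0) !px_place; lra.
rewrite (divn_eq r 5) => h; have : (r %% 5 < 5)%N by rewrite ltn_mod.
move: (r %/ 5)%N (r %% 5)%N h => i e h e5; have [iN|Ni] := ltnP i N; last first.
  have [-> ->] : i = N /\ e = 0%N by lia.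
  by rewrite addn0 upper_O upper_last !px_place; lra.
have [u2 u3 u4 u5] := upper_gadget iN.
case: e e5 {h} => [|[|[|[|[|]]]]] // _; rewrite ?addn0 ?addn1 ?addn2 ?addn3 ?addn4.
- by rewrite upper_O u2 !px_place; lra.
- by rewrite u2 u3 !px_place; lra.
- by rewrite u3 u4 !px_place; lra.
- by rewrite u4 u5 !px_place; lra.
by rewrite u5 -[(i * 5).+4.+2]/((i.+1 * 5).+1) upper_O !px_place -natr1; lra.
Qed.


(** The line y = - x / 4 - 5 / 2 separates the chains up to the last lower
    side; that one is below the horizontal line through its right end.  The
    factor 1 of y makes polyfun_affine applicable. *)
Let slant (x y : R) := 4^-1 * x + 1 * y + 5 / 2.

Lemma slant_place i x y : slant (px (place i x y)) (py (place i x y)) = slant x y.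
Proof. by rewrite px_place py_place /slant; field. Qed.

Lemma lower_slant j : (j < (N * 2).+1)%N -> slant (px (lower_chain j)) (py (lower_chain j)) <= 0.
Proof.
case: j => [_|j]; first by rewrite slant_place /slant; lra.
rewrite ltnS (divn_eq j 2) => h; have : (j %% 2 < 2)%N by rewrite ltn_mod.
move: (j %/ 2)%N (j %% 2)%N h => i [|[|]] // h _; rewrite ?addn0 ?addn1 in h *.
  by rewrite lower_odd ?slant_place /slant; [lra | lia].
by rewrite lower_evenS slant_place /slant; lra.
Qed.

Lemma upper_slant r : (r < (N * 5).+2)%N ->
  0 < slant (px (upper_chain r.+1)) (py (upper_chain r.+1)).
Proof.
rewrite (divn_eq r 5) => h; have : (r %% 5 < 5)%N by rewrite ltn_mod.
move: (r %/ 5)%N (r %% 5)%N h => i e h e5; have [iN|Ni] := ltnP i N; last first.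
  have iE : i = N by lia.
  have [->|->] : e = 0%N \/ e = 1%N by lia.
    by rewrite iE addn0 upper_O slant_place /slant; lra.
  by rewrite iE addn1 upper_last slant_place /slant; lra.
have [u2 u3 u4 u5] := upper_gadget iN.
case: e e5 {h} => [|[|[|[|[|]]]]] // _; rewrite ?addn0 ?addn1 ?addn2 ?addn3 ?addn4.
- by rewrite upper_O slant_place /slant; lra.
- by rewrite u2 slant_place /slant; lra.
- by rewrite u3 slant_place /slant; lra.
- by rewrite u4 slant_place /slant; lra.
by rewrite u5 slant_place /slant; lra.
Qed.

Hypothesis N0 : (0 < N)%N.

Lemma lower_lt_upper X : px (lower_chain 0) < X < px (lower_chain (N * 2).+1) ->
  polyfun lower_chain (N * 2).+1 X < polyfun upper_chain (N * 5).+2 X.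
Proof.
move=> /andP[X0 X1].
have [j jN jX] := find_seg (leqnn _) (introT andP (conj (ltW X0) X1)).
have X1' : px (upper_chain 0) <= X < px (upper_chain (N * 5).+2).
  by rewrite upper_last -lower_last (ltW X0).
have [r rN rX] := find_seg (leqnn _) X1'.
have [w [/andP[w0 w1] wp lowE]] := polyfun_affine lower_chain_incr jN jX.
have [w' [/andP[w'0 w'1] w'p uppE]] := polyfun_affine upper_chain_incr rN rX.
have v0 : 0 < 1 - w by lra.
have v'0 : 0 < 1 - w' by lra.
have [jN'|jN'] := ltnP j (N * 2).
  have l1 := lower_slant jN; have l2 := @lower_slant j.+1 ltac:(by []).
  have lo : slant X (polyfun lower_chain (N * 2).+1 X) <= 0.
    rewrite /slant lowE -/(slant _ _) -/(slant _ _).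
    by have := mulr_ge0_le0 (ltW v0) l1; have := mulr_ge0_le0 w0 l2; lra.
  have up : 0 < slant X (polyfun upper_chain (N * 5).+2 X).
    rewrite /slant uppE -/(slant _ _) -/(slant _ _).
    have u2 := upper_slant rN; case: r rN rX w'p {uppE} u2 => [|r] rN rX w'p u2.
      have -> : slant (px (upper_chain 0)) (py (upper_chain 0)) = 0.
        by rewrite slant_place /slant; field.
      by rewrite mulr0 add0r mulr_gt0 // w'p.
    by have := mulr_gt0 v'0 (upper_slant (ltnW rN)); have := mulr_ge0 w'0 (ltW u2); lra.
  by move: lo up; rewrite /slant; lra.
have jE : j = (N * 2)%N by apply/eqP; rewrite eqn_leq jN' -ltnS jN.
have M1 : (N.-1 < N)%N by rewrite ltn_predL.
have NE : N = N.-1.+1 by rewrite prednK.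
have [_ _ _ u5] := upper_gadget M1.
have e5 : (N.-1 * 5).+4.+1 = (N * 5)%N by rewrite -[LHS]/(N.-1.+1 * 5)%N prednK.
have r5 : (N * 5 <= r)%N.
  rewrite leqNgt; apply/negP => rlt; move: rX jX => /andP[_ rX] /andP[jX _].
  have : px (upper_chain r.+1) <= px (upper_chain (N.-1 * 5).+4.+1).
    by rewrite e5; apply: (px_le upper_chain_incr) => //; exact: leq_trans (leqnSn _) (leqnSn _).
  have : px (lower_chain j) = -16 + 24 * N%:R.
    by rewrite jE {1}NE lower_evenS px_place {2}NE -natr1; ring.
  rewrite u5 px_place; have : N%:R = N.-1%:R + 1 :> R by rewrite natr1 prednK.
  by move: jX rX => /=; lra.
have n1 : N%:R = N.-1%:R + 1 :> R by rewrite natr1 prednK.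
have lowY : polyfun lower_chain (N * 2).+1 X + 6 * N%:R < 0.
  have -> : polyfun lower_chain (N * 2).+1 X + 6 * N%:R = (1 - w) * -4.
    have := lowE 0 1 (6 * N%:R); rewrite mul0r add0r mul1r => ->.
    rewrite jE lower_last {1 2}NE lower_evenS !py_place n1; ring.
  by rewrite pmulr_rlt0 //; lra.
have nonneg t : (t = 0 \/ t = 1 \/ t = 2)%N -> 0 <= py (upper_chain (N * 5 + t)) + 6 * N%:R.
  case=> [|[]] ->.
  - by rewrite addn0 {1}NE -[upper_chain _]/(upper_chain (N.-1 * 5).+4.+1) u5 py_place n1; lra.
  - by rewrite addn1 upper_O py_place; lra.
  by rewrite addn2 upper_last py_place; lra.
have rE : r = (N * 5)%N \/ r = (N * 5).+1.
  move: r5; rewrite leq_eqVlt => /orP[/eqP <-|h]; [by left | right].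
  by apply/eqP; rewrite eqn_leq h andbT -ltnS.
have upY : 0 <= polyfun upper_chain (N * 5).+2 X + 6 * N%:R.
  have := uppE 0 1 (6 * N%:R); rewrite !mul0r !add0r !mul1r => ->.
  have [h1 h2] : 0 <= py (upper_chain r) + 6 * N%:R /\ 0 <= py (upper_chain r.+1) + 6 * N%:R.
    case: rE => ->; split.
    - by move: (nonneg 0%N); rewrite addn0; apply; left.
    - by move: (nonneg 1%N); rewrite addn1; apply; right; left.
    - by move: (nonneg 1%N); rewrite addn1; apply; right; left.
    by move: (nonneg 2%N); rewrite addn2; apply; right; right.
  by rewrite addr_ge0 // mulr_ge0 // ltW.
by move: lowY upY; lra.
Qed.

Theorem corridor_chains : monotone_chains (N * 2).+1 (N * 5).+2 lower_chain upper_chain.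
Proof.
split=> //; first lia.
- exact: lower_chain_incr.
- exact: upper_chain_incr.
- by rewrite lower_last upper_last.
exact: lower_lt_upper.
Qed.

End Corridor.

(** * Geodesic triangulations of the corridor *)

Section CorridorComplex.
Variables (R : realType) (N : nat).
Hypothesis N0 : (0 < N)%N.
Notation k := (N * 3)%N.
Notation kL := (N * 2).+1.
Notation kU := (N * 5).+2.
Notation m := (kL + kU)%N.
Notation V := 'I_(k + (kL + kU)).
Notation plane := 'rV[R]_2.
Notation bv := (@boundary_vertex m k).

Fact some_vertex_subproof : (0 < k + (kL + kU))%N. Proof. by rewrite addn_gt0 orbT. Qed.
Definition vertex (x : nat) : V := insubd (Ordinal some_vertex_subproof) x.

Lemma val_vertex x : (x < k + m)%N -> vertex x = x :> nat.
Proof. by move=> xM; rewrite /vertex val_insubd xM. Qed.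

(** The boundary vertices follow the interior ones in the order of mono_polygon:
    lower chain from the left, upper chain from the right. *)
Definition low j := vertex (k + j).
Definition upp r := if r is 0 then vertex k else vertex (k + (m - r)).
Arguments upp : simpl never.
Definition vtx_a i := if (i == N)%N then low kL else vertex (i * 3).
Definition vtx_b i := vertex (i * 3).+1.
Definition vtx_c i := vertex (i * 3).+2.
Definition corridor : seq (V * V * V) := gadget_faces N low upp vtx_a vtx_b vtx_c.
Notation F := corridor.

Lemma val_low j : (j <= kL)%N -> low j = (k + j)%N :> nat.
Proof. by move=> ?; apply: val_vertex; lia. Qed.
Lemma val_upp r : (0 < r)%N -> (r <= kU)%N -> upp r = (k + (m - r))%N :> nat.
Proof. by case: r => // r _ ?; apply: val_vertex; lia. Qed.
Lemma val_a i : (i < N)%N -> vtx_a i = (i * 3)%N :> nat.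
Proof. by move=> iN; rewrite /vtx_a ltn_eqF //; apply: val_vertex; lia. Qed.
Lemma val_b i : (i < N)%N -> vtx_b i = (i * 3).+1 :> nat.
Proof. by move=> iN; apply: val_vertex; lia. Qed.
Lemma val_c i : (i < N)%N -> vtx_c i = (i * 3).+2 :> nat.
Proof. by move=> iN; apply: val_vertex; lia. Qed.

Lemma low0 : low 0 = upp 0. Proof. by rewrite /low addn0. Qed.
Lemma a_low : vtx_a N = low kL. Proof. by rewrite /vtx_a eqxx. Qed.
Lemma a_upp : vtx_a N = upp kU.
Proof. by rewrite a_low; apply: ord_inj; rewrite val_low // val_upp //; lia. Qed.

Definition inner (v : V) := (v < k)%N.
Lemma inner_a i : (i < N)%N -> inner (vtx_a i). Proof. by move=> iN; rewrite /inner val_a //; lia. Qed.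
Lemma inner_b i : (i < N)%N -> inner (vtx_b i). Proof. by move=> iN; rewrite /inner val_b //; lia. Qed.
Lemma inner_c i : (i < N)%N -> inner (vtx_c i). Proof. by move=> iN; rewrite /inner val_c //; lia. Qed.
Lemma outer_low j : (j <= kL)%N -> ~~ inner (low j).
Proof. by move=> jk; rewrite /inner val_low // -leqNgt leq_addr. Qed.
Lemma outer_upp r : (r <= kU)%N -> ~~ inner (upp r).
Proof.
case: r => [_|r rk]; first by rewrite -low0 outer_low.
by rewrite /inner val_upp // -leqNgt leq_addr.
Qed.

Lemma inner_cases v : inner v -> exists2 i, (i < N)%N & v \in [:: vtx_a i; vtx_b i; vtx_c i].
Proof.
rewrite /inner => vk; have iN : (v %/ 3 < N)%N by rewrite ltn_divLR.
exists (v %/ 3)%N => //; rewrite !inE -!val_eqE /= val_a // val_b // val_c //.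
by move: (nat_of_ord v); lia.
Qed.

Lemma bv_low (j : 'I_m) : (j <= kL)%N -> bv j = low j.
Proof. by move=> jk; apply: ord_inj; rewrite val_low. Qed.

Lemma bv_upp (j : 'I_m) r : (0 < r)%N -> (r <= kU)%N -> (j + r = m)%N -> bv j = upp r.
Proof. by move=> r0 rk jr; apply: ord_inj; rewrite val_upp //=; lia. Qed.

Lemma arc_boundary (j : 'I_m) : boundary_arc N low upp (bv j) (bv (ordS j)).
Proof.
have jm := ltn_ord j; have [jk|kj] := ltnP j kL.
  left; exists j => //; split; first by rewrite bv_low // ltnW.
  have jS : ordS j = j.+1 :> nat by rewrite /= modn_small //; lia.
  by rewrite bv_low jS.
right; exists (m - j.+1)%N; first by lia.
split; first by apply: bv_upp; lia.
have [jS|jS] := ltnP j.+1 m.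
  by apply: bv_upp; rewrite /= ?modn_small //; lia.
have jE : j.+1 = m by lia.
by rewrite bv_low /= jE modnn ?subnn ?low0.
Qed.

Lemma boundary_arcP u v : boundary_arc N low upp u v ->
  exists j : 'I_m, u = bv j /\ v = bv (ordS j).
Proof.
case=> -[x xN [-> ->]].
  have xm : (x < m)%N by lia.
  exists (Ordinal xm); rewrite !bv_low /= ?modn_small //; lia.
have xm : (m - x.+1 < m)%N by lia.
exists (Ordinal xm); split; first by symmetry; apply: bv_upp => /=; lia.
case: x xN xm => [|x] xN xm.
  by rewrite bv_low /= subn1 prednK // modnn ?low0.
by symmetry; apply: bv_upp => //=; rewrite ?modn_small; lia.
Qed.

Lemma outer_uniq i : (i < N)%N -> uniq [:: upp (i * 5).+2; upp (i * 5).+1; upp (i * 5).+3;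
   upp (i * 5).+4; upp (i * 5).+4.+1; low (i * 2).+1; low (i * 2).+2].
Proof.
move=> iN; rewrite -(map_inj_uniq val_inj) /= !val_upp ?val_low //; try lia.
rewrite !inE; lia.
Qed.

Lemma corridor_sum (T : comNzRingType) (f : V -> V -> T) : (forall u v, f v u = - f u v) ->
  \sum_(t <- F) (f t.1.1 t.1.2 + f t.1.2 t.2 + f t.2 t.1.1) = \sum_j f (bv j) (bv (ordS j)).
Proof.
move=> anti; rewrite (gadget_boundary_sum vtx_b vtx_c low0 a_low a_upp anti) [RHS]big_split_ord /=; congr (_ + _).
  apply: eq_bigr => j _; have jk := ltn_ord j.
  by rewrite !bv_low //= ?modn_small //; lia.
rewrite [RHS](reindex_inj rev_ord_inj); apply: eq_bigr => r _; have rk := ltn_ord r.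
congr f; first by symmetry; apply: bv_upp => //=; lia.
have jE : (kL + (kU - r.+1)).+1 = (m - r)%N by lia.
apply: ord_inj; have [r0|r0] := posnP r.
  by rewrite r0 -low0 val_low // -[RHS]/(k + (kL + (kU - r.+1)).+1 %% m)%N jE r0 subn0 modnn.
by rewrite val_upp ?(ltnW rk) // -[RHS]/(k + (kL + (kU - r.+1)).+1 %% m)%N jE modn_small //; lia.
Qed.

Lemma corridor_vertex v : exists q r, is_face F v q r.
Proof.
have [vk|kv] := boolP (inner v).
  have [i iN] := inner_cases vk; rewrite !inE => /or3P[] /eqP ->.
  - by exists (vtx_c i), (vtx_b i); exact: (@gadget_face _ N low upp vtx_a vtx_b vtx_c i 0 iN isT).
  - by exists (vtx_a i), (vtx_c i); exact: (is_face_rot (is_face_rot (@gadget_face _ N low upp vtx_a vtx_b vtx_c i 0 iN isT))).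
  by exists (vtx_b i), (vtx_a i); exact: (is_face_rot (@gadget_face _ N low upp vtx_a vtx_b vtx_c i 0 iN isT)).
have vm : (v - k < m)%N by rewrite ltn_subLR // leqNgt.
have -> : v = bv (Ordinal vm) by apply: ord_inj; rewrite /= subnKC // leqNgt.
have [s f] := boundary_arc_face vtx_b vtx_c N0 low0 a_low a_upp (arc_boundary (Ordinal vm)).
by exists (bv (ordS (Ordinal vm))), s.
Qed.


Lemma corridor_opposite p q r : is_face F p q r ->
  (exists j, p = bv j /\ q = bv (ordS j)) \/ exists s, is_face F q p s.
Proof.
case/(gadget_faces_opposite N0 low0 a_low a_upp) => [/boundary_arcP|]; first by left.
by right.
Qed.

Lemma corridor_boundary_face j : exists s, is_face F (bv j) (bv (ordS j)) s.
Proof. exact: (boundary_arc_face vtx_b vtx_c N0 low0 a_low a_upp (arc_boundary j)). Qed.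

Definition corridor_polygon : 'I_m -> plane := @mono_polygon R kL kU (lower_chain R N) (upper_chain R N).
Notation phi := corridor_polygon.
Let chains : monotone_chains kL kU (lower_chain R N) (upper_chain R N) := corridor_chains R N0.

Definition position (x : 'M[R]_(k, 2)) (v : V) : plane :=
  match fintype.split v with inl i => row i x | inr j => phi j end.

Lemma position_bv x j : position x (bv j) = phi j.
Proof. by rewrite /position -[bv j]/(unsplit (inr j)) unsplitK. Qed.

Lemma position_interior x i : position x (interior_vertex m i) = row i x.
Proof. by rewrite /position -[interior_vertex m i]/(unsplit (inl i)) unsplitK. Qed.

Lemma position_low x j : (j <= kL)%N -> position x (low j) = lower_chain R N j.
Proof.
move=> jk; have jm : (j < m)%N by lia.
by rewrite -(bv_low (j := Ordinal jm)) // position_bv /phi /mono_polygon /= jk.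
Qed.

Lemma position_upp x r : (r <= kU)%N -> position x (upp r) = upper_chain R N r.
Proof.
move=> rk; have [r0|r0] := posnP r; first by rewrite r0 -low0 position_low.
have jm : (m - r < m)%N by lia.
rewrite -(bv_upp (j := Ordinal jm)) //= ?subnK //; try lia.
rewrite position_bv /phi /mono_polygon /=.
have [jk|jk] := leqP (m - r) kL; last by congr upper_chain; lia.
have -> : r = kU by lia.
by rewrite addnK (chains_end chains).
Qed.

Lemma position_inner x (v : V) : inner v -> exists i : 'I_k, v = interior_vertex m i /\ position x v = row i x.
Proof.
move=> vk; exists (Ordinal vk).
have vE : v = interior_vertex m (Ordinal vk) by apply: val_inj.
by split; rewrite ?{1}vE ?position_interior.
Qed.

Definition all_positive (x : 'M[R]_(k, 2)) : Prop := forall p q r, (p, q, r) \in F ->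
  0 < orient (position x p) (position x q) (position x r).

(** One positive choice of positions settles combinatorial questions as well: the
    vertices of a face are distinct, and a face is not listed in both
    orientations. *)
Section Reference.
Variable x1 : 'M[R]_(k, 2).
Hypothesis x1_pos : all_positive x1.

Lemma corridor_triangulation : is_triangulation phi (complex_of F).
Proof.
apply: (geometric_is_triangulation chains (z := position x1)).
- exact: position_bv.
- exact: x1_pos.
- exact: corridor_vertex.
- exact: corridor_opposite.
- exact: corridor_boundary_face.
exact: corridor_sum.
Qed.

Lemma positive_geodesic x : all_positive x -> geodesic_space phi (complex_of F) x.
Proof.
move=> xp; exists (pl_map (position x)); last by move=> i; rewrite pl_map_vertex position_interior.
apply: (pl_map_geodesic chains).
- exact: position_bv.
- exact: xp.
- exact: corridor_vertex.
- exact: corridor_opposite.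
exact: corridor_sum.
Qed.

Lemma corridor_distinct p q r : (p, q, r) \in F -> [/\ p != q, q != r & p != r].
Proof. by move=> /x1_pos; exact: tri_distinct. Qed.

Lemma corridor_oriented p q r : is_face F p q r -> 0 < orient (position x1 p) (position x1 q) (position x1 r).
Proof. by case/or3P => /x1_pos //; rewrite orient_rot // orient_rot. Qed.

(** The orientation spreads from the leftmost face. *)
Lemma geodesic_positive x : geodesic_space phi (complex_of F) x -> all_positive x.
Proof.
move=> [psi geo rows].
have zE v : psi (vertex_point R v) = position x v.
  have [vk|kv] := boolP (inner v).
    by have [i [-> ->]] := position_inner x vk; rewrite rows.
  have vm : (v - k < m)%N by rewrite ltn_subLR // leqNgt.
  have -> : v = bv (Ordinal vm) by apply: ord_inj; rewrite /= subnKC // leqNgt.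
  by rewrite position_bv; case: geo => _ _ ->.
have nbr (v : V) p q r : (v < k)%N -> is_face F p q r -> v \notin [set p; q; r]%SET ->
    exists j, bv j \notin [set p; q; r]%SET /\ [set v; bv j]%SET \in tri_edges F.
  move=> vk f _; have [i iN vi] := inner_cases vk.
  have [u [u0 un e]] := avoiding_boundary_neighbor N0 inner_a inner_b inner_c outer_uniq outer_upp outer_low corridor_distinct iN vi f.
  have um : (u - k < m)%N by rewrite ltn_subLR // leqNgt.
  have uE : u = bv (Ordinal um) by apply: ord_inj; rewrite /= subnKC // leqNgt.
  by exists (Ordinal um); rewrite -uE.
move=> p q r pF; rewrite -!zE; move: p q r pF.
apply: (gadget_faces_connected (P := fun p q r => 0 < orient (psi (vertex_point R p)) (psi (vertex_point R q)) (psi (vertex_point R r)))).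
- by move=> p q r h; rewrite orient_rot.
- move=> p q r s f f'; apply: (adjacent_positive chains corridor_distinct nbr geo f f').
  apply/eqP => rs; have := corridor_oriented f; have := corridor_oriented f'.
  by rewrite rs orientC oppr_gt0 => /lt_trans h /h; rewrite ltxx.
have j0 : (0 < m)%N by lia.
have j1 : (m - 1 < m)%N by lia.
have low0E : low 0 = bv (Ordinal j0) by rewrite bv_low.
have upp1E : upp 1 = bv (Ordinal j1) by symmetry; apply: bv_upp => //=; lia.
rewrite mul0n upp1E low0E; apply: (first_face_positive chains corridor_distinct geo).
- by rewrite -low0E -upp1E; apply: mem_is_face; exact: first_face.
- exact: (chains_start chains).
have -> : mono_polygon (lower_chain R N) (upper_chain R N) (Ordinal j1) = phi (Ordinal j1) by [].
by rewrite -(position_bv x1) -upp1E position_upp.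
Qed.

End Reference.
End CorridorComplex.

(** * The tilts cannot all vanish *)

Section Coordinates.
Variables (R : realType) (N : nat).

Lemma orient_place i (x y x' y' x'' y'' : R) :
  orient (place i x y) (place i x' y') (place i x'' y'') =
  (x' - x) * (y'' - y) - (y' - y) * (x'' - x).
Proof. by rewrite /orient !(px_place, py_place); ring. Qed.

Definition local_x i (p : 'rV[R]_2) : R := px p - 24 * i%:R.
Definition local_y i (p : 'rV[R]_2) : R := py p + 6 * i%:R.

Lemma place_local i p : p = place i (local_x i p) (local_y i p).
Proof. by apply: plane_eq; rewrite !(px_place, py_place) /local_x /local_y; ring. Qed.

Lemma local_placeE i (x y : R) : local_x i (place i x y) = x /\ local_y i (place i x y) = y.
Proof. by rewrite /local_x /local_y px_place py_place; split; ring. Qed.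
End Coordinates.

Section LocalGadget.
Variable R : realType.

Definition local_orient (t : (R * R) * (R * R) * (R * R)) : R :=
  (t.1.2.1 - t.1.1.1) * (t.2.2 - t.1.1.2) - (t.1.2.2 - t.1.1.2) * (t.2.1 - t.1.1.1).

(** The faces of a gadget in its own coordinates, where l is the vertex of the
    lower chain before pca and a' the vertex a of the next gadget. *)
Definition local_gadget (l a b c a' : R * R) : seq ((R * R) * (R * R) * (R * R)) :=
  [:: (a, c, b); (a, b, (-6, 12)); (b, c, (3, -2)); (c, a, (4, -4));
      ((-9, 0), a, (-6, 12)); ((-6, 12), b, (-5, 14)); ((-5, 14), b, (-4, 10));
      ((-4, 10), b, (3, -2)); ((3, -2), c, (15, -6)); ((4, -4), (8, -10), c);
      (c, a', (15, -6)); ((8, -10), a', c); (l, (4, -4), a)].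
End LocalGadget.

Section Deadlock.
Variable R : realType.
Implicit Types s bx bh cx cy : R.

(** Both a and pab = (-6, 12) are on the line 2 x + y = 0, so that the first face
    tells on which side of this line b is; the second one does the same for the
    line through roof1 and roof2. *)
Lemma deadlock_b s bx bh : 0 < s ->
  0 < (bx - s) * (12 - - (2 * s)) - (bh - - (2 * s)) * (-6 - s) ->
  0 < (bx - -5) * (10 - 14) - (bh - 14) * (-4 - -5) ->
  0 < 2 * bx + bh /\ 4 * bx + bh + 6 < 0.
Proof.
move=> s0 h1 h2; split; last by lra.
have : 0 < (6 + s) * (2 * bx + bh) by apply: lt_le_trans h1 _; rewrite le_eqVlt; apply/orP; left; apply/eqP; ring.
by rewrite pmulr_rgt0 //; lra.
Qed.

(** If c were at height -6 - w with w >= 0, the face (b, c, pbc) would force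
    c to the left of 6 + 3 w / 4, and then the face (c, a, pca) would be
    negative. *)
Lemma deadlock_c s bx bh cx cy : 0 < s -> s < 2 -> 0 < 2 * bx + bh -> 4 * bx + bh + 6 < 0 ->
  0 < (cx - bx) * (-2 - bh) - (cy - bh) * (3 - bx) ->
  0 < (s - cx) * (-4 - cy) - (- (2 * s) - cy) * (4 - cx) -> -6 < cy.
Proof.
move=> s0 s2 hb1 hb2 f3 f4; rewrite ltNge; apply/negP => cy6.
pose w := - 6 - cy; pose p := - 3 - bx; pose q := bh - 6.
have w0 : 0 <= w by rewrite /w; lra.
have q2 : 2 * p < q by rewrite /p /q; lra.
have q4 : q < 4 * p by rewrite /p /q; lra.
have p0 : 0 < p by lra.
have cxlt : cx < 6 + 3 / 4 * w.
  have q8 : 0 < 8 + q by lra.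
  rewrite -(ltr_pM2r q8) -subr_gt0.
  have wp : 0 <= w * (3 / 4 * q - p) by apply: mulr_ge0 => //; lra.
  have -> : (6 + 3 / 4 * w) * (8 + q) - cx * (8 + q) =
    ((cx - bx) * (-2 - bh) - (cy - bh) * (3 - bx)) + (3 * q - 4 * p + w * (3 / 4 * q - p)).
    by rewrite /w /p /q; field.
  lra.
have : 0 <= (4 - 2 * s) * (6 + 3 / 4 * w - cx) by apply: mulr_ge0; lra.
have sw : 0 <= s * w by apply: mulr_ge0 => //; exact: ltW.
have f4E : (s - cx) * (-4 - cy) - (- (2 * s) - cy) * (4 - cx) +
  (4 - 2 * s) * (6 + 3 / 4 * w - cx) = - w - 2 * s - s * w / 2 by rewrite /w; field.
lra.
Qed.

(** The face (pbc, c, (15, -6)) puts c to the left of (15, -6), and c is above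
    this point, so that in a counterclockwise face (c, a', (15, -6)) the vertex a'
    is below this point or to the left of it. *)
Lemma deadlock_next cx cy x' y' : -6 < cy ->
  0 < (cx - 3) * (-6 - -2) - (cy - -2) * (15 - 3) ->
  0 < (x' - cx) * (-6 - cy) - (y' - cy) * (15 - cx) ->
  y' < -6 \/ x' < 15.
Proof.
move=> c6 f9 f11; have [|y6] := ltP y' (-6); [by left | right].
have c15 : 0 < 15 - cx by lra.
have h : 0 <= (y' + 6) * (15 - cx) by apply: mulr_ge0; lra.
have : 0 < (cy + 6) * (15 - x').
  have -> : (cy + 6) * (15 - x') = (x' - cx) * (-6 - cy) - (y' - cy) * (15 - cx) + (y' + 6) * (15 - cx) by ring.
  lra.
by rewrite pmulr_rgt0; lra.
Qed.
End Deadlock.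

Section Nonvanishing.
Variables (R : realType) (N : nat).
Hypothesis N0 : (0 < N)%N.
Notation plane := 'rV[R]_2.

Definition tilt (x : 'M[R]_(N * 3, 2)) : 'rV[R]_N :=
  \row_(i < N) (2 * local_x i (position x (vtx_a N i)) + local_y i (position x (vtx_a N i))).

Variable x : 'M[R]_(N * 3, 2).
Let A i : plane := position x (vtx_a N i).
Let B i : plane := position x (vtx_b N i).
Let C i : plane := position x (vtx_c N i).

Lemma position_end : A N = place N (-3) 0.
Proof. by rewrite /A a_low (position_low N0) // lower_last. Qed.

Lemma position_start i : (i < N)%N ->
  position x (low N (i * 2)) = if i is 0 then place 0 (-10) 0 else place i (-16) (-4).
Proof.
move=> iN; rewrite (position_low N0); last by lia.
case: i iN => [|i] iN //; rewrite -[(i.+1 * 2)%N]/(i * 2).+2 lower_evenS place_succ.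
by apply: plane_eq; rewrite !(px_place, py_place); ring.
Qed.

Lemma position_outer i : (i < N)%N ->
  [/\ position x (upp N (i * 5).+1) = place i (-9) 0,
      [/\ position x (upp N (i * 5).+2) = place i (-6) 12,
          position x (upp N (i * 5).+3) = place i (-5) 14,
          position x (upp N (i * 5).+4) = place i (-4) 10 &
          position x (upp N (i * 5).+4.+1) = place i 3 (-2)],
      position x (upp N (i.+1 * 5).+1) = place i 15 (-6),
      position x (low N (i * 2).+1) = place i 4 (-4) &
      position x (low N (i * 2).+2) = place i 8 (-10)].
Proof.
move=> iN; have [u2 u3 u4 u5] := upper_gadget R iN.
rewrite !(position_upp N0); try lia.
rewrite !(position_low N0); try lia.
rewrite !upper_O u2 u3 u4 u5 (lower_odd R iN) lower_evenS place_succ; split=> //.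
by apply: plane_eq; rewrite !(px_place, py_place); ring.
Qed.

Definition start_x i : R := if i is 0 then -10 else -16.
Definition start_y i : R := if i is 0 then 0 else -4.

Notation orient_at t := (orient (position x t.1.1) (position x t.1.2) (position x t.2)).

Lemma gadget_local i (a b c a' : R * R) : (i < N)%N ->
  A i = place i a.1 a.2 -> B i = place i b.1 b.2 -> C i = place i c.1 c.2 ->
  A i.+1 = place i a'.1 a'.2 ->
  all (fun t => 0 < orient_at t) (gadget (low N) (upp N) (vtx_a N) (vtx_b N) (vtx_c N) i) =
  all (fun t => 0 < local_orient t) (local_gadget (start_x i, start_y i) a b c a').
Proof.
move=> iN aE bE cE a'E.
have [e0 [e1 e2 e3 e4] e5 e6 e7] := position_outer iN.
have lE : position x (low N (i * 2)) = place i (start_x i) (start_y i).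
  by rewrite position_start //; case: i {iN aE bE cE a'E e0 e1 e2 e3 e4 e5 e6 e7}.
by rewrite /= -/(A i) -/(B i) -/(C i) -/(A i.+1) aE bE cE a'E e0 e1 e2 e3 e4 e5 e6 e7 lE !orient_place.
Qed.

Lemma all_positiveP : all_positive x <->
  0 < orient (position x (low N 0)) (A 0) (position x (upp N 1)) /\
  forall i, (i < N)%N ->
   all (fun t => 0 < orient_at t) (gadget (low N) (upp N) (vtx_a N) (vtx_b N) (vtx_c N) i).
Proof.
split=> [h|[h0 h] p q r].
  split; first by apply: h; exact: first_face.
  by move=> i iN; apply/allP => -[[p q] r] t; apply: h; exact: mem_gadget iN t.
case/gadget_facesP => [[-> -> ->] //|[i iN t]].
exact: (allP (h i iN) _ t).
Qed.

(** By induction all vertices a are below the origins of their gadgets: in the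
    alternative of deadlock_next, the face ((15, -6), a', pab') decides for the
    lower side.  At the right end the vertex that plays a' satisfies neither. *)
Lemma tilt_neq0 : all_positive x -> tilt x != 0.
Proof.
move=> /all_positiveP[h0 h]; apply/eqP => t0.
pose loc i (p : plane) := (local_x i p, local_y i p).
have pl i (p : plane) : p = place i (loc i p).1 (loc i p).2 := place_local i p.
have tilt0 i : (i < N)%N -> local_y i (A i) = - (2 * local_x i (A i)).
  move=> iN; have := congr1 (fun v : 'rV[R]_N => v ord0 (Ordinal iN)) t0.
  by rewrite !mxE /= -/(A i); lra.
have low_a i : (i < N)%N -> local_y i (A i) < 0 -> local_y i (A i.+1) < -6 \/ local_x i (A i.+1) < 15.
  move=> iN ay; have := h i iN.
  rewrite (gadget_local iN (pl i _) (pl i _) (pl i _) (pl i _)).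
  rewrite /= /local_orient /= tilt0 //; move: ay; rewrite tilt0 //.
  set s := local_x i (A i); set bx := local_x i (B i); set bh := local_y i (B i).
  set cx := local_x i (C i); set cy := local_y i (C i) => ay.
  move=> /and5P[_ f2 f3 f4 /and5P[_ _ f7 _ /and5P[f9 _ f11 _ /andP[f13 _]]]].
  have s0 : 0 < s by lra.
  have s2 : s < 2 by move: f13; rewrite /start_x /start_y; case: (i) => [|?]; lra.
  have [b1 b2] := deadlock_b s0 f2 f7.
  exact: deadlock_next (deadlock_c s0 s2 b1 b2 f3 f4) f9 f11.
have neg i : (i < N)%N -> local_y i (A i) < 0.
  elim: i => [|i IH] iN.
    move: h0; rewrite {1}(place_local 0 (A 0)) (position_low N0) // (position_upp N0) // (upper_O R N 0).
    by rewrite /lower_chain orient_place; lra.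
  have iN' := ltnW iN; have := low_a i iN' (IH iN'); have := h i.+1 iN.
  rewrite (gadget_local iN (pl _ _) (pl _ _) (pl _ _) (pl _ _)).
  rewrite /= /local_orient /= => /and5P[_ _ _ _ /andP[f5 _]].
  move: f5; rewrite /loc /= /local_x /local_y -(natr1 i) => f5 [] ?; lra.
have iN : (N.-1 < N)%N by rewrite ltn_predL.
have := low_a _ iN (neg _ iN); rewrite prednK // position_end.
have := @natr1 R N.-1; rewrite prednK // /local_x /local_y px_place py_place; lra.
Qed.
End Nonvanishing.

(** * A gadget with small tilt *)

Section FamilyGadget.
Variable R : realType.

Lemma mul_bounds (a b x y : R) : - a <= x <= a -> - b <= y <= b -> - (a * b) <= x * y <= a * b.
Proof.
move=> xa yb; rewrite -ler_norml normrM; apply: ler_pM => //; by rewrite ler_norml.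
Qed.

(** The parameter t prescribes the tilt, P - Q is the height of a, and g the depth
    of c below -6.  The positions are tuned so that in the three critical faces,
    (a, b, pab), (b, c, pbc) and (c, a, pca), the terms that are linear in t cancel
    and only positive multiples of t^2, P, Q and eta remain. *)
Variables t P Q eta : R.
Let s := P - Q.
Let g := (P + t * t) / 2 - 2 * (Q + eta).

Definition family_a : R * R := (2 * t + t * t - s / 2 - s * t / 6, s).
Definition family_b : R * R := (- 3 - t - eta / 6, 6 + 4 * t + eta / 2).
Definition family_c : R * R := (6 - t + 3 / 4 * g - g * t / 4 - eta / 6, - 6 - g).

Hypothesis t_bound : - (1 / 10) <= t <= 1 / 10.
Hypothesis P_bound : 0 <= P <= 1 / 100.
Hypothesis Q_bound : 0 < Q <= 1 / 100.
Hypothesis eta_bound : 0 < eta <= 1 / 100.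

Let tt_bound : 0 <= t * t <= 1 / 100.
Proof. by apply/andP; split; [rewrite -expr2; exact: sqr_ge0 | have := mul_bounds t_bound t_bound; lra]. Qed.
Let s_bound : - (1 / 100) <= s <= 1 / 100. Proof. by move: P_bound Q_bound; rewrite /s; lra. Qed.
Let g_bound : - (1 / 20) <= g <= 1 / 20. Proof. by move: tt_bound P_bound Q_bound eta_bound; rewrite /g; lra. Qed.
Let st_bound := mul_bounds s_bound t_bound.
Let gt_bound := mul_bounds g_bound t_bound.

Lemma family_tilt : 2 * family_a.1 + family_a.2 = t * (4 + 2 * t - s / 3).
Proof. by rewrite /family_a /=; field. Qed.

Lemma family_gadget (l a' : R * R) : 0 < local_orient (l, (4, -4), family_a) ->
  0 < local_orient (family_c, a', (15, -6)) -> 0 < local_orient ((8, -10), a', family_c) ->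
  all (fun f => 0 < local_orient f) (local_gadget l family_a family_b family_c a').
Proof.
move=> h13 h11 h12.
have [ax cx] : - (1 / 4) <= family_a.1 <= 1 / 4 /\ 58 / 10 <= family_c.1 <= 62 / 10.
  by move: tt_bound st_bound gt_bound t_bound s_bound g_bound eta_bound; rewrite /family_a /family_c /=; lra.
have as_ : family_a.2 = s by [].
have cg : family_c.2 = - 6 - g by [].
have bx : - (32 / 10) <= family_b.1 <= - (28 / 10) by move: t_bound eta_bound; rewrite /family_b /=; lra.
have bh : 55 / 10 <= family_b.2 <= 65 / 10 by move: t_bound eta_bound; rewrite /family_b /=; lra.
have sx := mul_bounds s_bound ax.
have f1 : 0 < local_orient (family_a, family_c, family_b).
  have h1 : 5 * 5 <= (family_c.1 - family_a.1) * (family_b.2 - s).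
    by apply: ler_pM; move: s_bound; lra.
  have h2 : (6 + g + s) * (family_a.1 - family_b.1) <= 65 / 10 * (35 / 10).
    by apply: ler_pM; move: s_bound g_bound; lra.
  rewrite /local_orient as_ cg /=.
  have -> : (family_c.1 - family_a.1) * (family_b.2 - s) - (- 6 - g - s) * (family_b.1 - family_a.1) =
    (family_c.1 - family_a.1) * (family_b.2 - s) - (6 + g + s) * (family_a.1 - family_b.1) by ring.
  lra.
have f2 : 0 < local_orient (family_a, family_b, (-6, 12)).
  have -> : local_orient (family_a, family_b, (-6, 12)) =
    t * t * (2 + 4 * t - 2 / 3 * s) + eta * ((6 + 3 * family_a.1 + s) / 6).
    by rewrite /local_orient /family_a /family_b /=; field.
  rewrite ltr_wpDl //.
    by apply: mulr_ge0; [case/andP: tt_bound | move: t_bound s_bound; lra].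
  by apply: mulr_gt0; [case/andP: eta_bound | move: s_bound; lra].
have f3 : 0 < local_orient (family_b, family_c, (3, -2)).
  have -> : local_orient (family_b, family_c, (3, -2)) =
    t * t * (4 + g) + eta * ((3 + 7 * t + 3 / 4 * (g * t) + eta / 2 - 5 / 4 * g) / 6).
    by rewrite /local_orient /family_b /family_c /=; field.
  rewrite ltr_wpDl //.
    by apply: mulr_ge0; [case/andP: tt_bound | move: g_bound; lra].
  by apply: mulr_gt0; [case/andP: eta_bound | move: t_bound g_bound gt_bound eta_bound; lra].
have f4 : 0 < local_orient (family_c, family_a, (4, -4)).
  pose K := g * (1 / 4 - 5 / 12 * t).
  have K_bound : - (1 / 20) <= K <= 1 / 20.
    by move: g_bound gt_bound; rewrite /K; lra.
  have -> : local_orient (family_c, family_a, (4, -4)) =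
    P * (1 / 2 - 5 / 6 * t + K) + Q * (1 - 2 / 3 * t - K) + eta * (2 - 2 * t - (4 + s) / 6)
    + t * t * (3 / 2 + t / 2 + g).
    by rewrite /local_orient /family_a /family_c /K /g /s /=; field.
  rewrite ltr_wpDr //.
    by apply: mulr_ge0; [case/andP: tt_bound | move: t_bound g_bound; lra].
  rewrite ltr_wpDl //.
    apply: addr_ge0; apply: mulr_ge0; try by [case/andP: P_bound | case/andP: Q_bound => /ltW].
      by move: t_bound; lra.
    by move: t_bound; lra.
  by apply: mulr_gt0; [case/andP: eta_bound | move: t_bound s_bound; lra].
have f5 : 0 < local_orient ((-9, 0), family_a, (-6, 12)).
  by move: s_bound ax; rewrite /local_orient /family_a /=; lra.
have f6 : 0 < local_orient ((-6, 12), family_b, (-5, 14)).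
  by rewrite /local_orient /family_b /=; move: t_bound eta_bound; lra.
have f7 : 0 < local_orient ((-5, 14), family_b, (-4, 10)).
  by rewrite /local_orient /family_b /=; move: eta_bound; lra.
have f8 : 0 < local_orient ((-4, 10), family_b, (3, -2)).
  by rewrite /local_orient /family_b /=; move: t_bound eta_bound; lra.
have f9 : 0 < local_orient ((3, -2), family_c, (15, -6)).
  by move: g_bound cx; rewrite /local_orient /family_c /=; lra.
have f10 : 0 < local_orient ((4, -4), (8, -10), family_c).
  by move: g_bound cx; rewrite /local_orient /family_c /=; lra.
by rewrite /= f1 f2 f3 f4 f5 f6 f7 f8 f9 f10 h11 h12 h13.
Qed.

End FamilyGadget.

(** * The family of geodesic triangulations *)

Section Family.
Variables (R : realType) (N : nat).

(** A safety margin that is small with respect to the accumulated losses, of the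
    order of 4^-N for the gain and 4^N for the debt of the budget. *)
Definition eta : R := (4^-1 ^+ N) ^+ 2 / 2000.

Section OnePoint.
Variable y : 'rV[R]_N.

Definition theta (i : nat) : R := if insub i is Some j then y ord0 (j : 'I_N) / 10 else 0.

(** The first component P collects the gains theta^2, a fourth of which is passed
    on by each gadget; the second one Q is the debt caused by the safety margin,
    which grows by a factor 4 in each gadget. *)
Fixpoint budget (i : nat) : R * R := if i is j.+1 then
  (((budget j).1 + theta j * theta j) / 4, 4 * ((budget j).2 + eta)) else (0, eta).
Notation P i := (budget i).1.
Notation Q i := (budget i).2.

Definition family_point (n : nat) : 'rV[R]_2 :=
  let i := (n %/ 3)%N in
  let p := nth (0, 0) [:: family_a (theta i) (P i) (Q i); family_b (theta i) eta;
                          family_c (theta i) (P i) (Q i) eta] (n %% 3)%N in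
  place i p.1 p.2.

Definition family : 'M[R]_(N * 3, 2) := \matrix_(r, j) family_point r ord0 j.

Lemma row_family (r : 'I_(N * 3)) : row r family = family_point r.
Proof. by apply/rowP => j; rewrite !mxE. Qed.

Lemma theta_ord (i : 'I_N) : theta i = y ord0 i / 10.
Proof. by rewrite /theta insubT //= => h; congr (y ord0 _ / 10); apply: val_inj. Qed.

Lemma position_family (v : 'I_(N * 3 + ((N * 2).+1 + (N * 5).+2))) : inner v ->
  position family v = family_point v.
Proof.
move=> vk; have [r [vE ->]] := position_inner family vk.
by rewrite row_family vE.
Qed.

(** In the coordinates of the i-th gadget. *)
Definition next_a (i : nat) : R * R :=
  if (i.+1 < N)%N then ((family_a (theta i.+1) (P i.+1) (Q i.+1)).1 + 24, P i.+1 - Q i.+1 - 6)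
  else (21, -6).

Hypothesis N0 : (0 < N)%N.

Lemma family_positions i : (i < N)%N ->
  let a := family_a (theta i) (P i) (Q i) in let b := family_b (theta i) eta in
  let c := family_c (theta i) (P i) (Q i) eta in
  [/\ position family (vtx_a N i) = place i a.1 a.2,
      position family (vtx_b N i) = place i b.1 b.2,
      position family (vtx_c N i) = place i c.1 c.2 &
      position family (vtx_a N i.+1) = place i (next_a i).1 (next_a i).2].
Proof.
have aE j : (j < N)%N -> position family (vtx_a N j) =
    place j (family_a (theta j) (P j) (Q j)).1 (family_a (theta j) (P j) (Q j)).2.
  move=> jN; rewrite position_family ?inner_a // /family_point val_a //.
  by rewrite mulnK // modnMl.
move=> iN a b c; split; first exact: aE.
- rewrite position_family ?inner_b // /family_point val_b //.
  have -> : ((i * 3).+1 %/ 3 = i)%N by lia.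
  by have -> : ((i * 3).+1 %% 3 = 1)%N by lia.
- rewrite position_family ?inner_c // /family_point val_c //.
  have -> : ((i * 3).+2 %/ 3 = i)%N by lia.
  by have -> : ((i * 3).+2 %% 3 = 2)%N by lia.
rewrite /next_a; have [iN'|iN'] := ltnP i.+1 N; first by rewrite aE // place_succ.
have -> : i.+1 = N by apply/eqP; rewrite eqn_leq iN' andbT.
rewrite position_end // -{1}(prednK N0).
have -> : i = N.-1 by lia.
by rewrite place_succ; apply: plane_eq; rewrite !(px_place, py_place) /=; ring.
Qed.

Hypothesis y_le1 : `|y| <= 1.

Lemma theta_bound i : - (1 / 10) <= theta i <= 1 / 10.
Proof.
rewrite /theta; case: insubP => [j _ _|_]; last by lra.
have : `|y ord0 j| <= 1 := le_trans (entry_le_norm y ord0 j) y_le1.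
by rewrite ler_norml; lra.
Qed.

Lemma theta_sq i : 0 <= theta i * theta i <= 1 / 100.
Proof.
apply/andP; split; first by rewrite -expr2; exact: sqr_ge0.
by have := mul_bounds (theta_bound i) (theta_bound i); lra.
Qed.

Lemma P_bound i : 0 <= P i <= 1 / 100.
Proof. by elim: i => [|i IH]; rewrite /=; [lra | have := theta_sq i; move: IH; lra]. Qed.

Let w : R := 4^-1 ^+ N.
Let w_bound : 0 < w <= 1.
Proof.
by rewrite /w exprn_gt0 ?exprn_ile1 ?invr_ge0 ?invr_gt0 ?invf_le1 ?ler1n ?ltr0n.
Qed.

Lemma eta_bound : 0 < eta <= 1 / 2000.
Proof.
rewrite /eta -/w; have ww : 0 < w ^+ 2 <= 1.
  by case/andP: w_bound => w0 w1; rewrite exprn_gt0 // exprn_ile1 // ltW.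
move: ww; lra.
Qed.

Lemma Q_growth i : Q i + 2 * eta <= 3 * eta * 4 ^+ i.
Proof.
elim: i => [|i /= IH]; first by rewrite /= expr0; lra.
by have := eta_bound; rewrite exprS; move: IH; lra.
Qed.

Lemma Q_gt0 i : 0 < Q i.
Proof. by have := eta_bound; elim: i => [|i /= IH] h; [rewrite /=; lra | have := IH h; lra]. Qed.

Lemma Q_small i : (i <= N)%N -> Q i <= 3 / 2000 * w.
Proof.
move=> iN; have /andP[h2 _] := eta_bound.
have e4 : 4 ^+ i <= 4 ^+ N :> R by apply: ler_weXn2l => //; lra.
have wE : w * 4 ^+ N = 1 by rewrite /w -exprMn mulVf ?expr1n //; lra.
have : eta * 4 ^+ i <= eta * 4 ^+ N by rewrite ler_pM2l.
have -> : eta * 4 ^+ N = w / 2000.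
  by rewrite /eta -/w expr2 -!mulrA [2000^-1 * _]mulrC [w * (4 ^+ N * _)]mulrA wE mul1r.
have := Q_growth i; lra.
Qed.

Lemma Q_bound i : (i <= N)%N -> 0 < Q i <= 1 / 100.
Proof. by move=> /Q_small; have := Q_gt0 i; move: w_bound; lra. Qed.

(** One active gadget is enough for the budget P to outlive Q at the right end. *)
Lemma P_last : 2 / 5 <= `|y| -> w <= 625 * P N.
Proof.
move=> y25; have [j yj] : exists j, `|y ord0 j| = `|y| by apply: norm_attained; lra.
have tj : 1 / 625 <= theta j * theta j.
  have : 2 / 5 * (2 / 5) <= `|y ord0 j| * `|y ord0 j| by apply: ler_pM; rewrite ?yj //; lra.
  by rewrite -normrM ger0_norm -?expr2 ?sqr_ge0 // theta_ord expr2; lra.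
suff H i : (j < i)%N -> 4^-1 ^+ i <= 625 * P i by exact: H.
elim: i => // i IH; rewrite ltnS leq_eqVlt => /orP[/eqP ji|/IH h]; rewrite exprS /=.
  have /andP[Pi _] := P_bound i; rewrite -ji in Pi *.
  have : (4^-1 : R) ^+ j <= 1 by rewrite exprn_ile1 ?invr_ge0 ?invf_le1 ?ler1n ?ler0n.
  lra.
have := theta_sq i; move: h; lra.
Qed.

(** With P' and Q' for the next gadget, the depth of c is 2 P' - Q' / 2 and the
    height of the next a is P' - Q'; the critical face is a positive combination
    of P' and Q', at the right end a multiple of the depth. *)
Lemma next_a_faces i : (i < N)%N -> 2 / 5 <= `|y| ->
  0 < local_orient (family_c (theta i) (P i) (Q i) eta, next_a i, (15, -6)) /\
  0 < local_orient ((8, -10), next_a i, family_c (theta i) (P i) (Q i) eta).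
Proof.
move=> iN y25; rewrite /local_orient /next_a.
set g := (P i + theta i * theta i) / 2 - 2 * (Q i + eta).
have gE : g = 2 * P i.+1 - Q i.+1 / 2 by rewrite /g /=; field.
set p' := P i.+1 in gE *; set q' := Q i.+1 in gE *.
set x' := (family_a (theta i.+1) p' q').1.
have e_bd := eta_bound; have t_bd := theta_bound i; have tt_bd := theta_sq i.
have P_bd := P_bound i; have Q_bd := Q_bound (ltnW iN).
have g_bd : - (1 / 20) <= g <= 1 / 20 by move: P_bd Q_bd e_bd tt_bd; rewrite /g; lra.
have gt_bd := mul_bounds g_bd t_bd.
set c := family_c _ _ _ _; have c2 : c.2 = - 6 - g by [].
have cx : 58 / 10 <= c.1 <= 62 / 10.
  by move: g_bd gt_bd t_bd e_bd; rewrite /c /family_c -/g /=; lra.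
move: (c) c2 cx => [c1 c2] /= -> cx.
have P'_bd : 0 <= p' <= 1 / 100 := P_bound i.+1.
have Q'_bd : 0 < q' <= 1 / 100 := Q_bound iN.
case: ltnP => iN'; last first.
  have iE : i.+1 = N by apply/eqP; rewrite eqn_leq iN iN'.
  have Ql : q' <= 3 / 2000 * w by rewrite /q' iE; exact: Q_small.
  have Pl : w <= 625 * p' by rewrite /p' iE; exact: P_last.
  have g0 : 0 < g by move: w_bound Ql Pl; rewrite gE; lra.
  by split=> /=; lra.
set s' := p' - q'; set t' := theta i.+1.
have s'_bd : - (1 / 100) <= s' <= 1 / 100 by rewrite /s'; lra.
have st_bd := mul_bounds s'_bd (theta_bound i.+1).
have tt'_bd := theta_sq i.+1; have t'_bd := theta_bound i.+1.
have ax : - (1 / 4) <= x' <= 1 / 4.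
  by move: st_bd tt'_bd t'_bd s'_bd; rewrite /x' /family_a -/s' /= -/t'; lra.
clear e_bd t_bd tt_bd P_bd Q_bd gt_bd st_bd tt'_bd t'_bd y25.
split.
  have -> : (x' + 24 - c1) * (-6 - (-6 - g)) - (s' - 6 - (-6 - g)) * (15 - c1) =
     p' * (3 + 2 * x' + c1) + q' * (21 / 2 - c1 - x' / 2).
    by rewrite gE /s'; field.
  rewrite ltr_wpDl //.
    by apply: mulr_ge0; [case/andP: P'_bd | lra].
  by apply: mulr_gt0; [case/andP: Q'_bd | lra].
rewrite /=; have h1 : 15 * 3 <= (x' + 24 - 8) * (-6 - g - -10) by apply: ler_pM; lra.
have h2 : (s' - 6 - -10) * (c1 - 8) <= 0 by apply: mulr_ge0_le0; lra.
lra.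
Qed.

Theorem family_positive : 2 / 5 <= `|y| -> all_positive family.
Proof.
move=> y25; apply/all_positiveP; split.
  have [a0 _ _ _] := family_positions N0.
  rewrite a0 (position_low N0) // (position_upp N0) // (upper_O R N 0) /lower_chain orient_place /=.
  by have := eta_bound; lra.
move=> i iN; have [aE bE cE a'E] := family_positions iN.
rewrite (gadget_local N0 iN aE bE cE a'E).
have [h1 h2] := next_a_faces iN y25.
have e_bd := eta_bound; have P_bd := P_bound i; have Q_bd := Q_bound (ltnW iN).
have t_bd := theta_bound i; have tt_bd := theta_sq i.
apply: family_gadget => //; first by lra.
have s_bd : - (1 / 100) <= P i - Q i <= 1 / 100 by lra.
have st_bd := mul_bounds s_bd t_bd.
move: (theta i) (P i) (Q i) st_bd tt_bd s_bd t_bd => t p q st_bd tt_bd s_bd t_bd.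
by rewrite /local_orient /start_x /start_y; case: (i) => [|_]; rewrite /family_a /=; lra.
Qed.

Lemma tilt_family (i : 'I_N) : tilt family ord0 i =
  y ord0 i / 10 * (4 + 2 * theta i - (P i - Q i) / 3).
Proof.
have [aE _ _ _] := family_positions (ltn_ord i).
rewrite mxE aE; have [-> ->] := local_placeE i (family_a (theta i) (P i) (Q i)).1 (family_a (theta i) (P i) (Q i)).2.
by rewrite family_tilt -theta_ord.
Qed.

Lemma tilt_factor_gt0 i : (i < N)%N -> 0 < 4 + 2 * theta i - (P i - Q i) / 3.
Proof.
by move=> iN; have := theta_bound i; have := P_bound i; have := Q_bound (ltnW iN); lra.
Qed.
End OnePoint.

Lemma cont_theta i : continuous (fun y => theta y i).
Proof. by rewrite /theta; case: insub => [j|]; cont_tac. Qed.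

Lemma cont_budget i : continuous (fun y => (budget y i).1) /\ continuous (fun y => (budget y i).2).
Proof.
elim: i => [|i [c1 c2]] /=; first by split; cont_tac.
by have ct := cont_theta (i := i); split; cont_tac.
Qed.

Lemma cont_place (T : topologicalType) i (f h : T -> R) : continuous f -> continuous h ->
  continuous (fun x => place i (f x) (h x)).
Proof.
by move=> cf ch; apply: cont_mx => a b; under eq_fun do rewrite mxE; case: (b == ord0); cont_tac.
Qed.

Lemma cont_local_points (T : topologicalType) (h : R) (t p q : T -> R) (e : nat) :
  continuous t -> continuous p -> continuous q ->
  let v x := nth (0, 0) [:: family_a (t x) (p x) (q x); family_b (t x) h;
                            family_c (t x) (p x) (q x) h] e in
  continuous (fun x => (v x).1) /\ continuous (fun x => (v x).2).
Proof.
move=> ct cp cq; case: e => [|[|[|e]]]; rewrite /family_a /family_b /family_c /= ?nth_nil /=.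
all: split; cont_tac.
Qed.

Lemma cont_family : continuous family.
Proof.
apply: cont_mx => r j; under eq_fun do rewrite mxE; apply: cont_entry.
have [c1 c2] := cont_budget (r %/ 3)%N.
have [v1 v2] := cont_local_points eta (r %% 3)%N (cont_theta (i := (r %/ 3)%N)) c1 c2.
exact: cont_place v1 v2.
Qed.

Lemma cont_position v : continuous (fun x : 'M[R]_(N * 3, 2) => position x v).
Proof.
rewrite /position; case: (fintype.split v) => [i|j]; last by move=> x; exact: cst_continuous.
by apply: cont_mx => a b; under eq_fun do rewrite mxE; cont_tac.
Qed.

Lemma cont_tilt : continuous (@tilt R N).
Proof.
apply: cont_mx => a i; under eq_fun do rewrite mxE.
have c := cont_position (v := vtx_a N i).
by rewrite /local_x /local_y /px /py; cont_tac.
Qed.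
End Family.

(** * Nontrivial homotopy groups *)

Theorem theorem1p1 (R : realType) (n : nat) (hn : (0 < n)%N) :
  exists (m k : nat) (phi : 'I_m -> 'rV[R]_2) (T : complex2 (k + m)),
    [/\ embedded_polygon phi,
        is_triangulation phi T &
        exists2 x0 : 'M[R]_(k, 2),
          geodesic_space phi T x0 &
          pi_nontrivial R n (geodesic_space phi T) x0].
Proof.
pose N := n.+1; have N0 : (0 < N)%N by [].
have [s1 s2] := south_bounds R n.
have ref : all_positive (family (south R n)) := family_positive N0 s1 s2.
exists ((N * 2).+1 + (N * 5).+2)%N, (N * 3)%N, (@corridor_polygon R N), (complex_of (corridor N)).
split.
- exact: mono_embedded (corridor_chains R N0).
- exact: corridor_triangulation ref.
exists (family (south R n)); first exact: positive_geodesic.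
apply: (@sphere_obstruction R n _ _ (@family R N) (@tilt R N)).
- exact: cont_family.
- exact: cont_tilt.
- by move=> y y1 y2; apply: positive_geodesic => //; exact: family_positive.
- by move=> x /(geodesic_positive N0 ref) /(tilt_neq0 N0).
- move=> y i y1 yi; rewrite tilt_family // mulr_ge0 //; first by rewrite divr_ge0.
  by rewrite ltW // tilt_factor_gt0.
move=> y i y1 yi; rewrite tilt_family // mulr_le0_ge0 //; first by rewrite pmulr_lle0 // invr_gt0.
by rewrite ltW // tilt_factor_gt0.
Qed.
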